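(* Let $S$ be a local Noetherian domain with maximal ideal $N$ and quotient field $F$; let $V$ be a DVR that birationally dominates $S$ such that $V/NV$ is a finite extension of $S/N$ of degree $m$ (that is, $V/NV$ has finite dimension $m$ over $S/N$); and let $R$ be a Noetherian subring of $S$ that is twisted by a nonzero torsion-free finite rank $V$-module $K$ along some multiplicatively closed subset $C$ of $S$ containing a nonunit of $S$. Let $M$ be the maximal ideal of the (necessarily local) ring $R$. Let $I$ and $J$ be ideals of $R$ contracted from $S$ such that $J$ is $M$-primary and $I$ meets $C$. Then: (1) $\mu_R(I)=\mu_S(IS)+m\cdot r_K$; (2) $\operatorname{emb.dim}R=\operatorname{emb.dim}S+m\cdot r_K$; (3) the multiplicity of $J$ on $I$ is $$e(J,I)=e(JS,S)+\begin{cases} r_K\cdot\operatorname{length}(V/JV) & \text{if }\dim(S)=1,\\ 0 & \text{if }\dim(S)>1;\end{cases}$$ (4) the multiplicity of the local ring $R$ is $$e(R)=e(S)+\begin{cases} m\cdot r_K & \text{if }\dim(S)=1,\\ 0 & \text{if }\dim(S)>1.\end{cases}$$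
   Context: All rings are commutative with identity. A DVR is a rank one discrete valuation ring (a local PID that is not a field). $V$ birationally dominates $S$ if $S\subseteq V\subseteq F$ and the maximal ideal of $V$ contracts to $N$ (equivalently $NV\ne V$). $\mathfrak M_V$ is the maximal ideal of $V$ and $r_K=\dim_{V/\mathfrak M_V}K/\mathfrak M_VK$. $\operatorname{length}(V/JV)$ is the length as an $S$-module. An ideal $I$ of a subring $R\subseteq S$ is contracted from $S$ if $I=IS\cap R$; it meets $C$ if $I\cap C\neq\emptyset$. $\mu_A(L)$ is the minimal number of generators of an $A$-module $L$; $\operatorname{emb.dim}A=\mu_A(\mathfrak m)$ for $(A,\mathfrak m)$ local Noetherian. For a local Noetherian ring $(A,\mathfrak m)$ of Krull dimension $d\ge1$, an $\mathfrak m$-primary ideal $J$ and a finitely generated $A$-module $L$, $e(J,L)$ is the multiplicity of $J$ on $L$: the Hilbert polynomial $P_{J,L}(X)\in\mathbb Q[X]$ satisfies $P_{J,L}(n)=\operatorname{length}_A(J^nL/J^{n+1}L)$ for $n\gg0$, and $e(J,L)/(d-1)!$ is its coefficient of $X^{d-1}$. Put $e(A)=e(\mathfrak m,A)$. A derivation $D:B\to L$ from a ring $B$ to a $B$-module $L$ is an additive map with $D(st)=sD(t)+tD(s)$; $\ker D$ is its additive kernel. Twisted subring: let $S$ be a ring, $K$ an $S$-module, $C$ a multiplicatively closed subset of nonzerodivisors of $S$ that are also nonzerodivisors on $K$, and view $S\subseteq S_C$, $K\subseteq K_C$ (localizations at $C$). A subring $R$ of $S$ is twisted by $K$ along $C$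 if there is a derivation $D:S_C\to K_C$ with $D(c)=0$ for all $c\in C$ such that (a) $R=S\cap D^{-1}(K)$; (b) $D(S_C)$ generates $K_C$ as an $S_C$-module; (c) $S\subseteq \ker D+cS$ for all $c\in C$. In particular $C\subseteq R$.
   Formalization: In (1) the ideal I is assumed to be proper: I = R is contracted from S and meets C, but there the formula would read 1 = 1 + m·r_K, which is false whenever r_K > 0. *)

(* Defs.v *)
From HB Require Import structures.
From mathcomp Require Import all_boot all_order all_algebra.
From mathcomp Require Import boolp classical_sets.

Set Implicit Arguments.
Unset Strict Implicit.
Unset Printing Implicit Defensive.

Import Order.TTheory GRing.Theory Num.Theory.

Local Open Scope classical_set_scope.
Local Open Scope ring_scope.

(* An inclusion of rings A ⊆ B is an injective ring morphism A -> B.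
   Submodules and ideals are classical sets; ideals of A are the submodules
   of the regular module A^o. *)

Section Submodules.
Variables (A : comNzRingType) (L : lmodType A).

(* cf. [submod_closed] of MathComp, for classical sets *)
Definition is_submod (P : set L) : Prop :=
  P 0 /\ forall (a : A) (x y : L), P x -> P y -> P (a *: x + y).

Definition span (X : set L) : set L := smallest is_submod X.

(* I P, generated by the products a x with a in I and x in P *)
Definition smul (I : set A) (P : set L) : set L :=
  span [set y | exists a x, [/\ I a, P x & y = a *: x]].

(* I^n P; in particular I^0 P = P *)
Definition pow_smul (I : set A) (n : nat) (P : set L) : set L :=
  iter n (smul I) P.

Definition generated_by (P : set L) (n : nat) : Prop :=
  exists x : 'I_n -> L, P = span (range x).

(* minimal number of generators (0 if P is not finitely generated) *)
Definition mu (P : set L) : nat := infimum 0%N (generated_by P).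

(* P ⊆ c_0 ⊊ c_1 ⊊ ... ⊊ c_n ⊆ Q: the chains of length n of submodules
   of the subquotient Q / P *)
Definition submod_chain (Q P : set L) (n : nat) : Prop :=
  exists c : 'I_n.+1 -> set L,
    (forall i, [/\ is_submod (c i), P `<=` c i & c i `<=` Q]) /\
    (forall i j : 'I_n.+1, (i < j)%N -> c i `<` c j).

(* length of the A-module Q / P for submodules P ⊆ Q of L
   (0 if the length is infinite) *)
Definition length_quot (Q P : set L) : nat :=
  supremum 0%N (submod_chain Q P).

(* the classes of x_0, ..., x_(n-1) form a basis of L / m L over A / m *)
Definition fiber_basis (m : set A) (n : nat) (x : 'I_n -> L) : Prop :=
  (forall y : L, exists a : 'I_n -> A,
     smul m setT (y - \sum_(i < n) a i *: x i)) /\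
  (forall a : 'I_n -> A,
     smul m setT (\sum_(i < n) a i *: x i) -> forall i, m (a i)).

(* L / m L has finite dimension n over the field A / m *)
Definition has_fiber_dim (m : set A) (n : nat) : Prop :=
  exists x : 'I_n -> L, fiber_basis m x.

(* dimension of L / m L over A / m (0 if infinite) *)
Definition fiber_dim (m : set A) : nat := xget 0%N (has_fiber_dim m).

Definition torsion_free : Prop :=
  forall (a : A) (x : L), a *: x = 0 -> a = 0 \/ x = 0.

Definition lin_indep (n : nat) (x : 'I_n -> L) : Prop :=
  forall a : 'I_n -> A, \sum_(i < n) a i *: x i = 0 -> forall i, a i = 0.

(* the number of elements of a linearly independent family is bounded *)
Definition finite_rank : Prop :=
  exists r : nat, forall n (x : 'I_n -> L), lin_indep x -> (n <= r)%N.

End Submodules.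

Section Ideals.
Variable A : comNzRingType.

Definition is_ideal (I : set A) : Prop := is_submod (I : set A^o).

Definition is_prime (P : set A) : Prop :=
  [/\ is_ideal P, ~ P 1 & forall x y, P (x * y) -> P x \/ P y].

Definition is_maximal (M : set A) : Prop :=
  [/\ is_ideal M, ~ M 1 &
      forall I, is_ideal I -> M `<=` I -> I = M \/ I = setT].

Definition local_ring (M : set A) : Prop :=
  is_maximal M /\ forall M', is_maximal M' -> M' = M.

Definition noetherian : Prop :=
  forall I : set A, is_ideal I -> exists n, generated_by (I : set A^o) n.

Definition radical (I : set A) : set A := [set x | exists n, I (x ^+ n)].

(* J is primary, with radical M *)
Definition is_primary (M J : set A) : Prop :=
  [/\ is_ideal J, ~ J 1,
      forall x y, J (x * y) -> J x \/ exists n, J (y ^+ n)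
    & radical J = M].

Definition prime_chain (n : nat) : Prop :=
  exists p : 'I_n.+1 -> set A,
    (forall i, is_prime (p i)) /\
    (forall i j : 'I_n.+1, (i < j)%N -> p i `<` p j).

(* 0 if the dimension is infinite, which cannot happen for a local
   Noetherian ring *)
Definition krull_dim : nat := supremum 0%N prime_chain.

Definition emb_dim (M : set A) : nat := mu (M : set A^o).

Definition is_dvr (M : set A) : Prop :=
  [/\ local_ring M,
      forall I, is_ideal I -> exists x : A, I = [set a * x | a in setT]
    & exists x, x <> 0 /\ M x].

End Ideals.

Arguments noetherian A : clear implicits.
Arguments krull_dim A : clear implicits.

(* the ideal generated by the image of I *)
Definition extension (A B : comNzRingType) (f : A -> B) (I : set A) : set B :=
  span (f @` I : set B^o).

Definition contracted (A B : comNzRingType) (f : A -> B) (I : set A) : Prop :=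
  I = f @^-1` (extension f I).

Section Multiplicity.
Variables (A : comNzRingType) (L : lmodType A) (J : set A) (Q : set L).

Definition is_hilbert_poly (P : {poly rat}) : Prop :=
  exists n0 : nat, forall n : nat, (n0 <= n)%N ->
    P.[n%:R] = (length_quot (pow_smul J n Q) (pow_smul J n.+1 Q))%:R.

Definition hilbert_poly : {poly rat} := xget 0 is_hilbert_poly.

(* The multiplicity e(J, Q) for A local Noetherian of dimension d >= 1,
   J primary to the maximal ideal and Q a finitely generated submodule of L:
   the coefficient of X^(d-1) in the Hilbert polynomial is e(J, Q) / (d-1)!. *)
Definition multiplicity : rat :=
  ((krull_dim A).-1)`!%:R * hilbert_poly`_(krull_dim A).-1.

End Multiplicity.

(* e(A), where M is the maximal ideal of A *)
Definition ring_multiplicity (A : comNzRingType) (M : set A) : rat :=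
  multiplicity M [set: A^o].

(* L viewed as an A-module through f : A -> B *)
Definition restrict_scalars (A B : comNzRingType) (f : {rmorphism A -> B})
  (L : lmodType B) : Type := L.

Section RestrictScalars.
Variables (A B : comNzRingType) (f : {rmorphism A -> B}) (L : lmodType B).
Local Notation rL := (restrict_scalars f L).

HB.instance Definition _ := GRing.Zmodule.on rL.

Definition restrict_scale (a : A) (x : rL) : rL := f a *: (x : L).

Fact restrict_scaleA a b x :
  restrict_scale a (restrict_scale b x) = restrict_scale (a * b) x.
Proof. by rewrite /restrict_scale scalerA rmorphM. Qed.

Fact restrict_scale1 : left_id 1 restrict_scale.
Proof. by move=> x; rewrite /restrict_scale rmorph1 scale1r. Qed.

Fact restrict_scaleDr : right_distributive restrict_scale +%R.
Proof. by move=> a x y; rewrite /restrict_scale scalerDr. Qed.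

Fact restrict_scaleDl x : {morph restrict_scale^~ x : a b / a + b}.
Proof. by move=> a b; rewrite /restrict_scale rmorphD scalerDl. Qed.

HB.instance Definition _ := GRing.Zmodule_isLmodule.Build A rL
  restrict_scaleA restrict_scale1 restrict_scaleDr restrict_scaleDl.

End RestrictScalars.

(* V is a subring of the quotient field of S containing S, and its maximal
   ideal MV contracts to N *)
Definition birationally_dominates (S V : idomainType) (jS : {rmorphism S -> V})
    (jV : {rmorphism V -> {fraction S}}) (N : set S) (MV : set V) : Prop :=
  [/\ injective jV, forall s : S, jV (jS s) = tofrac s & jS @^-1` MV = N].

(* Whether 1 is required to be in C is immaterial: adjoining 1 to C changes
   neither the localizations at C nor the property of being twisted. *)
Definition mul_closed (S : comNzRingType) (C : set S) : Prop :=
  forall c d, C c -> C d -> C (c * d).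

(* j : S -> SC is the localization of S at C *)
Definition is_localization (S SC : comNzRingType) (C : set S)
    (j : {rmorphism S -> SC}) : Prop :=
  [/\ forall c, C c -> exists u, j c * u = 1,
      forall x, exists c s, C c /\ j c * x = j s
    & forall s, j s = 0 -> exists2 c, C c & c * s = 0].

(* jK : K -> KC is the localization at C of the S-module K *)
Definition is_mod_localization (S SC : comNzRingType) (C : set S)
    (j : {rmorphism S -> SC}) (K : lmodType S) (KC : lmodType SC)
    (jK : {additive K -> KC}) : Prop :=
  [/\ forall s k, jK (s *: k) = j s *: jK k,
      forall x, exists c k, C c /\ j c *: x = jK k
    & forall k, jK k = 0 -> exists2 c, C c & c *: k = 0].

Definition is_derivation (B : comNzRingType) (L : lmodType B)
    (D : {additive B -> L}) : Prop :=
  forall s t, D (s * t) = s *: D t + t *: D s.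

(* The set R is the subring of S twisted by K along C. *)
Definition twisted (S : comNzRingType) (K : lmodType S) (C R : set S) : Prop :=
  [/\ mul_closed C,
      forall c, C c -> GRing.lreg c,
      forall c, C c -> injective (fun k : K => c *: k)
    & exists (SC : comNzRingType) (j : {rmorphism S -> SC})
             (KC : lmodType SC) (jK : {additive K -> KC})
             (D : {additive SC -> KC}),
        [/\ is_localization C j, is_mod_localization C j jK & is_derivation D] /\
        [/\ forall c, C c -> D (j c) = 0,
            R = [set s | exists k, D (j s) = jK k],
            span (range D) = setT
          & forall c s, C c ->
              exists (x : SC) (t : S), D x = 0 /\ j s = x + j (c * t)]].

(* Main.v *)
(* A twisted subring R of S behaves like the idealization S ⋆ K: writing dR for
   the restriction to R of the derivation (with values in K), every c in C
   satisfies S = ker dR + cS and dR maps cS ∩ R onto K modulo cK, so that the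
   ideals {r | r in a, dR r in L} have over R the length of a plus that of L,
   and multiply like the ideals a ⋆ L of S ⋆ K. An ideal I of R contracted from
   S and meeting C is IS ⋆ K. With x a uniformizer of V and v its valuation,
   J^n I = J^n IS ⋆ x^(l_n) K where l_(n+1) - l_n = v(J) for n > 0, so that the
   Hilbert function of I over R is that of IS over S plus r_K length (V / JV).
   Minimal numbers of generators are the lengths of I / MI and follow likewise.

   To compare coefficients of Hilbert polynomials one needs their existence,
   the equality e(JS, IS) = e(JS, S) and dim R = dim S. For generators
   x_1, ..., x_r of J, filter J^n by monomials in lexicographic order: the ideal
   of coefficients occurring in front of a leading monomial u is monotone in u,
   so by Dickson's lemma it depends only on u truncated at some h. This gives
   both the Artin-Rees lemma and the polynomiality of Hilbert functions; the
   dimension is then the order of growth of length (A / J^k). *)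
Require Import Defs.
From HB Require Import structures.
From mathcomp Require Import all_boot all_order all_algebra.
From mathcomp Require Import boolp classical_sets.
From mathcomp Require Import zify ring lra.
Import Defs.
Set Implicit Arguments.
Unset Strict Implicit.
Unset Printing Implicit Defensive.
Import Order.TTheory GRing.Theory Num.Theory.
Local Open Scope classical_set_scope.
Local Open Scope ring_scope.

(** * Submodules and ideals *)

(** [length_quot] is a supremum with default value 0, so counting is done with the relation
    [has_length], which asserts finiteness; [length_quot] is evaluated only where a finite length is
    at hand. The localizations disappear in [twisted_twisting]: the record [twisting] keeps what is
    left of the derivation on [R], and linearity over [S] becomes linearity over the kernel of [dR]
    up to multiples of some [c] in [C]. This is why the ideals that are compared must contain an
    element of [C]. The product of [m] and r_K arises as the length over [S] of K / NK: if NV = x^t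
    V and V / xV has length e over [S], then m = t e, while K / xK has length r_K e and K / NK has
    length t r_K e. [K] may fail to be finitely generated over [V]; finite rank enters only to make
    K / xK finite dimensional. The restriction n > 0 on the increments of l_n comes from l_0 = 0 and
    l_1 = min(v(J), v(I)): the first value of the Hilbert function is irregular, which the Hilbert
    polynomial does not see. *)

Section Submodules.
Variables (A : comNzRingType) (L : lmodType A).
Implicit Types (P Q T X : set L) (I J : set A).

Lemma submod0 P : is_submod P -> P 0.
Proof. by case. Qed.

Lemma submodD P x y : is_submod P -> P x -> P y -> P (x + y).
Proof. by move=> [_ h] px py; rewrite -[x]scale1r; apply: h. Qed.

Lemma submodZ P a x : is_submod P -> P x -> P (a *: x).
Proof. by move=> [p0 h] px; rewrite -[_ *: _]addr0; apply: h. Qed.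

Lemma submodN P x : is_submod P -> P x -> P (- x).
Proof. by move=> sP px; rewrite -scaleN1r; apply: submodZ. Qed.

Lemma submodB P x y : is_submod P -> P x -> P y -> P (x - y).
Proof. by move=> sP px py; apply: submodD => //; apply: submodN. Qed.

Lemma submodDl P x y : is_submod P -> P x -> P (x + y) -> P y.
Proof. by move=> sP px pxy; rewrite -[y](addKr x); apply: submodD => //; apply: submodN. Qed.

Lemma submodDr P x y : is_submod P -> P y -> P (x + y) -> P x.
Proof. by rewrite addrC; apply: submodDl. Qed.

Lemma eqm_refl P x : is_submod P -> P (x - x).
Proof. by move=> sP; rewrite subrr; apply: submod0. Qed.

Lemma eqm_sym P x y : is_submod P -> P (x - y) -> P (y - x).
Proof. by move=> sP h; rewrite -opprB; apply: submodN. Qed.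

Lemma eqm_trans P y x z : is_submod P -> P (x - y) -> P (y - z) -> P (x - z).
Proof. by move=> sP h h'; rewrite -(subrK y x) -addrA; apply: submodD. Qed.

Lemma eqmD P x y x' y' : is_submod P -> P (x - x') -> P (y - y') -> P (x + y - (x' + y')).
Proof. by move=> sP h h'; rewrite opprD addrACA; apply: submodD. Qed.

Lemma eqmZ P a x y : is_submod P -> P (x - y) -> P (a *: x - a *: y).
Proof. by move=> sP h; rewrite -scalerBr; apply: submodZ. Qed.

Lemma eqm_in P Q x y : is_submod Q -> P `<=` Q -> P (x - y) -> Q y -> Q x.
Proof. by move=> sQ PQ h Qy; rewrite -(subrK y x); apply: submodD => //; apply: PQ. Qed.

Lemma submodT : is_submod [set: L].
Proof. by []. Qed.

Lemma submod_zero : is_submod [set (0 : L)].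
Proof. by split=> // a x y -> ->; rewrite scaler0 addr0. Qed.

Lemma submodI P Q : is_submod P -> is_submod Q -> is_submod (P `&` Q).
Proof.
move=> [p0 p] [q0 q]; split=> // a x y [? ?] [? ?].
by split; [apply: p|apply: q].
Qed.

Lemma span_submod X : is_submod (span X).
Proof.
split=> [B [[b0 _] _] //|a x y hx hy B hB].
by case: (hB) => -[_ h] _; apply: h; [apply: hx|apply: hy].
Qed.

Lemma sub_span X : X `<=` span X.
Proof. exact: sub_gen_smallest. Qed.

Lemma span_min X P : is_submod P -> X `<=` P -> span X `<=` P.
Proof. exact: smallest_sub. Qed.

Lemma spanS X Y : X `<=` Y -> span X `<=` span Y.
Proof.
move=> h; apply: span_min; first exact: span_submod.
by move=> x /h; apply: sub_span.
Qed.

Definition sadd P Q : set L := [set z | exists x y, [/\ P x, Q y & z = x + y]].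

Lemma sadd_submod P Q : is_submod P -> is_submod Q -> is_submod (sadd P Q).
Proof.
move=> sP sQ; split.
  by exists 0, 0; rewrite addr0; split=> //; apply: submod0.
move=> a _ _ [x [y [px qy ->]]] [x' [y' [px' qy' ->]]].
exists (a *: x + x'), (a *: y + y'); split; first by apply: sP.2.
  by apply: sQ.2.
by rewrite scalerDr addrACA.
Qed.

Lemma saddSl P Q : is_submod Q -> P `<=` sadd P Q.
Proof. by move=> sQ x px; exists x, 0; rewrite addr0; split=> //; apply: submod0. Qed.

Lemma saddSr P Q : is_submod P -> Q `<=` sadd P Q.
Proof. by move=> sP x qx; exists 0, x; rewrite add0r; split=> //; apply: submod0. Qed.

Lemma sadd_min P Q T : is_submod T -> P `<=` T -> Q `<=` T -> sadd P Q `<=` T.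
Proof. by move=> sT pt qt _ [x [y [/pt ? /qt ? ->]]]; apply: submodD. Qed.

Lemma saddS P Q P' Q' : P `<=` P' -> Q `<=` Q' -> sadd P Q `<=` sadd P' Q'.
Proof. by move=> h h' _ [x [y [px qy ->]]]; exists x, y; split; [exact: h|exact: h'|]. Qed.

Lemma saddC P Q : sadd P Q = sadd Q P.
Proof.
by apply/seteqP; split=> _ [x [y [? ? ->]]]; exists y, x; rewrite addrC; split.
Qed.

Lemma saddA P Q T : sadd P (sadd Q T) = sadd (sadd P Q) T.
Proof.
apply/seteqP; split.
  move=> _ [x [_ [px [y [z [qy tz ->]]] ->]]].
  by exists (x + y), z; rewrite addrA; split=> //; exists x, y; split.
move=> _ [_ [z [[x [y [px qy ->]]] tz ->]]].
by exists x, (y + z); rewrite addrA; split=> //; exists y, z; split.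
Qed.

Lemma sadd_idl P Q : is_submod P -> is_submod Q -> P `<=` Q -> sadd P Q = Q.
Proof.
move=> sP sQ pq; apply/seteqP; split; first exact: sadd_min.
exact: saddSr.
Qed.

Definition cyc (x : L) : set L := [set z | exists a : A, z = a *: x].

Lemma cyc_submod x : is_submod (cyc x).
Proof.
split; first by exists 0; rewrite scale0r.
move=> a _ _ [b ->] [c ->]; exists (a * b + c).
by rewrite scalerDl scalerA.
Qed.

Lemma cycid x : cyc x x.
Proof. by exists 1; rewrite scale1r. Qed.

Lemma cyc_min x P : is_submod P -> P x -> cyc x `<=` P.
Proof. by move=> sP px _ [a ->]; apply: submodZ. Qed.

Lemma smul_submod I P : is_submod (smul I P).
Proof. exact: span_submod. Qed.

Lemma smulP I P a x : I a -> P x -> smul I P (a *: x).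
Proof. by move=> Ia Px; apply: sub_span; exists a, x; split. Qed.

Lemma smul_min I P T : is_submod T ->
  (forall a x, I a -> P x -> T (a *: x)) -> smul I P `<=` T.
Proof. by move=> sT h; apply: span_min => // _ [a [x [Ia Px ->]]]; apply: h. Qed.

Lemma smulS I J P Q : I `<=` J -> P `<=` Q -> smul I P `<=` smul J Q.
Proof.
move=> ij pq; apply: smul_min; first exact: smul_submod.
by move=> a x /ij Ja /pq Qx; apply: smulP.
Qed.

Lemma smul_subr I P : is_submod P -> smul I P `<=` P.
Proof. by move=> sP; apply: smul_min => // a x _; apply: submodZ. Qed.

Lemma smul_addr I P Q : is_submod P -> is_submod Q ->
  smul I (sadd P Q) = sadd (smul I P) (smul I Q).
Proof.
move=> sP sQ; apply/seteqP; split; last first.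
  by apply: sadd_min; [exact: smul_submod| |]; apply: smulS => //;
    [exact: saddSl|exact: saddSr].
apply: smul_min; first by apply: sadd_submod; apply: smul_submod.
move=> a _ Ia [x [y [px qy ->]]]; exists (a *: x), (a *: y).
by rewrite scalerDr; split=> //; apply: smulP.
Qed.

Lemma pow_smul_submod I P n : is_submod P -> is_submod (pow_smul I n P).
Proof. by move=> sP; case: n => [//|n]; apply: smul_submod. Qed.

Lemma pow_smulS I P Q n : P `<=` Q -> pow_smul I n P `<=` pow_smul I n Q.
Proof. by move=> h; elim: n => [//|n IH]; apply: smulS. Qed.

Lemma pow_smul_dec I P n : is_submod P -> pow_smul I n.+1 P `<=` pow_smul I n P.
Proof. by move=> sP; apply: smul_subr; apply: pow_smul_submod. Qed.

Lemma pow_smul_le I P m n : is_submod P -> (m <= n)%N ->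
  pow_smul I n P `<=` pow_smul I m P.
Proof.
move=> sP /subnK <-; elim: (n - m)%N => [//|k IH].
by rewrite addSn; apply: subset_trans IH; apply: pow_smul_dec.
Qed.

Lemma pow_smul_addr I P Q n : is_submod P -> is_submod Q ->
  pow_smul I n (sadd P Q) = sadd (pow_smul I n P) (pow_smul I n Q).
Proof.
move=> sP sQ; elim: n => [//|n IH] /=.
by rewrite IH smul_addr //; apply: pow_smul_submod.
Qed.

Lemma pow_smul_subr I P n : is_submod P -> pow_smul I n P `<=` P.
Proof. by move=> sP; exact: (@pow_smul_le I P 0 n). Qed.

Lemma span_seq_cons (y : L) (s : seq L) :
  span [set` y :: s] = sadd (span [set` s]) (cyc y).
Proof.
apply/seteqP; split.
  apply: (span_min (sadd_submod (span_submod _) (cyc_submod _))) => z /=.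
  rewrite inE => /orP[/eqP ->|zs].
    by apply: saddSr; [exact: span_submod|exact: cycid].
  by apply: saddSl; [exact: cyc_submod|exact: sub_span].
apply: (sadd_min (span_submod _)).
  by apply: spanS => z /= zs; rewrite inE zs orbT.
by apply: (cyc_min (span_submod _)); apply: sub_span; rewrite /= mem_head.
Qed.

Lemma span_nil : span [set` [::] : seq L] = [set 0].
Proof.
apply/seteqP; split; first exact: span_min submod_zero _.
by move=> _ ->; apply: submod0 (span_submod _).
Qed.

End Submodules.

Section Ideals.
Variable A : comNzRingType.
Implicit Types (I J P : set A).

Lemma ideal0 I : is_ideal I -> I 0.
Proof. exact: (@submod0 _ A^o). Qed.

Lemma idealD I x y : is_ideal I -> I x -> I y -> I (x + y).
Proof. exact: (@submodD _ A^o). Qed.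

Lemma idealB I x y : is_ideal I -> I x -> I y -> I (x - y).
Proof. exact: (@submodB _ A^o). Qed.

Lemma idealN I x : is_ideal I -> I x -> I (- x).
Proof. exact: (@submodN _ A^o). Qed.

Lemma idealMl I a x : is_ideal I -> I x -> I (a * x).
Proof. exact: (@submodZ _ A^o). Qed.

Lemma idealMr I a x : is_ideal I -> I x -> I (x * a).
Proof. by move=> iI; rewrite mulrC; apply: idealMl. Qed.

Lemma idealT : is_ideal [set: A].
Proof. by []. Qed.

Lemma ideal1 I : is_ideal I -> I 1 -> I = setT.
Proof. by move=> iI I1; apply/seteqP; split=> // x _; rewrite -[x]mulr1; apply: idealMl. Qed.

Lemma span_scale_ring (L : lmodType A) (P : set L) (X : set A^o) :
  is_submod P -> smul (span X) P `<=` span [set y | exists a x, [/\ X a, P x & y = a *: x]].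
Proof.
move=> sP; apply: smul_min; first exact: span_submod.
move=> a x + Px; move: a; apply: span_min => [|a Xa]; last first.
  by apply: sub_span; exists a, x; split.
split; first by rewrite /= scale0r; apply: submod0 (span_submod _).
move=> b u v /= hu hv; rewrite scalerDl -scalerA.
by apply: (span_submod _).2.
Qed.

Lemma sadd_ideal (I J : set A) : is_ideal I -> is_ideal J -> is_ideal (sadd (I : set A^o) J).
Proof. exact: (@sadd_submod A A^o). Qed.

Definition colon (P : set A) (a : A) : set A := [set x | P (x * a)].

Lemma colon_ideal P a : is_ideal P -> is_ideal (colon P a).
Proof.
move=> iP; split; first by rewrite /colon /= mul0r; apply: ideal0.
move=> b x y hx hy; change (P ((b * x + y) * a)); rewrite mulrDl -mulrA.
by apply: iP.2.
Qed.

End Ideals.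

(** * Length *)

Lemma proper_exists (T : Type) (P Q : set T) : P `<` Q -> exists2 x, Q x & ~ P x.
Proof.
move=> [_ h]; apply: contrapT => h'; apply: h => x Qx.
by apply: contrapT => nP; apply: h'; exists x.
Qed.

Lemma subset_proper_trans (T : Type) (P Q U : set T) : P `<=` Q -> Q `<` U -> P `<` U.
Proof.
move=> PQ [QU h]; split; first exact: subset_trans QU.
by move=> UP; apply: h; apply: subset_trans PQ.
Qed.

Lemma proper_subset_trans (T : Type) (P Q U : set T) : P `<` Q -> Q `<=` U -> P `<` U.
Proof.
move=> [PQ h] QU; split; first exact: subset_trans QU.
by move=> UP; apply: h; apply: subset_trans UP.
Qed.

Section Length.
Variables (A : comNzRingType) (L : lmodType A).
Implicit Types (P Q T X : set L).

(** Inductive form of [submod_chain] that peels off the bottom step; [Q] is only a bounding set,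
    which stays fixed during inductions. *)
Fixpoint has_chain (Q P : set L) (n : nat) : Prop :=
  if n is k.+1 then exists T, [/\ is_submod T, P `<` T & has_chain Q T k] else P `<=` Q.

Lemma has_chain_mono P Q P' Q' n : P' `<=` P -> Q `<=` Q' -> has_chain Q P n -> has_chain Q' P' n.
Proof.
elim: n P P' => [|n IH] P P' pp qq /=; first by move=> h x /pp /h /qq.
move=> [T [sT PT hT]]; exists T; split=> //; last exact: IH hT.
exact: subset_proper_trans PT.
Qed.

Lemma has_chain_sub P Q n : has_chain Q P n -> P `<=` Q.
Proof.
elim: n P => [//|n IH] P /= [T [_ PT /IH]]; apply: subset_trans.
exact: properW.
Qed.

Lemma has_chain_cat P T Q a b : has_chain T P a -> has_chain Q T b -> has_chain Q P (a + b).
Proof.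
move=> + hb; elim: a P => [|a IH] P /=; first by move=> h; apply: has_chain_mono hb.
by move=> [T' [? ? /IH h]]; exists T'; split.
Qed.

(** A strict step stays strict after intersecting with [T] or after adding [T], by the modular law,
    so it is counted in [a] or in [b]. This is the source of the additivity of length. *)
Lemma has_chain_split P Q T n : is_submod P -> is_submod Q -> is_submod T -> has_chain Q P n ->
  exists a b, [/\ (n <= a + b)%N, has_chain (Q `&` T) (P `&` T) a & has_chain (sadd Q T) (sadd P T) b].
Proof.
move=> + sQ sT; elim: n P => [|n IH] P sP /=.
  by move=> h; exists 0, 0; split=> //=; [apply: setSI|apply: saddS].
move=> [P' [sP' PP' /(IH _ sP') [a [b [nab ha hb]]]]].
have PP := properW PP'.
case: (pselect (P' `&` T `<=` P `&` T)) => h; last first.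
  exists a.+1, b; split=> //; last by apply: has_chain_mono hb => //; apply: saddS.
  exists (P' `&` T); split=> //; first exact: submodI.
  by split=> //; apply: setSI.
exists a, b.+1; split; first by rewrite addnS.
  by apply: has_chain_mono ha => //; apply: setSI.
exists (sadd P' T); split=> //; first exact: sadd_submod.
split; first exact: saddS.
have [x P'x nPx] := proper_exists PP'.
(* If x = p + t with p in [P], then t = x - p lies in both [P'] and [T], hence in [P], and so does
   x. *)
move=> /(_ x (saddSl sT P'x)) [p [t [Pp Tt e]]].
apply: nPx; rewrite e; apply: submodD => //.
suff: (P `&` T) t by case.
apply: h; split=> //.
have -> : t = x - p by rewrite e addrAC subrr add0r.
by apply: submodB => //; apply: PP.
Qed.

(** Unlike the value 0 of [length_quot], which may stand for an infinite length, this asserts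
    finiteness. *)
Definition has_length Q P n := has_chain Q P n /\ forall k, has_chain Q P k -> (k <= n)%N.

Lemma has_chain_submod_chain P Q n : is_submod P -> has_chain Q P n -> is_submod Q -> submod_chain Q P n.
Proof.
move=> sP + sQ; elim: n P sP => [|n IH] P sP /=.
  move=> PQ; exists (fun=> P); split; first by move=> i; split.
  by move=> i j; rewrite !ord1.
move=> [T [sT PT /(IH _ sT) [c [hc1 hc2]]]].
have TQ : T `<=` Q by have [_ h1 h2] := hc1 ord0; apply: subset_trans h2.
exists (fun i => if unlift ord0 i is Some j then c j else P); split.
  move=> i; case: unliftP => [j _|_]; last first.
    by split=> //; apply: subset_trans TQ; apply: properW.
  have [? h ?] := hc1 j; split=> //.
  by apply: subset_trans h; apply: properW.
move=> i j; case: (unliftP ord0 j) => [j' -> |->]; last by rewrite ltn0.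
case: (unliftP ord0 i) => [i' -> |->]; first by rewrite !lift0 ltnS; apply: hc2.
move=> _; have [_ h _] := hc1 j'.
exact: proper_subset_trans h.
Qed.

Lemma submod_chain_has_chain P Q n : is_submod P -> submod_chain Q P n -> has_chain Q P n.
Proof.
move=> sP; elim: n P sP => [|n IH] P sP [c [h1 h2]].
  by have [_ a b] := h1 ord0; apply: subset_trans b.
have [_ h0 _] := h1 ord0.
have lt1 := h2 ord0 (lift ord0 ord0) isT.
have [s1 _ _] := h1 (lift ord0 ord0).
exists (c (lift ord0 ord0)); split=> //; first exact: subset_proper_trans lt1.
apply: IH => //; exists (fun i => c (lift ord0 i)); split; last first.
  by move=> i j ij; apply: h2; rewrite !lift0.
move=> i; have [? ? ?] := h1 (lift ord0 i); split=> //.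
have [->//|i0] := eqVneq i ord0.
apply: properW; apply: h2; by rewrite !lift0 ltnS lt0n.
Qed.

Lemma has_length_length_quot P Q n : is_submod P -> is_submod Q -> has_length Q P n ->
  length_quot Q P = n.
Proof.
move=> sP sQ [h1 h2]; rewrite /length_quot /supremum.
have mem : submod_chain Q P n by apply: has_chain_submod_chain.
case: eqP => [e|_]; first by rewrite e in mem.
have hs : supremums (submod_chain Q P) n.
  split; first by move=> k /(submod_chain_has_chain sP) /h2; rewrite leEnat.
  by move=> k; apply.
exact: (is_subset1_supremums (xgetPex _ (ex_intro _ n hs)) hs).
Qed.

Lemma has_length_uniq P Q m n : has_length Q P m -> has_length Q P n -> m = n.
Proof. by move=> [a b] [c d]; apply/eqP; rewrite eqn_leq d // b. Qed.

Lemma has_length_exists P Q b : P `<=` Q -> (forall k, has_chain Q P k -> (k <= b)%N) ->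
  exists2 n, has_length Q P n & (n <= b)%N.
Proof.
move=> PQ hb.
have ex : exists n, `[< has_chain Q P n >] by exists 0; apply/asboolP.
have ub n : `[< has_chain Q P n >] -> (n <= b)%N by move/asboolP; apply: hb.
case: (ex_maxnP ex ub) => n /asboolP h1 h2; exists n; last exact: hb.
by split=> // k hk; apply: h2; apply/asboolP.
Qed.

Lemma has_length_xx P : has_length P P 0.
Proof.
split=> // -[//|k] /= [T [_ PT /has_chain_sub TP]].
by case: PT => _ [].
Qed.

Lemma has_length_sub P Q n : has_length Q P n -> P `<=` Q.
Proof. by move=> [/has_chain_sub]. Qed.

Lemma has_length_proper P Q n : is_submod Q -> P `<` Q -> has_length Q P n -> (0 < n)%N.
Proof. by move=> sQ PQ h; apply: h.2; exists Q; split. Qed.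

Lemma has_chain_bound P T Q a b n : is_submod P -> is_submod Q -> is_submod T ->
  has_length T P a -> has_length Q T b -> has_chain Q P n -> (n <= a + b)%N.
Proof.
move=> sP sQ sT ha hb h; have [a' [b' [le h1 h2]]] := has_chain_split sP sQ sT h.
have PT := has_length_sub ha; have TQ := has_length_sub hb.
apply: leq_trans le _; apply: leq_add.
  by apply: ha.2; apply: has_chain_mono h1 => x; [move=> Px; split=> //; exact: PT|case].
apply: hb.2; apply: has_chain_mono h2; first exact: saddSr.
by apply: sadd_min.
Qed.

Lemma has_length_add P T Q a b : is_submod P -> is_submod Q -> is_submod T ->
  has_length T P a -> has_length Q T b -> has_length Q P (a + b).
Proof.
move=> sP sQ sT ha hb; split; last by move=> k; apply: (@has_chain_bound P T Q).
by apply: has_chain_cat hb.1; apply: ha.1.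
Qed.

Lemma has_length_split P T Q n : is_submod P -> is_submod Q -> is_submod T ->
  P `<=` T -> T `<=` Q -> has_length Q P n ->
  exists a b, [/\ has_length T P a, has_length Q T b & n = (a + b)%N].
Proof.
move=> sP sQ sT PT TQ h.
have [a ha _] : exists2 a, has_length T P a & (a <= n)%N.
  by apply: has_length_exists => // k hk; apply: h.2; apply: has_chain_mono hk.
have [b hb _] : exists2 b, has_length Q T b & (b <= n)%N.
  by apply: has_length_exists => // k hk; apply: h.2; apply: has_chain_mono hk.
exists a, b; split=> //; apply: has_length_uniq h _; exact: has_length_add hb.
Qed.

Lemma has_length_le P T Q U a b : T `<=` Q -> P `<=` U -> has_length Q P b -> has_length T U a -> (a <= b)%N.
Proof. by move=> TQ PU hb ha; apply: hb.2; apply: has_chain_mono ha.1. Qed.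

End Length.

(* A map that is linear modulo P' up to the change of scalars and induces a
   bijection Q / P -> Q' / P' identifies the two lattices of submodules. *)
Section LengthIso.
Variables (A B : comNzRingType) (L : lmodType A) (L' : lmodType B).
Variables (P Q : set L) (P' Q' : set L') (f : L -> L').
Hypotheses (sP : is_submod P) (sQ : is_submod Q) (sP' : is_submod P') (sQ' : is_submod Q').
Hypotheses (PQ : P `<=` Q) (PQ' : P' `<=` Q').
Hypothesis fQ : forall x, Q x -> Q' (f x).
Hypothesis fD : forall x y, Q x -> Q y -> P' (f (x + y) - (f x + f y)).
Hypothesis f_surj : forall y, Q' y -> exists2 x, Q x & P' (y - f x).
Hypothesis f_ker : forall x, Q x -> P' (f x) <-> P x.
Hypothesis fZ : forall a x, Q x -> exists b, P' (f (a *: x) - b *: f x).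
Hypothesis fZ' : forall b x, Q x -> exists a, P' (f (a *: x) - b *: f x).

Let fB x y : Q x -> Q y -> P' (f (x - y) - (f x - f y)).
Proof.
move=> Qx Qy; have Qxy : Q (x - y) by apply: submodB.
have := fD Qxy Qy; rewrite subrK => h.
have -> : f (x - y) - (f x - f y) = - (f x - (f (x - y) + f y)).
  by rewrite !opprB addrA addrAC.
exact: submodN.
Qed.

(** Preimages are submodules by [fZ], and strict inclusions survive because [f] is onto modulo
    [P']. *)
Let has_chain_pull T' n : is_submod T' -> P' `<=` T' -> has_chain Q' T' n ->
  has_chain Q [set x | Q x /\ T' (f x)] n.
Proof.
elim: n T' => [|n IH] T' sT' PT' /=; first by move=> _ x [].
have sub U : is_submod U -> P' `<=` U -> is_submod [set x | Q x /\ U (f x)].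
  move=> sU PU; split.
    split; first exact: submod0.
    by apply: PU; apply/f_ker; apply: submod0.
  move=> a x y [Qx Ux] [Qy Uy]; split; first exact: sQ.2.
  have [b hb] := fZ a Qx.
  apply: (eqm_in sU PU (fD (submodZ a sQ Qx) Qy)).
  apply: submodD => //; apply: (eqm_in sU PU hb); exact: submodZ.
move=> [U [sU TU hU]]; have PU : P' `<=` U.
  by apply: subset_trans PT' _; apply: properW.
exists [set x | Q x /\ U (f x)]; split; [exact: sub| |exact: IH].
split; first by move=> x [Qx /(properW TU) ?].
have [y Uy nTy] := proper_exists TU.
have [x Qx hx] := f_surj (has_chain_sub hU Uy).
move=> /(_ x) h; apply: nTy; apply: (eqm_in sT' PT' hx).
suff: Q x /\ T' (f x) by case.
by apply: h; split=> //; apply: (eqm_in sU PU (eqm_sym sP' hx)).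
Qed.

(** Images are submodules by [fZ']; they stay distinct because elements with the same image modulo
    [P'] differ by an element of [P]. *)
Let has_chain_push T n : is_submod T -> P `<=` T -> has_chain Q T n ->
  has_chain Q' [set y | Q' y /\ exists2 x, T x & P' (y - f x)] n.
Proof.
elim: n T => [|n IH] T sT PT /=; first by move=> _ x [].
have sub U : is_submod U -> U `<=` Q -> P `<=` U ->
   is_submod [set y | Q' y /\ exists2 x, U x & P' (y - f x)].
  move=> sU UQ PU; split.
    split; first exact: submod0.
    exists 0; first exact: submod0.
    rewrite sub0r; apply: submodN => //; apply/f_ker; exact: submod0.
  move=> b y1 y2 [Qy1 [x1 Ux1 h1]] [Qy2 [x2 Ux2 h2]]; split; first exact: sQ'.2.
  have [a ha] := fZ' b (UQ _ Ux1).
  have hD := fD (submodZ a sQ (UQ _ Ux1)) (UQ _ Ux2).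
  exists (a *: x1 + x2); first exact: sU.2.
  apply: (eqm_trans sP' _ (eqm_sym sP' hD)); apply: eqmD => //.
  by apply: (eqm_trans sP' (eqmZ b sP' h1)); apply: eqm_sym.
move=> [U [sU TU hU]]; have PU : P `<=` U.
  by apply: subset_trans PT _; apply: properW.
have UQ := has_chain_sub hU.
exists [set y | Q' y /\ exists2 x, U x & P' (y - f x)]; split; [exact: sub| |exact: IH].
split.
  by move=> y [? [x Tx ?]]; split=> //; exists x => //; apply: (properW TU).
have [x Ux nTx] := proper_exists TU.
move=> /(_ (f x)) []; first split; first by apply/fQ/UQ.
  by exists x => //; apply: eqm_refl.
move=> _ [x0 Tx0 h0]; apply: nTx; have Ux0 := properW TU Tx0.
apply: (eqm_in sT PT _ Tx0); apply/f_ker; first by apply: submodB => //; apply: UQ.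
apply: (eqm_in sP' (@subset_refl _ P') (fB (UQ _ Ux) (UQ _ Ux0)) h0).
Qed.

Lemma has_length_iso n : has_length Q P n <-> has_length Q' P' n.
Proof.
have h1 k : has_chain Q P k -> has_chain Q' P' k.
  move=> h; apply: has_chain_mono (has_chain_push sP _ h) => // y Py; split; first exact: PQ'.
  exists 0; first exact: submod0.
  by apply: submodB => //; apply/f_ker; apply: submod0.
have h2 k : has_chain Q' P' k -> has_chain Q P k.
  move=> h; apply: has_chain_mono (has_chain_pull sP' _ h) => // x Px; split; first exact: PQ.
  by apply/f_ker => //; apply: PQ.
by split=> -[h b]; split; auto.
Qed.

End LengthIso.

(** * Noetherian rings and Dickson's lemma *)

Section Noetherian.
Variable A : comNzRingType.
Hypothesis noethA : noetherian A.

Lemma noeth_stab (f : nat -> set A) : (forall n, is_ideal (f n)) ->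
  (forall n, f n `<=` f n.+1) -> exists j0, forall j, (j0 <= j)%N -> f j = f j0.
Proof.
move=> idf fS.
have mono i j : (i <= j)%N -> f i `<=` f j.
  move=> /subnK <-; elim: (j - i)%N => [//|k IH].
  by rewrite addSn; apply: subset_trans IH (fS _).
have idU : is_ideal [set x | exists n, f n x].
  split; first by exists 0%N; apply: ideal0 (idf _).
  move=> a x y [n hn] [k hk]; exists (maxn n k); apply: (idf _).2.
    exact: (mono _ _ (leq_maxl _ _)).
  exact: (mono _ _ (leq_maxr _ _)).
have [n [x Ux]] := noethA idU.
have /choice [k hk] i : exists k, f k (x i).
  suff: [set x | exists n, f n x] (x i) by [].
  by rewrite Ux; apply: sub_span; exists i.
exists (\max_i k i) => j hj; apply/seteqP; split; last exact: mono.
move=> y fy; have : [set x | exists n, f n x] y by exists j.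
rewrite Ux; move: y {fy}; apply: (span_min (idf _)).
by move=> _ [i _ <-]; exact: (mono _ _ (leq_bigmax i) _ (hk i)).
Qed.

(** If every member of [F] were strictly contained in another, iterating a choice of such would give
    a chain that never becomes stationary. *)
Lemma noeth_max (F : set A -> Prop) I0 : (forall I, F I -> is_ideal I) -> F I0 ->
  exists2 I, F I & forall J, F J -> ~ I `<` J.
Proof.
move=> Fid F0; apply: contrapT => h.
have /choice [g hg] (I : {I | F I}) : exists J : {I | F I}, sval I `<` sval J.
  apply: contrapT => nJ; apply: h; exists (sval I); first exact: svalP.
  by move=> J FJ IJ; apply: nJ; exists (exist _ J FJ).
pose f n := iter n g (exist _ I0 F0).
have [j0 hj] := @noeth_stab (fun n => sval (f n)) (fun n => Fid _ (svalP (f n)))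
  (fun n => properW (hg (f n))).
have := hg (f j0).
by have /= -> := hj j0.+1 (leqnSn _); apply: properxx.
Qed.

Lemma noeth_ind (Pr : set A -> Prop) :
  (forall I, is_ideal I -> (forall J, is_ideal J -> I `<` J -> Pr J) -> Pr I) ->
  forall I, is_ideal I -> Pr I.
Proof.
move=> h I0 iI0; apply: contrapT => nP.
have [I [iI nPI] hI] := @noeth_max (fun I => is_ideal I /\ ~ Pr I) I0
  (fun _ h => h.1) (conj iI0 nP).
apply: nPI; apply: h => // J iJ IJ; apply: contrapT => nPJ.
exact: (hI J).
Qed.

Lemma fin_max (T : eqType) (s : seq T) (Q : T -> nat -> Prop) :
  (forall x, x \in s -> exists j, forall j', (j <= j')%N -> Q x j') ->
  exists j, forall x, x \in s -> forall j', (j <= j')%N -> Q x j'.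
Proof.
elim: s => [|x s IH] h; first by exists 0%N.
have [j hj] : exists j, forall x, x \in s -> forall j', (j <= j')%N -> Q x j'.
  by apply: IH => y ys; apply: h; rewrite inE ys orbT.
have [k hk] := h x (mem_head _ _).
exists (maxn j k) => y; rewrite inE => /orP[/eqP ->|ys] j'; rewrite geq_max => /andP[? ?].
  exact: hk.
exact: hj.
Qed.

(** Only finitely many [u] of size [r] have entries at most [h], so their thresholds admit a common
    one. *)
Lemma box_max r h (Q : seq nat -> nat -> Prop) :
  (forall u, size u = r -> exists j, forall j', (j <= j')%N -> Q u j') ->
  exists j, forall u, size u = r -> all (leq^~ h) u ->
    forall j', (j <= j')%N -> Q u j'.
Proof.
elim: r Q => [|r IH] Q hQ.
  by have [j hj] := hQ [::] erefl; exists j => -[].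
have [j hj] : exists j, forall a, a \in iota 0 h.+1 -> forall j', (j <= j')%N ->
    forall u, size u = r -> all (leq^~ h) u -> Q (a :: u) j'.
  apply: fin_max => a _.
  have [|j hj] := IH (fun u => Q (a :: u)); first by move=> u su; apply: hQ; rewrite /= su.
  by exists j => j' jj' u su au; apply: hj.
exists j => -[//|a u] [su] /= /andP[ah au] j' jj'; apply: (hj a) => //.
by rewrite mem_iota.
Qed.

Definition leqs (u v : seq nat) := all2 leq u v.

Lemma leqs_refl u : leqs u u.
Proof. by elim: u => //= a u ->; rewrite leqnn. Qed.

Definition trunc h (u : seq nat) := map (minn h) u.

Lemma trunc_le h u : leqs (trunc h u) u.
Proof. by elim: u => //= a u ->; rewrite geq_minr. Qed.

Lemma trunc_trunc h h' u : (h <= h')%N -> trunc h (trunc h' u) = trunc h u.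
Proof.
move=> hh; rewrite /trunc -map_comp; apply: eq_map => a /=.
by rewrite minnA (minn_idPl hh).
Qed.

Lemma size_trunc h u : size (trunc h u) = size u.
Proof. exact: size_map. Qed.

Lemma all_trunc h u : all (leq^~ h) (trunc h u).
Proof. by elim: u => //= a u ->; rewrite geq_minl. Qed.

Lemma trunc_stable (f : seq nat -> set A) r h h' : (h <= h')%N ->
  (forall u, size u = r -> f u = f (trunc h u)) ->
  forall u, size u = r -> f u = f (trunc h' u).
Proof.
by move=> hh H u su; rewrite H // [RHS]H ?size_trunc // trunc_trunc.
Qed.

(* Sequences of size r stand for the elements of N^r. *)
Lemma dickson r (f : seq nat -> set A) :
  (forall u, size u = r -> is_ideal (f u)) ->
  (forall u v, size u = r -> size v = r -> leqs u v -> f u `<=` f v) ->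
  exists h, forall u, size u = r -> f u = f (trunc h u).
Proof.
elim: r f => [|r IH] f idf mf; first by exists 0%N => -[].
have idf' j u : size u = r -> is_ideal (f (j :: u)).
  by move=> su; apply: idf; rewrite /= su.
have mf' j k u v : size u = r -> size v = r -> (j <= k)%N -> leqs u v ->
    f (j :: u) `<=` f (k :: v).
  move=> su sv jk uv; apply: mf => /=; rewrite ?su ?sv //.
  by rewrite /leqs /= jk.
(* [g u] is the eventual value of [f] as the first exponent grows; it is an ideal because each chain
   [f (j :: u)] becomes stationary. *)
pose g u := [set x | exists j, f (j :: u) x].
have stab u : size u = r -> exists j, forall j', (j <= j')%N -> g u = f (j' :: u).
  move=> su.
  have [j0 hj] := @noeth_stab (fun j => f (j :: u)) (fun j => idf' j u su)
    (fun j => mf' _ _ _ _ su su (leqnSn j) (leqs_refl u)).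
  exists j0 => j' /hj ->; apply/seteqP; split; last by move=> x fx; exists j0.
  move=> x [j fx]; have [jj|/ltnW jj] := leqP j0 j; first by rewrite -(hj j).
  exact: mf' jj (leqs_refl u) _ fx.
have [h hh] : exists h, forall u, size u = r -> g u = g (trunc h u).
  apply: IH.
    by move=> u su; have [j /(_ j (leqnn j)) ->] := stab u su; apply: idf'.
  move=> u v su sv uv x [j fx]; exists j.
  by apply: mf' fx.
have [j0 hj0] : exists j0, forall u, size u = r -> all (leq^~ h) u ->
    forall j', (j0 <= j')%N -> g u = f (j' :: u).
  exact: box_max stab.
have gj j u : (j0 <= j)%N -> size u = r -> f (j :: u) = g u.
  move=> jj su; apply/seteqP; split; first by move=> x; exists j.
  rewrite hh // (hj0 (trunc h u) _ _ j) ?size_trunc ?all_trunc //.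
  by apply: mf'; rewrite ?size_trunc // trunc_le.
(* Finitely many first exponents lie below [j0]; the induction hypothesis is applied to each of
   these slices. *)
have [h' hh'] : exists h', forall j, j \in iota 0 j0 -> forall h'', (h' <= h'')%N ->
    forall u, size u = r -> f (j :: u) = f (j :: trunc h'' u).
  apply: fin_max => j _; have [||k hk] := IH (fun u => f (j :: u)).
  - by move=> u; apply: idf'.
  - by move=> u v su sv; apply: mf'.
  by exists k => h'' kh; apply: (@trunc_stable (fun u => f (j :: u)) _ _ _ kh hk).
exists (maxn (maxn h h') j0) => -[//|j u] [su] /=.
set H := maxn _ _.
have [hH [h'H j0H]] : (h <= H)%N /\ (h' <= H)%N /\ (j0 <= H)%N by rewrite /H; lia.
have gH := trunc_stable hH hh.
have [jj|jj] := leqP j0 j.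
  rewrite !gj ?size_trunc //; first exact: gH.
  by rewrite leq_min jj j0H.
have -> : minn H j = j by lia.
by apply: (hh' j) => //; rewrite mem_iota.
Qed.

End Noetherian.

(** * Eventually polynomial functions *)

Section EventuallyPolynomial.

Definition evpoly (f : nat -> nat) : Prop :=
  exists p : {poly rat}, exists n0 : nat,
    forall n, (n0 <= n)%N -> p.[n%:R] = (f n)%:R.

Lemma evpoly_ext f g k : (forall n, (k <= n)%N -> f n = g n) -> evpoly f -> evpoly g.
Proof.
move=> fg [p [n0 h]]; exists p, (maxn k n0) => n; rewrite geq_max => /andP[kn ?].
by rewrite -fg // h.
Qed.

Lemma evpoly_const c : evpoly (fun=> c).
Proof. by exists (c%:R)%:P, 0%N => n _; rewrite hornerC. Qed.

Lemma evpolyD f g : evpoly f -> evpoly g -> evpoly (fun n => f n + g n)%N.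
Proof.
move=> [p [n0 hp]] [q [n1 hq]]; exists (p + q), (maxn n0 n1) => n.
by rewrite geq_max => /andP[? ?]; rewrite hornerD hp // hq // natrD.
Qed.

Lemma evpoly_sum (T : Type) (s : seq T) (F : T -> nat -> nat) :
  (forall i, evpoly (F i)) -> evpoly (fun n => \sum_(i <- s) F i n)%N.
Proof.
move=> h; elim: s => [|x s IH].
  by apply: (@evpoly_ext (fun=> 0%N) _ 0%N) (evpoly_const _) => n _; rewrite big_nil.
apply: (@evpoly_ext (fun n => F x n + \sum_(i <- s) F i n)%N _ 0%N).
  by move=> n _; rewrite big_cons.
exact: evpolyD.
Qed.

Lemma evpoly_shift f k : evpoly f -> evpoly (fun n => f (n - k)%N).
Proof.
move=> [p [n0 h]]; exists (p \Po ('X - k%:R%:P)), (n0 + k)%N => n hn.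
rewrite horner_comp !hornerE -h; last by lia.
by rewrite natrB //; lia.
Qed.

(** A shift of the variable keeps the degree and the leading coefficient, so these cancel in the
    difference. *)
Lemma size_shift_sub (q : {poly rat}) a :
  (size ((q \Po ('X + a%:P) - q)%R) <= (size q).-1)%N.
Proof.
have [->|q0] := eqVneq q 0; first by rewrite comp_poly0 subr0 size_poly0.
have s2 : size ('X + a%:P : {poly rat}) = 2%N by rewrite size_XaddC.
have sq : size (q \Po ('X + a%:P)) = size q by apply: size_comp_poly2.
have sz : (0 < size q)%N by rewrite size_poly_gt0.
apply/leq_sizeP => j; rewrite -(prednK sz) /= leq_eqVlt => /orP[/eqP <-|lt].
  rewrite coefB -{1}sq -!lead_coefE lead_coef_comp ?s2 //.
  by rewrite lead_coefXaddC expr1n mulr1 subrr.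
by rewrite coefB !nth_default ?subrr // ?sq -(prednK sz).
Qed.

(** Induction on the degree: the first difference of X^(n+1) has degree n and leading coefficient n
    + 1, which is invertible in the rationals. *)
Lemma poly_antidiff (p : {poly rat}) : exists q, q \Po ('X + 1%:P) - q = p.
Proof.
suff h n (r : {poly rat}) : (size r <= n)%N -> exists q, q \Po ('X + 1%:P) - q = r.
  exact: (h (size p)).
elim: n r => [|n IH] r sr.
  exists 0; rewrite comp_poly0 subr0; apply/esym/eqP.
  by rewrite -size_poly_eq0 -leqn0.
pose c := r`_n / n.+1%:R.
pose Dn : {poly rat} := ('X + 1%:P) ^+ n.+1 - 'X^(n.+1).
have [|q hq] := IH (r - c *: Dn).
  rewrite /Dn {Dn}.
  apply/leq_sizeP => j; rewrite leq_eqVlt => /orP[/eqP <-|lt]; last first.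
    rewrite coefB nth_default ?sub0r; last exact: leq_trans sr lt.
    rewrite coefZ exprDn big_ord_recl /= expr1n mulr1 bin0 mulr1n subn0 addrAC subrr add0r.
    rewrite coef_sum big1 ?mulr0 ?oppr0 // => i _.
    rewrite expr1n mulr1 coefMn coefXn gtn_eqF ?mul0rn //.
    by rewrite /bump /=; lia.
  rewrite coefB coefZ exprDn big_ord_recl /= expr1n mulr1 bin0 mulr1n subn0 addrAC subrr add0r.
  rewrite coef_sum big_ord_recl /= big1 ?addr0; last first.
    move=> i _; rewrite expr1n mulr1 coefMn coefXn gtn_eqF ?mul0rn //.
    by rewrite /bump /=; have := ltn_ord i; lia.
  rewrite /bump /= expr1n mulr1 coefMn coefXn subSS subn0 eqxx bin1 /c.
  by rewrite -mulr_natr mul1r mulfVK ?subrr // pnatr_eq0.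
exists (q + c *: 'X^(n.+1)).
rewrite /Dn in hq; rewrite comp_polyD comp_polyZ rmorphXn /= comp_polyX opprD addrACA hq.
by rewrite -scalerBr subrK.
Qed.

(** A discrete antiderivative telescopes; the constant [c] absorbs the terms before [n0], where [f]
    need not be polynomial. *)
Lemma evpoly_partial_sum f : evpoly f -> evpoly (fun n => \sum_(i < n) f i)%N.
Proof.
move=> [p [n0 h]]; have [q hq] := poly_antidiff p.
pose c : rat := (\sum_(i < n0) f i)%:R - q.[n0%:R].
exists (q + c%:P), n0 => n /subnK <-; elim: (n - n0)%N => [|k IH].
  by rewrite add0n hornerD hornerC /c addrC subrK.
rewrite addSn big_ord_recr /= natrD -IH -h; last by rewrite leq_addl.
rewrite -hq !hornerD hornerN horner_comp !hornerD !hornerC hornerX natr1.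
ring.
Qed.

End EventuallyPolynomial.

(** * Monomial filtrations, Artin-Rees and Hilbert functions *)

Section Monomials.

(** Exponents of the monomials of degree [n] in [r] variables, listed in increasing lexicographic
    order, so that filtrations can be built along prefixes of the list. *)
Fixpoint mons r n : seq (seq nat) :=
  if r is r'.+1 then flatten [seq [seq j :: u | u <- mons r' (n - j)%N] | j <- iota 0 n.+1]
  else if n is 0%N then [:: [::]] else [::].

Lemma monsS r n :
  mons r.+1 n = flatten [seq [seq j :: u | u <- mons r (n - j)%N] | j <- iota 0 n.+1].
Proof. by []. Qed.

Lemma mem_mons r n u : (u \in mons r n) = (size u == r) && (sumn u == n).
Proof.
elim: r n u => [|r IH] n u.
  by case: n u => [|n] [|a u].
apply/flatten_mapP/idP => [[j]|].
  rewrite mem_iota => /andP[_ jn] /mapP [v]; rewrite IH => /andP[/eqP sv /eqP nv] ->.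
  by rewrite /= sv nv eqxx /= subnKC.
case: u => [//|a u]; rewrite [size _]/= [sumn _]/= => /andP[su /eqP hn]; exists a.
  by rewrite mem_iota; lia.
apply/mapP; exists u => //; rewrite IH -eqSS su /=.
by apply/eqP; lia.
Qed.

Fixpoint ltl (u v : seq nat) : bool :=
  match u, v with
  | a :: u', b :: v' => (a < b)%N || ((a == b) && ltl u' v')
  | _, _ => false
  end.

Lemma ltl_irr u : ltl u u = false.
Proof. by elim: u => //= a u ->; rewrite ltnn eqxx. Qed.

Lemma ltl_asym u v : ltl u v -> ltl v u -> false.
Proof.
elim: u v => [|a u IH] [|b v] //=.
case: ltngtP => //= _; exact: IH.
Qed.

Definition addu (u v : seq nat) := [seq (p.1 + p.2)%N | p <- zip u v].

Lemma size_addu u v : size u = size v -> size (addu u v) = size u.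
Proof. by move=> e; rewrite size_map size1_zip // e. Qed.

Lemma sumn_addu u v : size u = size v -> sumn (addu u v) = (sumn u + sumn v)%N.
Proof.
elim: u v => [|a u IH] [|b v] //= [/IH]; rewrite /addu => -> ; lia.
Qed.

Lemma ltl_addu u v d : size u = size v -> size d = size u ->
  ltl u v -> ltl (addu u d) (addu v d).
Proof.
elim: u v d => [|a u IH] [|b v] [|c d] //= [suv] [sd].
rewrite ltn_add2r eqn_add2r => /orP[->//|/andP[-> h]].
by rewrite [ltl _ _](IH v d) ?orbT.
Qed.

Lemma leqs_addu u v : size u = size v -> leqs u v ->
  exists2 d, size d = size u & v = addu u d.
Proof.
rewrite /leqs; elim: u v => [|a u IH] [|b v] //=; first by exists [::].
move=> [/IH h] /andP[ab /h [d sd ->]]; exists ((b - a)%N :: d); first by rewrite /= sd.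
by rewrite /addu /= subnKC.
Qed.

Lemma pairwise_flatten_map (T : Type) (e : rel T) (F : nat -> seq T) m k :
  (forall j, pairwise e (F j)) ->
  (forall i j, (i < j)%N -> allrel e (F i) (F j)) ->
  pairwise e (flatten [seq F j | j <- iota m k]).
Proof.
move=> h1 h2; elim: k m => [//|k IH] m /=; rewrite pairwise_cat h1 IH !andbT.
have: forall m', (m < m')%N -> allrel e (F m) (flatten [seq F j | j <- iota m' k]).
  elim: k {IH} => [|k IH] m' mm /=; first by rewrite allrel0r.
  by rewrite allrel_catr h2 //= IH // ltnW.
by apply.
Qed.

Lemma mons_sorted r n : pairwise ltl (mons r n).
Proof.
elim: r n => [|r IH] n; first by case: n.
apply: pairwise_flatten_map.
  by move=> j; rewrite pairwise_map; apply: sub_pairwise (IH _) => u v /= ->; rewrite eqxx orbT.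
move=> i j ij; apply/allrelP => u v /mapP [u' _ ->] /mapP [v' _ ->] /=.
by rewrite ij.
Qed.

Lemma mons_prefix r n s1 u s2 v : mons r n = s1 ++ u :: s2 ->
  (v \in s1) = [&& size v == size u, sumn v == sumn u & ltl v u].
Proof.
move=> e; have := mons_sorted r n; rewrite e pairwise_cat => /and3P [h1 _ h3].
have := mem_mons r n u; rewrite e mem_cat mem_head orbT => /esym/andP[/eqP su /eqP nu].
apply/idP/and3P => [vs|[/eqP sv /eqP nv vu]].
  have := mem_mons r n v; rewrite e mem_cat vs /= => /esym; rewrite su nu => /andP[-> ->].
  split=> //; move/allrelP: h1; apply=> //; exact: mem_head.
have : v \in mons r n by rewrite mem_mons sv nv su nu !eqxx.
rewrite e mem_cat inE => /or3P [//|/eqP ev|vs2].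
  by rewrite ev ltl_irr in vu.
by move: h3 => /= /andP[/allP /(_ v vs2) uv _]; case: (ltl_asym vu uv).
Qed.

(** Split by the first exponent j. For each j < h the inner sum is a shift of an eventually
    polynomial function, by induction; for j >= h the function no longer depends on j, so these
    terms form a partial sum of a single one. *)
Lemma evpoly_mons r (l : seq nat -> nat) h :
  (forall u, size u = r -> l u = l (trunc h u)) ->
  evpoly (fun n => \sum_(u <- mons r n) l u)%N.
Proof.
elim: r l h => [|r IH] l h H.
  apply: (@evpoly_ext (fun=> 0%N) _ 1%N) (evpoly_const _) => -[//|n] _ /=.
  by rewrite big_nil.
pose F j n := (\sum_(u <- mons r n) l (j :: u))%N.
have evF j : evpoly (F j).
  apply: (IH _ h) => u su; rewrite H /= ?su //.
  by rewrite [RHS]H /= ?size_trunc ?su // trunc_trunc // minnA minnn.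
have Fh j n : (h <= j)%N -> F j n = F h n.
  move=> hj; apply: eq_big_seq => u; rewrite mem_mons => /andP[/eqP su _].
  by rewrite H /= ?su // [RHS]H /= ?su // minnn (minn_idPl hj).
apply: (@evpoly_ext (fun n => \sum_(j <- iota 0 h) F j (n - j) +
   \sum_(i < n - h + 1) F h i)%N _ h).
  move=> n hn; rewrite monsS big_flatten big_map.
  have -> : n.+1 = (h + (n - h + 1))%N by lia.
  rewrite iotaD big_cat /= add0n; congr (_ + _)%N.
    by apply: eq_bigr => j _; rewrite big_map.
  have E k (G : nat -> nat) : (\sum_(j <- iota h k) G j = \sum_(i < k) G (h + i))%N.
    by rewrite -{1}(addn0 h) iotaDl big_map -(big_mkord xpredT (fun i => G (h + i)%N)) /index_iota subn0.
  rewrite {}E (reindex_inj rev_ord_inj) /=; apply: eq_bigr => j _.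
  rewrite big_map -/(F _ _) Fh ?leq_addr //.
  by congr F; have := ltn_ord j; lia.
apply: evpolyD; first by apply: evpoly_sum => j; apply: evpoly_shift.
apply: (evpoly_ext (k := h)) (evpoly_shift h (_ : evpoly (fun n => \sum_(i < n.+1) F h i)%N)).
  by move=> n _; rewrite addn1.
have [p [n0 hp]] := evpoly_partial_sum (evF h).
exists (p \Po ('X + 1%:P)), n0 => n hn; rewrite horner_comp !hornerE natr1 hp //.
exact: leqW.
Qed.

End Monomials.

(** * Powers of an ideal filtered by monomials *)

Section MonomialFiltration.
Variables (A : comNzRingType) (xs : seq A).
Local Notation r := (size xs).

Fixpoint mon_of (zs : seq A) (u : seq nat) : A :=
  match zs, u with
  | x :: zs', a :: u' => x ^+ a * mon_of zs' u'
  | _, _ => 1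
  end.
Local Notation mon := (mon_of xs).

Lemma mon_addu zs u v : size u = size zs -> size v = size zs ->
  mon_of zs (addu u v) = mon_of zs u * mon_of zs v.
Proof.
elim: zs u v => [|x zs IH] [|a u] [|b v] //=; rewrite ?mulr1 //.
by move=> [su] [sv]; rewrite -/(addu u v) IH // exprD; ring.
Qed.

Definition mon_span (y : A) (s : seq (seq nat)) : set A :=
  span ([set z | exists2 v, v \in s & z = mon v * y] : set A^o).

Lemma mon_span_ideal y s : is_ideal (mon_span y s).
Proof. exact: span_submod. Qed.

Lemma mon_span_in y s v : v \in s -> mon_span y s (mon v * y).
Proof. by move=> vs; apply: sub_span; exists v. Qed.

Lemma mon_span_min y s P : is_ideal P -> (forall v, v \in s -> P (mon v * y)) -> mon_span y s `<=` P.
Proof. by move=> iP h; apply: (span_min iP) => _ [v vs ->]; apply: h. Qed.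

Lemma mon_span_rcons y s u : mon_span y (rcons s u) = sadd (mon_span y s : set A^o) (cyc (mon u * y : A^o)).
Proof.
apply/seteqP; split.
  apply: mon_span_min; first exact: sadd_submod (mon_span_ideal _ _) (cyc_submod _).
  move=> v; rewrite mem_rcons inE => /orP[/eqP ->|vs].
    by apply: saddSr; [exact: mon_span_ideal|exact: cycid].
  by apply: saddSl; [exact: cyc_submod|exact: mon_span_in].
apply: (@sadd_min A A^o); first exact: mon_span_ideal.
  by apply: mon_span_min; [exact: mon_span_ideal|] => v vs; apply: mon_span_in; rewrite mem_rcons inE vs orbT.
apply: (@cyc_min A A^o); first exact: mon_span_ideal.
by apply: mon_span_in; rewrite mem_rcons mem_head.
Qed.

Let J : set A := span ([set` xs] : set A^o).

Lemma mon_unit zs k : (k < size zs)%N ->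
  exists e, [/\ size e = size zs, sumn e = 1%N & mon_of zs e = zs`_k].
Proof.
elim: zs k => [//|x zs IH] [_|k /= /IH [e [se ne he]]].
  exists (1%N :: nseq (size zs) 0%N); split; first by rewrite /= size_nseq.
    by rewrite /= sumn_nseq.
  rewrite /= expr1; suff -> : mon_of zs (nseq (size zs) 0%N) = 1 by rewrite mulr1.
  by elim: zs {IH} => //= z zs ->; rewrite expr0 mulr1.
by exists (0%N :: e); split; rewrite /= ?se ?ne // expr0 mul1r.
Qed.

Lemma mon_deg0 zs u : sumn u = 0%N -> mon_of zs u = 1.
Proof.
elim: u zs => [|a u IH] [|z zs] //= /eqP; rewrite addn_eq0 => /andP[/eqP -> /eqP h].
by rewrite IH // expr0 mulr1.
Qed.

Lemma mon_pos zs u n : size u = size zs -> sumn u = n.+1 ->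
  exists k v, [/\ (k < size zs)%N, size v = size zs, sumn v = n & mon_of zs u = zs`_k * mon_of zs v].
Proof.
elim: zs u n => [|z zs IH] [|a u] n //= [su].
case: a => [|a] hn; last first.
  exists 0%N, (a :: u); split; rewrite /= ?su //; first by lia.
  by rewrite exprS mulrA.
have [k [v [kz sv nv ->]]] := IH _ _ su hn.
exists k.+1, (0%N :: v); split; rewrite /= ?sv ?expr0 //.
by rewrite !mul1r.
Qed.

Lemma pow_smul_mons n (y : A) : pow_smul J n (cyc (y : A^o)) = mon_span y (mons r n).
Proof.
elim: n => [|n IH].
  apply/seteqP; split.
    apply: (@cyc_min A A^o); first exact: mon_span_ideal.
    have h : nseq r 0%N \in mons r 0 by rewrite mem_mons size_nseq sumn_nseq mul0n !eqxx.
    have := @mon_span_in y _ _ h; rewrite mon_deg0 ?mul1r //.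
    by rewrite sumn_nseq mul0n.
  apply: mon_span_min; first exact: cyc_submod.
  move=> v; rewrite mem_mons => /andP[_ /eqP /mon_deg0 ->]; rewrite mul1r; exact: cycid.
rewrite [LHS]/= IH; apply/seteqP; split.
  rewrite {1}/J; apply: (subset_trans (@span_scale_ring A A^o _ _ (mon_span_ideal _ _))).
  apply: span_min; first exact: mon_span_ideal.
  move=> _ [a [x [/= axs hx ->]]]; move: x hx; apply: span_min.
    split; first by rewrite /= scaler0; apply: ideal0 (mon_span_ideal _ _).
    move=> b u v /= hu hv; rewrite scalerDr scalerA mulrC -scalerA.
    by apply: (mon_span_ideal _ _).2.
  move=> _ [v + ->]; rewrite mem_mons => /andP[/eqP sv /eqP nv] /=.
  have [e [se ne he]] : exists e, [/\ size e = size xs, sumn e = 1%N & mon_of xs e = a].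
    by rewrite -(nth_index 0 axs); apply: mon_unit; rewrite index_mem.
  have -> : a *: (mon v * y : A^o) = mon (addu e v) * y.
    by rewrite mon_addu // he -mulrA.
  apply: mon_span_in; rewrite mem_mons size_addu ?se ?sv // eqxx sumn_addu ?se ?sv //.
  by rewrite ne nv add1n eqxx.
apply: mon_span_min; first exact: smul_submod.
move=> v; rewrite mem_mons => /andP[/eqP sv /eqP nv].
have [k [w [kr sw nw ->]]] := mon_pos sv nv.
rewrite -mulrA; apply: (@smulP _ A^o).
  by apply: sub_span; apply: mem_nth.
by apply: mon_span_in; rewrite mem_mons sw nw !eqxx.
Qed.

Section LeadingIdeals.
Hypothesis noethA : noetherian A.
Variables (y : A) (W : nat -> set A).
Hypothesis W_ideal : forall n, is_ideal (W n).
Hypothesis JW : forall n a x, J a -> W n x -> W n.+1 (a * x).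

Lemma mon_W d n x : size d = r -> W n x -> W (n + sumn d)%N (mon d * x).
Proof.
have [k hd] : exists k, sumn d = k by exists (sumn d).
elim: k d hd => [|k IH] d hd sd Wx; first by rewrite mon_deg0 // hd mul1r addn0.
have [i [w [ir sw nw ->]]] := mon_pos sd hd.
rewrite hd -mulrA addnS -nw; apply: JW; last exact: IH.
by apply: sub_span; apply: mem_nth.
Qed.

Definition lower (u : seq nat) : set A :=
  span ([set z | exists v, [/\ size v = r, sumn v = sumn u, ltl v u & z = mon v * y]] : set A^o).

Definition base (u : seq nat) : set A := sadd (W (sumn u) : set A^o) (lower u).

(* coefficients of the leading monomial u of the elements of
   W_|u| + (xs)^|u| y all of whose monomials are at most u *)
Definition lead (u : seq nat) : set A := colon (base u) (mon u * y).

Lemma lower_ideal u : is_ideal (lower u).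
Proof. exact: span_submod. Qed.

Lemma base_ideal u : is_ideal (base u).
Proof. exact: (@sadd_submod A A^o _ _ (W_ideal _) (lower_ideal _)). Qed.

Lemma lead_ideal u : is_ideal (lead u).
Proof. exact/colon_ideal/base_ideal. Qed.

Lemma mon_lower d u z : size u = r -> size d = r -> lower u z ->
  lower (addu u d) (mon d * z).
Proof.
move=> su sd; rewrite mulrC; move: z.
apply: (span_min (colon_ideal (mon d) (lower_ideal (addu u d)))) => _ [v [sv nv vu ->]].
apply: sub_span; exists (addu v d); split.
- by rewrite size_addu sv.
- by rewrite !sumn_addu ?nv ?sv ?su.
- by apply: ltl_addu; rewrite ?sv ?su.
by rewrite mon_addu ?sv //; ring.
Qed.

Lemma mon_base d u z : size u = r -> size d = r -> base u z ->
  base (addu u d) (mon d * z).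
Proof.
move=> su sd [w [l [Ww ll ->]]]; exists (mon d * w), (mon d * l); split.
- by rewrite sumn_addu ?su ?sd //; apply: mon_W.
- exact: mon_lower.
by rewrite mulrDr.
Qed.

(** Multiplying a relation with leading monomial [u] by [mon d] keeps its leading coefficient and
    the order of the other monomials. *)
Lemma lead_mono u v : size u = r -> size v = r -> leqs u v -> lead u `<=` lead v.
Proof.
move=> su sv /leqs_addu; rewrite su sv => /(_ erefl) [d sd ->] a.
rewrite /lead /colon /= => h; rewrite mon_addu //.
have -> : a * (mon u * mon d * y) = mon d * (a * (mon u * y)) by ring.
exact: mon_base.
Qed.

(** This serves two filtrations: the constant [W] gives Artin-Rees, and W_n = J^(n+1) I + J^n T,
    with T spanned by some of the generators of [I], gives Hilbert functions. *)
Lemma lead_stable : exists h, forall u, size u = r -> lead u = lead (trunc h u).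
Proof.
by apply: dickson => // [u _|]; [exact: lead_ideal|exact: lead_mono].
Qed.

Lemma lower_prefix n s1 u s2 : mons r n = s1 ++ u :: s2 -> lower u = mon_span y s1.
Proof.
move=> e; have hp := mons_prefix _ e.
have su : size u = r.
  have := mem_mons r n u; rewrite e mem_cat mem_head orbT => /esym/andP[/eqP -> _] //.
rewrite /lower /mon_span; apply: (congr1 (@span A A^o)); apply/seteqP; split=> x /=.
  by move=> [v [sv nv vu ->]]; exists v => //; rewrite hp sv nv su vu !eqxx.
by move=> [v + ->]; rewrite hp => /and3P[/eqP sv /eqP nv vu]; exists v; split; rewrite ?sv.
Qed.

End LeadingIdeals.

(** A division algorithm. The leading coefficient of z at [u] also occurs at the truncation [t] of
    [u], for some q in [Q]; if u = t + d, subtracting [mon d * q], which lies in J^(|d|) Q, removes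
    the leading term of z. *)
Lemma artin_rees_aux (Q : set A) : noetherian A -> is_ideal Q ->
  exists h, forall n, (h <= n)%N ->
    forall z, Q z -> pow_smul J n (setT : set A^o) z -> pow_smul J (n - h) (Q : set A^o) z.
Proof.
move=> noethA iQ.
have JW (n : nat) a x : J a -> Q x -> Q (a * x) by move=> _; apply: idealMl.
have [h hh] := @lead_stable noethA 1 (fun=> Q) (fun=> iQ) JW.
have JE n : pow_smul J n (setT : set A^o) = mon_span 1 (mons r n).
  rewrite -pow_smul_mons; congr pow_smul; apply/seteqP; split=> // a _.
  by exists a; rewrite -[LHS]mulr1.
(* Exponents truncated at [h] have total degree at most [r * h], so the cofactor [d] has degree at
   least n - r h. *)
exists (r * h)%N => n hn z Qz; rewrite JE => zn.
have ipow : is_ideal (pow_smul J (n - r * h) (Q : set A^o)) by apply: pow_smul_submod.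
suff H s1 s2 : mons r n = s1 ++ s2 -> forall z, Q z -> mon_span 1 s1 z ->
    pow_smul J (n - r * h) (Q : set A^o) z.
  by apply: (H (mons r n) [::]) => //; rewrite cats0.
elim/last_ind: s1 s2 {z Qz zn} => [|s1 u IH] s2 e z Qz.
  by move/(mon_span_min (@submod_zero _ A^o)) => -> //; apply: ideal0.
rewrite cat_rcons in e; rewrite mon_span_rcons => -[l [_ [hl [a ->] ez]]].
have := mem_mons r n u; rewrite e mem_cat mem_head orbT => /esym/andP[/eqP su /eqP nu].
have low : lower 1 u = mon_span 1 s1 := lower_prefix 1 e.
have : lead 1 (fun=> Q) u a.
  exists z, (- l); split=> //; first by rewrite low; apply: idealN (mon_span_ideal _ _) hl.
  by rewrite ez addrAC subrr add0r.
set t := trunc h u; have st : size t = r by rewrite /t size_trunc.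
rewrite hh // -/t => -[q [l' [Qq hl' ea]]].
have [d sd ud] : exists2 d, size d = r & u = addu t d.
  by have [|d sd ->] := @leqs_addu t u _ (trunc_le h u); [rewrite st su|exists d; rewrite // sd].
have nt : (sumn t <= r * h)%N.
  rewrite -st /t; elim: (u) => //= b v IHv; rewrite mulSn.
  by apply: leq_add => //; apply: geq_minl.
have nd : (n - r * h <= sumn d)%N.
  have : sumn u = (sumn t + sumn d)%N by rewrite {1}ud sumn_addu ?sd ?st.
  by rewrite nu; lia.
have dq : pow_smul J (n - r * h) (Q : set A^o) (mon d * q).
  apply: (@pow_smul_le _ A^o _ _ _ (sumn d)) => //.
  apply: (@mon_W (fun k => pow_smul J k (Q : set A^o)) _ d 0) => // k b x Jb hx.
  exact: (@smulP _ A^o).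
have zd : z - mon d * q = l + mon d * l'.
  rewrite ez; have -> : a *: (mon u * 1 : A^o) = mon d * (q + l').
    by rewrite -ea ud mon_addu //; change (a * (mon t * mon d * 1) = mon d * (a * (mon t * 1))); ring.
  by rewrite mulrDr; ring.
have hz : pow_smul J (n - r * h) (Q : set A^o) (z - mon d * q).
  apply: (IH _ e); first by apply: idealB => //; apply: idealMl.
  rewrite zd; apply: (idealD (mon_span_ideal _ _)) => //.
  by rewrite -low ud; apply: mon_lower.
by rewrite -(subrK (mon d * q) z); apply: (idealD ipow).
Qed.

(** Multiplication by [z] induces an isomorphism from A / (P : z) onto (P + Az) / P. *)
Lemma cyc_len (P : set A) z n : is_ideal P ->
  has_length (sadd (P : set A^o) (cyc (z : A^o))) P n <-> has_length ([set: A^o]) (colon P z) n.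
Proof.
move=> iP; apply: iff_sym.
have sP : is_ideal (sadd (P : set A^o) (cyc (z : A^o))).
  by apply: sadd_submod => //; apply: cyc_submod.
apply: (@has_length_iso A A A^o A^o _ _ _ _ (fun a : A^o => (a * z : A^o))) => //.
- exact: colon_ideal.
- exact/saddSl/cyc_submod.
- by move=> a _; apply: saddSr => //; exists a.
- by move=> a b _ _; rewrite mulrDl subrr; apply: ideal0.
- move=> _ [p [_ [Pp [a ->] ->]]]; exists a => //.
  by rewrite addrK.
- by move=> a b _; exists a; rewrite -[(a *: b) * z]mulrA subrr; apply: ideal0.
- by move=> a b _; exists a; rewrite -[(a *: b) * z]mulrA subrr; apply: ideal0.
Qed.

(** Adjoining the products of [y] with the monomials of degree n to [W n] one by one gives steps
    isomorphic to A / [lead u], of finite length since [J] lies in [lead u]. Their lengths depend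
    only on a truncation of [u], so [evpoly_mons] applies. *)
Lemma hilbert_cyc y (W : nat -> set A) b : noetherian A ->
  (forall n, is_ideal (W n)) -> (forall n a x, J a -> W n x -> W n.+1 (a * x)) ->
  (forall n, pow_smul J n.+1 (cyc (y : A^o)) `<=` W n) ->
  has_length ([set: A^o]) J b ->
  exists2 l : nat -> nat, evpoly l &
    forall n, has_length (sadd (W n : set A^o) (pow_smul J n (cyc (y : A^o)))) (W n) (l n).
Proof.
move=> noethA iW JW yW hJ.
have [h hh] := @lead_stable noethA y W iW JW.
have JU u : size u = r -> J `<=` lead y W u.
  move=> su a Ja; apply: saddSl; first exact: lower_ideal.
  apply: yW; apply: (@smulP _ A^o J (pow_smul J (sumn u) (cyc (y : A^o)))) => //; rewrite pow_smul_mons.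
  by apply: mon_span_in; rewrite mem_mons su !eqxx.
have ex u : exists k, size u = r -> has_length ([set: A^o]) (lead y W u) k.
  have [su|ne] := pselect (size u = r); last by exists 0%N.
  have [_ [k [_ hk _]]] := has_length_split (span_submod _) (@submodT _ A^o)
    (lead_ideal y iW u) (JU u su) (subsetT _) hJ.
  by exists k.
have [l hl] := choice ex.
exists (fun n => \sum_(u <- mons r n) l u)%N.
  apply: (@evpoly_mons _ _ h) => u su.
  by apply: has_length_uniq (hl u su) _; rewrite hh //; apply: hl; rewrite size_trunc.
move=> n; rewrite pow_smul_mons.
suff H s1 s2 : mons r n = s1 ++ s2 ->
    has_length (sadd (W n : set A^o) (mon_span y s1)) (W n) (\sum_(u <- s1) l u).
  by apply: (H (mons r n) [::]) => //; rewrite cats0.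
elim/last_ind: s1 s2 => [|s1 u IH] s2 e.
  rewrite big_nil; have -> : sadd (W n : set A^o) (mon_span y [::]) = W n; last exact: has_length_xx.
  apply/seteqP; split; last exact/saddSl/mon_span_ideal.
  by apply: (@sadd_min A A^o _ _ _ (iW n)) => //; apply: (mon_span_min (iW n)).
rewrite cat_rcons in e; rewrite mon_span_rcons saddA.
have := mem_mons r n u; rewrite e mem_cat mem_head orbT => /esym/andP[/eqP su /eqP nu].
have sU : is_ideal (sadd (W n : set A^o) (mon_span y s1)).
  exact: (@sadd_submod A A^o _ _ (iW n) (mon_span_ideal _ _)).
rewrite -cats1 big_cat big_seq1 /=.
apply: (@has_length_add A A^o _ _ _ _ _ (iW n) (sadd_submod sU (cyc_submod _)) sU).
  exact: IH e.
apply/cyc_len => //; have := hl u su.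
by rewrite /lead /base (lower_prefix y e) nu.
Qed.

End MonomialFiltration.

Section ArtinRees.
Variables (A : comNzRingType) (J : set A).
Hypotheses (noethA : noetherian A) (J_ideal : is_ideal J).

Implicit Types (P Q I : set A).

Lemma ideal_span_seq I : is_ideal I ->
  exists2 s : seq A, I = span ([set` s] : set A^o) & forall y, y \in s -> I y.
Proof.
move=> /noethA [n [x Ix]].
have e : range x = [set` codom x].
  by apply/seteqP; split=> [_ [i _ <-]|_ /codomP [i ->]]; [apply/codom_f|exists i].
exists (codom x); first by rewrite -e.
by move=> y /codomP [i ->]; rewrite Ix; apply: sub_span; exists i.
Qed.

Lemma artin_rees (Q : set A) : is_ideal Q -> exists h, forall n, (h <= n)%N ->
  forall z, Q z -> pow_smul J n (setT : set A^o) z -> pow_smul J (n - h) (Q : set A^o) z.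
Proof.
have [xs -> _] := ideal_span_seq J_ideal; exact: artin_rees_aux.
Qed.

Lemma pow_smul_cyc1 n (z x : A) : pow_smul J n (cyc (z : A^o)) x <->
  exists2 y : A, pow_smul J n (setT : set A^o) y & x = z * y.
Proof.
elim: n x => [|n IH] x.
  split=> [[a ->]|[y _ ->]]; first by exists a => //; rewrite mulrC.
  by exists y; rewrite mulrC.
split.
  have sT : is_submod [set x : A^o | exists2 y, pow_smul J n.+1 (setT : set A^o) y & x = z * y].
    split; first by exists 0; [exact: submod0 (pow_smul_submod _ _ _)|rewrite mulr0].
    move=> a _ _ [u hu ->] [v hv ->]; exists (a *: u + v).
      by apply: (pow_smul_submod _ _ _).2.
    by change (a * (z * u) + z * v = z * (a * u + v)); ring.
  move: x; apply: (smul_min sT) => a x Ja /IH [y hy ->].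
  exists (a * y); first exact: (@smulP _ A^o).
  by change (a * (z * y) = z * (a * y)); ring.
move=> [y hy ->]; move: y hy.
have sT : is_submod [set y : A^o | pow_smul J n.+1 (cyc (z : A^o)) (z * y)].
  have sP := @pow_smul_submod A A^o J _ n.+1 (cyc_submod (z : A^o)).
  split; first by rewrite /= mulr0; apply: (submod0 sP).
  move=> a u v /= hu hv.
  have -> : z * (a *: u + v) = a *: (z * u : A^o) + z * v.
    by change (z * (a * u + v) = a * (z * u) + z * v); ring.
  exact: sP.2.
apply: (smul_min sT) => a y Ja hy /=.
have -> : z * (a *: y) = a *: (z * y : A^o) by change (z * (a * y) = a * (z * y)); ring.
by apply: (@smulP _ A^o) => //; apply/IH; exists y.
Qed.

(** The generators of [I] are adjoined one at a time, each contributing an eventually polynomial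
    function relative to the span of the earlier ones modulo J^(n+1) I. *)
Lemma hilbert_ideal (I : set A) b : is_ideal I -> has_length ([set: A^o]) J b ->
  exists2 l : nat -> nat, evpoly l &
    forall n, has_length (pow_smul J n (I : set A^o)) (pow_smul J n.+1 (I : set A^o)) (l n).
Proof.
move=> iI hJ; have [s Is sI] := ideal_span_seq iI.
have iP n : is_submod (pow_smul J n (I : set A^o)) by apply: pow_smul_submod.
suff H (t : seq A) : (forall y, y \in t -> I y) -> exists2 l : nat -> nat, evpoly l &
    forall n, has_length (sadd (pow_smul J n.+1 (I : set A^o)) (pow_smul J n (span ([set` t] : set A^o))))
                   (pow_smul J n.+1 (I : set A^o)) (l n).
  have [l el hl] := H s sI; exists l => // n; have := hl n.
  rewrite -Is sadd_idl //; exact: pow_smul_dec.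
elim: t => [|y t IH] tI.
  exists (fun=> 0%N); first exact: evpoly_const.
  move=> n; suff -> : sadd (pow_smul J n.+1 (I : set A^o)) (pow_smul J n (span ([set` [::]] : set A^o))) = pow_smul J n.+1 (I : set A^o).
    exact: has_length_xx.
  apply/seteqP; split; last by apply: saddSl; apply/pow_smul_submod/span_submod.
  apply: (sadd_min (iP n.+1)) => // x /(pow_smul_subr (span_submod _)).
  by move/(span_min (@submod_zero A A^o)) => -> //; apply: submod0.
have [|l el hl] := IH; first by move=> z zt; apply: tI; rewrite inE zt orbT.
have Iy : I y by apply: tI; rewrite mem_head.
have iS : is_submod (span ([set` t] : set A^o)) by apply: span_submod.
have ext : span ([set` y :: t] : set A^o) = sadd (span ([set` t] : set A^o)) (cyc (y : A^o)).
  exact: (@span_seq_cons A A^o).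
pose W n : set A := sadd (pow_smul J n.+1 (I : set A^o)) (pow_smul J n (span ([set` t] : set A^o))).
have iW n : is_ideal (W n) by apply: sadd_submod => //; apply: pow_smul_submod.
have [xs Jxs _] := ideal_span_seq J_ideal.
have [|||l' el' hl'] := @hilbert_cyc A xs y W b noethA iW.
- move=> n a x; rewrite -Jxs => Ja [u [v [hu hv ->]]]; exists (a * u), (a * v).
  split; [exact: (@smulP _ A^o)|exact: (@smulP _ A^o)|by rewrite mulrDr].
- move=> n; rewrite -Jxs; apply: subset_trans (saddSl _); last exact: pow_smul_submod.
  exact: pow_smulS (cyc_min iI Iy).
- by rewrite -Jxs.
exists (fun n => l n + l' n)%N; first exact: evpolyD.
move=> n; rewrite ext pow_smul_addr ?saddA //; last exact: cyc_submod.
apply: (has_length_add (iP _) _ (iW n) (hl n)); last by have := hl' n; rewrite -Jxs.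
by apply: (sadd_submod (iW n)); apply/pow_smul_submod/cyc_submod.
Qed.

End ArtinRees.

(** * Dimension of Noetherian local rings *)

Section LocalRing.
Variables (A : comNzRingType) (M : set A).
Hypotheses (noethA : noetherian A) (M_local : local_ring M).

Implicit Types (P Q I : set A).

Lemma maximal_ideal : is_ideal M.
Proof. by case: M_local => -[]. Qed.

Lemma maximal_proper : ~ M 1.
Proof. by case: M_local => -[]. Qed.

Lemma local_proper I : is_ideal I -> ~ I 1 -> I `<=` M.
Proof.
move=> iI I1; have [Q [iQ Q1 IQ] hQ] := @noeth_max A noethA
  (fun Q => [/\ is_ideal Q, ~ Q 1 & I `<=` Q]) I (fun Q h => let: And3 a _ _ := h in a) (And3 iI I1 (fun x h => h)).
suff <- : Q = M by [].
apply: M_local.2; split=> // Q' iQ' QQ'.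
have [/(ideal1 iQ') ->|Q'1] := pselect (Q' 1); [by right|left].
apply/seteqP; split=> //; apply: contrapT => nQ.
apply: (hQ Q'); last by split.
by split=> //; apply: subset_trans QQ'.
Qed.

Lemma local_unit x : ~ M x -> exists y, y * x = 1.
Proof.
move=> Mx; apply: contrapT => h; apply: Mx.
apply: (@local_proper (cyc (x : A^o))); [exact: cyc_submod| |exact: cycid].
by move=> [a e]; apply: h; exists a.
Qed.

Lemma maximal_prime : is_prime M.
Proof.
split; [exact: maximal_ideal|exact: maximal_proper|].
move=> x y Mxy; apply: contrapT => /not_orP [/local_unit [u ux] My].
by apply: My; rewrite -[y]mul1r -ux -mulrA; apply: idealMl maximal_ideal _.
Qed.

Lemma prime_sub_maximal P : is_prime P -> P `<=` M.
Proof. by move=> [? ? _]; apply: local_proper. Qed.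

Lemma has_length_maximal : has_length ([set: A^o]) M 1.
Proof.
have [[iM M1 maxM] _] := M_local; split.
  exists setT; split=> //; split=> // h; exact/M1/h.
case=> [//|[//|k]] /= [T [sT MT [U [sU TU _]]]].
have [e|e] := maxM T sT (properW MT); first by rewrite e in MT; case: (properxx MT).
by rewrite e in TU; case: TU => _ [].
Qed.

(** For a proper ideal [Q] this is [M]-primariness; admitting the unit ideal keeps Noetherian
    induction uniform. *)
Definition M_radical (Q : set A) := forall x, M x -> exists k, Q (x ^+ k).

Lemma prime_of_M_radical P : is_prime P -> M_radical P -> P = M.
Proof.
move=> pP h; apply/seteqP; split; first exact: prime_sub_maximal.
move=> x /h [k]; case: pP => [iP P1 hP].
by elim: k => [//|k IH]; rewrite exprS => /hP [].
Qed.

(** A maximal member among the ideals Q : z with z outside [Q] is prime, hence equal to [M]. Then (Q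
    + Az) / Q has length 1, and Noetherian induction applies to Q + Az. *)
Lemma finite_length Q : is_ideal Q -> M_radical Q -> exists n, has_length ([set: A^o]) Q n.
Proof.
move: Q; apply: (noeth_ind noethA) => Q iQ IH rQ.
have [Q1|Q1] := pselect (Q 1).
  by rewrite (ideal1 iQ Q1); exists 0%N; apply: has_length_xx.
have [||_ [z [Qz ->]] hP] := @noeth_max A noethA (fun P => exists z, ~ Q z /\ P = colon Q z) (colon Q 1).
- by move=> _ [z [_ ->]]; apply: colon_ideal.
- by exists 1.
have iC := colon_ideal z iQ.
have QC : Q `<=` colon Q z by move=> x Qx; apply: idealMr.
have pC : is_prime (colon Q z).
  split=> //; first by rewrite /colon /= mul1r.
  move=> x y hxy; apply: contrapT => /not_orP [nx ny].
  apply: (hP (colon Q (y * z))); first by exists (y * z); split.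
  split; first by move=> w Qw; rewrite /colon /= mulrCA; apply: idealMl.
  by move=> /(_ x); rewrite /colon /= mulrA => /(_ hxy).
have eM : colon Q z = M.
  by apply: prime_of_M_radical => // x /rQ [k Qk]; exists k; apply: QC.
have iS : is_ideal (sadd (Q : set A^o) (cyc (z : A^o))).
  by apply: sadd_submod => //; apply: cyc_submod.
have QS : Q `<=` sadd (Q : set A^o) (cyc (z : A^o)) by exact: (@saddSl A A^o _ _ (cyc_submod _)).
have [||n hn] := IH _ iS.
- split=> // h; apply: Qz; apply: h; apply: saddSr => //; exact: cycid.
- by move=> x /rQ [k Qk]; exists k; apply: QS.
exists (1 + n)%N; apply: (has_length_add iQ (@submodT A A^o) iS) => //.
by apply/cyc_len => //; rewrite eM; apply: has_length_maximal.
Qed.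

End LocalRing.

Section HilbertSamuel.
Variables (A : comNzRingType) (M J : set A).
Hypotheses (noethA : noetherian A) (M_local : local_ring M).
Hypotheses (J_ideal : is_ideal J) (JM : J `<=` M) (radJ : M_radical M J).

Implicit Types (P Q I : set A).

Let Jp k : set A := pow_smul J k (setT : set A^o).

Let Jp_ideal k : is_ideal (Jp k).
Proof. exact: (@pow_smul_submod A A^o). Qed.

Let Jp_dec k l : (k <= l)%N -> Jp l `<=` Jp k.
Proof. exact: (@pow_smul_le A A^o). Qed.

Lemma M_radical_pow k : M_radical M (Jp k).
Proof.
move=> x /radJ [e Je]; exists (e * k)%N; rewrite exprM.
elim: k => [//|k IH]; rewrite exprS; exact: (@smulP A A^o).
Qed.

(** The Hilbert-Samuel function of A / Q with respect to [J]. *)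
Definition HS (Q : set A) k : nat := length_quot ([set: A^o]) (sadd (Q : set A^o) (Jp k)).

Let sQ Q k : is_ideal Q -> is_ideal (sadd (Q : set A^o) (Jp k)).
Proof. by move=> iQ; apply: (@sadd_submod A A^o _ _ iQ (Jp_ideal k)). Qed.

Lemma HS_hlen Q k : is_ideal Q -> has_length ([set: A^o]) (sadd (Q : set A^o) (Jp k)) (HS Q k).
Proof.
move=> iQ; have [|n hn] := finite_length noethA M_local (sQ k iQ).
  move=> x /(@M_radical_pow k) [e he]; exists e.
  exact: (@saddSr A A^o).
by rewrite /HS (@has_length_length_quot A A^o _ _ _ (sQ k iQ) (@submodT A A^o) hn).
Qed.

Lemma HS_mono Q k l : is_ideal Q -> (k <= l)%N -> (HS Q k <= HS Q l)%N.
Proof.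
move=> iQ kl; apply: has_length_le (HS_hlen l iQ) (HS_hlen k iQ) => //.
by apply: (@saddS A A^o) => //; apply: Jp_dec.
Qed.

Lemma HS_anti Q Q' k : is_ideal Q -> is_ideal Q' -> Q `<=` Q' -> (HS Q' k <= HS Q k)%N.
Proof.
move=> iQ iQ' QQ'; apply: has_length_le (HS_hlen k iQ) (HS_hlen k iQ') => //.
exact: (@saddS A A^o).
Qed.

Let add_ideal Q (a : A) : is_ideal Q -> is_ideal (sadd (Q : set A^o) (cyc (a : A^o))).
Proof. by move=> iQ; apply: (@sadd_submod A A^o) => //; apply: cyc_submod. Qed.

Lemma HS_split Q a k : is_ideal Q ->
  exists2 l, has_length ([set: A^o]) (colon (sadd (Q : set A^o) (Jp k)) a) l
    & HS Q k = (HS (sadd (Q : set A^o) (cyc (a : A^o))) k + l)%N.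
Proof.
move=> iQ; have iS := sQ k iQ; have iSa := add_ideal a iS.
have [l [l' [h1 h2 e]]] := has_length_split iS (@submodT A A^o) iSa
  (@saddSl A A^o _ _ (cyc_submod _)) (@subsetT _ _) (HS_hlen k iQ).
exists l; first exact/cyc_len.
rewrite e addnC; congr (_ + _)%N.
apply: has_length_uniq h2 _.
have -> : sadd (sadd (Q : set A^o) (Jp k)) (cyc (a : A^o)) =
          sadd (sadd (Q : set A^o) (cyc (a : A^o))) (Jp k).
  by rewrite -!saddA; congr sadd; apply: saddC.
exact/HS_hlen/add_ideal.
Qed.

(** [c] is regular modulo the prime [P], so by Artin-Rees (P + J^(k+h)) : c lies in P + J^k. Hence
    passing to the quotient of A / P by c loses at least the length of A / (P + J^k). *)
Lemma HS_drop P P1 c : is_prime P -> is_ideal P1 -> P `<=` P1 -> P1 c -> ~ P c ->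
  exists h, forall k, (HS P1 (k + h) + HS P k <= HS P (k + h))%N.
Proof.
move=> [iP _ hP] iP1 PP1 P1c Pc; have iPc := add_ideal c iP.
have [h hh] := artin_rees noethA J_ideal iPc.
exists h => k; have [l hl ->] := HS_split c (k + h) iP.
apply: leq_add.
  apply: HS_anti => //; apply: (@sadd_min A A^o) => //.
  exact: (@cyc_min A A^o).
apply: has_length_le hl (HS_hlen k iP) => // a [p [j [Pp Jj e]]].
have : pow_smul J k (sadd (P : set A^o) (cyc (c : A^o))) j.
  rewrite -(addnK h k); apply: hh => //; first exact: leq_addl.
  exists (- p), (a * c); split; [exact: idealN|by exists a|by rewrite e addKr].
rewrite pow_smul_addr //; last exact: cyc_submod.
move=> [p' [_ [/(pow_smul_subr iP) Pp' /pow_smul_cyc1 [j' Jj' ->] ej]]].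
exists (a - j'), j'; rewrite subrK; split=> //.
suff : P ((a - j') * c) by case/hP.
rewrite mulrBl e ej; have -> : p + (p' + c * j') - j' * c = p + p' by ring.
exact: idealD.
Qed.

(** Using [HS_drop] k + 1 times gives (k + 1) HS(P1, k) <= HS(P, k + (k + 1) h) <= C ((h + 1) (k +
    1))^(d+1); dividing by k + 1 lowers the exponent. *)
Lemma HS_drop_growth P P1 c d C : is_prime P -> is_ideal P1 -> P `<=` P1 -> P1 c -> ~ P c ->
  (forall k, HS P k <= C * k.+1 ^ d.+1)%N -> exists C', forall k, (HS P1 k <= C' * k.+1 ^ d)%N.
Proof.
move=> pP iP1 PP1 P1c Pc hC; have [h hh] := HS_drop pP iP1 PP1 P1c Pc.
exists (C * h.+1 ^ d.+1)%N => k.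
have step i : (i * HS P1 k <= HS P (k + i * h))%N.
  elim: i => [//|i IH]; rewrite mulSn; apply: leq_trans (leq_add (leqnn _) IH) _.
  have -> : (k + i.+1 * h = k + i * h + h)%N by lia.
  apply: leq_trans (hh _); rewrite leq_add2r; apply: HS_mono => //; lia.
have := leq_trans (step k.+1) (hC _).
have le : ((k + k.+1 * h).+1 ^ d.+1 <= (h.+1 * k.+1) ^ d.+1)%N.
  by rewrite leq_exp2r; lia.
move=> /leq_trans /(_ (leq_mul (leqnn C) le)).
rewrite expnMn [X in (_ <= _ * (_ * X))%N]expnS.
have -> : (C * (h.+1 ^ d.+1 * (k.+1 * k.+1 ^ d)) = k.+1 * (C * h.+1 ^ d.+1 * k.+1 ^ d))%N by ring.
by rewrite leq_pmul2l.
Qed.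

Lemma HS_pos Q : is_ideal Q -> Q `<=` M -> (0 < HS Q 1)%N.
Proof.
move=> iQ QM; apply: (has_length_proper (@submodT A A^o) _ (HS_hlen 1 iQ)).
split=> // h; apply: (maximal_proper M_local).
have iM := maximal_ideal M_local.
apply: (@sadd_min A A^o _ _ _ iM QM _ 1 (h 1 I)).
apply: (@smul_min A A^o J setT M iM) => a x Ja _.
exact: (@idealMr A M x a iM (JM Ja)).
Qed.

(** Each strict inclusion of primes lowers the exponent of growth by one, and at exponent 0 no
    further inclusion is possible. *)
Lemma prime_chain_growth n d C : prime_chain A n ->
  (forall k, HS [set 0%R] k <= C * k.+1 ^ d)%N -> (n <= d)%N.
Proof.
move=> [p [pp sp]] h0.
have iz := @submod_zero A A^o.
have ip i : is_ideal (p i) by case: (pp i).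
have H i (hi : (i < n.+1)%N) : (i <= d)%N /\
    exists C', forall k, (HS (p (Ordinal hi)) k <= C' * k.+1 ^ (d - i))%N.
  elim: i hi => [|i IH] hi.
    split=> //; exists C => k; rewrite subn0; apply: leq_trans (h0 k).
    by apply: HS_anti => // x ->; apply: ideal0.
  have [id [C' hC']] := IH (ltnW hi).
  have lt : p (Ordinal (ltnW hi)) `<` p (Ordinal hi) by apply: sp.
  have [c pc npc] := proper_exists lt.
  have drop e : (forall k, HS (p (Ordinal (ltnW hi))) k <= C' * k.+1 ^ e.+1)%N ->
      exists C', forall k, (HS (p (Ordinal hi)) k <= C' * k.+1 ^ e)%N.
    exact: (HS_drop_growth (pp _) (ip _) (properW lt) pc npc).
  have [lid|] := ltnP i d.
    by split=> //; apply: drop => k; rewrite -subSn // subSS.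
  move=> di; have {id di} e : i = d by apply/eqP; rewrite eqn_leq id di.
  have [h hh] := HS_drop (pp _) (ip _) (properW lt) pc npc.
  (* At exponent 0 the function is bounded, yet each advance of its argument by [h] adds at least
     HS(P1, 1) >= 1. *)
  have step j : (j <= HS (p (Ordinal (ltnW hi))) (1 + j * h))%N.
    elim: j => [//|j IHj].
    have -> : (1 + j.+1 * h = 1 + j * h + h)%N by lia.
    apply: leq_trans (hh _); rewrite -add1n; apply: leq_add => //.
    apply: leq_trans (HS_mono (ip _) (_ : 1 <= _)%N); last by lia.
    exact: (HS_pos (ip _) (prime_sub_maximal noethA M_local (pp _))).
  have e' : (d - i = 0)%N by rewrite e subnn.
  have := leq_trans (step C'.+1) (hC' _).
  by rewrite e' expn0 muln1 ltnn.
by have [] := H n (ltnSn n).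
Qed.

Definition chain_over (Q : set A) n := exists p : 'I_n.+1 -> set A,
  [/\ forall i, is_prime (p i), forall i j : 'I_n.+1, (i < j)%N -> p i `<` p j
    & forall i, Q `<=` p i].

Lemma chain_over_cons P Q n : is_prime P -> P `<` Q -> chain_over Q n -> chain_over P n.+1.
Proof.
move=> pP PQ [p [pp sp Qp]].
have Pp i : P `<` p i by apply: proper_subset_trans PQ _.
exists (fun i => if unlift ord0 i is Some j then p j else P); split.
- by move=> i; case: unliftP.
- move=> i j; case: (unliftP ord0 j) => [j' -> |->]; last by rewrite ltn0.
  case: (unliftP ord0 i) => [i' -> |->]; first by rewrite !lift0 ltnS; apply: sp.
  by move=> _.
- by move=> i; case: unliftP => [j _|_] //; apply: properW.
Qed.

Lemma chain_overS Q Q' n : Q `<=` Q' -> chain_over Q' n -> chain_over Q n.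
Proof. by move=> QQ' [p [? ? h]]; exists p; split=> // i; apply: subset_trans QQ' _. Qed.

Let growth d Q := exists C, forall k, (HS Q k <= C * k.+1 ^ d)%N.

(** If a b lies in [Q] but neither factor does, then Q : a and Q + Aa are strictly larger, and their
    growth bounds add up to one for [Q]. So Noetherian induction leaves only the primes other than
    [M]. *)
Let HS_growth_nonprime d Q : is_ideal Q ->
  (forall Q', is_ideal Q' -> Q `<` Q' -> growth d Q') ->
  (is_prime Q -> Q <> M -> growth d Q) -> growth d Q.
Proof.
move=> iQ IH hprime; have [Q1|Q1] := pselect (Q 1).
  exists 0%N => k; suff -> : HS Q k = 0%N by [].
  apply: has_length_uniq (HS_hlen k iQ) _; rewrite (_ : sadd _ _ = setT); first exact: has_length_xx.
  apply/seteqP; split=> // x _; apply: (@saddSl A A^o _ _ (Jp_ideal k)).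
  by rewrite (ideal1 iQ Q1).
have [pQ|nQ] := pselect (is_prime Q).
  have [e|] := pselect (Q = M); last exact: hprime.
  exists 1%N => k; rewrite mul1n; apply: (@leq_trans 1); last by rewrite expn_gt0.
  apply: has_length_le (has_length_maximal M_local) (HS_hlen k iQ) => //.
  rewrite -e; exact: (@saddSl A A^o _ _ (Jp_ideal k)).
have [a [b [ab na nb]]] : exists a b, [/\ Q (a * b), ~ Q a & ~ Q b].
  apply: contrapT => h; apply: nQ; split=> // x y xy; apply: contrapT => /not_orP [nx ny].
  by apply: h; exists x, y; split.
have iC := colon_ideal a iQ.
have QC : Q `<` colon Q a.
  split; first by move=> x Qx; apply: idealMr.
  by move=> h; apply: nb; apply: h; rewrite /colon /= mulrC.
have QS : Q `<` sadd (Q : set A^o) (cyc (a : A^o)).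
  split; first exact: (@saddSl A A^o _ _ (cyc_submod _)).
  by move=> h; apply: na; apply: h; apply: (@saddSr A A^o) => //; exact: cycid.
have [C1 hC1] := IH _ iC QC; have [C2 hC2] := IH _ (add_ideal a iQ) QS.
exists (C2 + C1)%N => k; have [l hl ->] := HS_split a k iQ.
rewrite mulnDl; apply: leq_add => //; apply: leq_trans (hC1 k).
apply: has_length_le (HS_hlen k iC) hl => // x [u [v [uC Jv ->]]].
exists (u * a), (v * a); split=> //; last by rewrite -mulrDl.
exact: (idealMr a (Jp_ideal k) Jv).
Qed.

(** Converse of [prime_chain_growth]. For a prime [Q] other than [M], adjoining c from [J] outside
    [Q] shortens the chains of primes; the increments of HS(Q) are bounded by HS(Q + Ac), and
    summing them raises the exponent by one. *)
Lemma HS_growth d Q : is_ideal Q -> (forall n, chain_over Q n -> (n <= d)%N) ->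
  exists C, forall k, (HS Q k <= C * k.+1 ^ d)%N.
Proof.
elim: d Q => [|d IHd] Q iQ; move: Q iQ; apply: (noeth_ind noethA) => Q iQ IH hQ;
  apply: HS_growth_nonprime => // [Q' iQ' QQ'|pQ ne].
- by apply: IH => // n /(chain_overS (properW QQ')); apply: hQ.
- suff : (1 <= 0)%N by [].
  apply: hQ; apply: (chain_over_cons pQ (Q := M)).
    split; first exact: (prime_sub_maximal noethA M_local pQ).
    by move=> h; apply: ne; apply/seteqP; split=> //; apply: (prime_sub_maximal noethA M_local pQ).
  exists (fun=> M); split=> [_|i j|_]; [exact: (maximal_prime noethA M_local)|by rewrite !ord1|by []].
- by apply: IH => // n /(chain_overS (properW QQ')); apply: hQ.
(* Taking [c] in [J] makes c J^k lie in J^(k+1), so that (Q + J^(k+1)) : c contains Q + J^k. *)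
have [c Jc Qc] : exists2 c, J c & ~ Q c.
  apply: contrapT => h; apply: ne; apply: (prime_of_M_radical noethA M_local pQ).
  move=> x /radJ [k Jk]; exists k; apply: contrapT => nQ; apply: h; by exists (x ^+ k).
have ltS : Q `<` sadd (Q : set A^o) (cyc (c : A^o)).
  split; first exact: (@saddSl A A^o _ _ (cyc_submod _)).
  by move=> h; apply: Qc; apply: h; apply: (@saddSr A A^o) => //; exact: cycid.
have [n hn|C hC] := IHd _ (add_ideal c iQ).
  by rewrite -ltnS; apply: hQ; apply: chain_over_cons hn.
have step k : (HS Q k.+1 <= HS Q k + C * k.+2 ^ d)%N.
  have [l hl ->] := HS_split c k.+1 iQ; rewrite addnC; apply: leq_add => //.
  apply: has_length_le (HS_hlen k iQ) hl => // x [u [v [Qu Jv ->]]].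
  exists (u * c), (v * c); split; [exact: idealMr| |by rewrite mulrDl].
  by rewrite mulrC; apply: (@smulP A A^o).
exists (HS Q 0 + C)%N; elim=> [|k IHk]; first by rewrite exp1n muln1 leq_addr.
apply: leq_trans (step k) _; apply: leq_trans (leq_add IHk (leqnn _)) _.
set B := (HS Q 0 + C)%N.
have CB : (C * k.+2 ^ d <= B * k.+2 ^ d)%N by rewrite leq_mul2r leq_addl orbT.
have E : (B * k.+1 ^ d.+1 <= B * (k.+1 * k.+2 ^ d))%N.
  have e2 : (k.+1 ^ d <= k.+2 ^ d)%N by case: (d) => [//|e]; rewrite leq_exp2r.
  by rewrite expnS !leq_mul2l e2 !orbT.
apply: leq_trans (leq_add E CB) _.
by rewrite expnS -mulnDr -mulSnr.
Qed.

End HilbertSamuel.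

(** * Coefficients of Hilbert polynomials *)

Section PolynomialGrowth.
Implicit Type p q : {poly rat}.

Lemma poly_growth p : exists C : nat, forall n,
  `|p.[n%:R]| <= C%:R * n.+1%:R ^+ (size p).-1.
Proof.
pose s := \sum_(i < size p) `|p`_i|.
have s0 : 0 <= s by apply: sumr_ge0.
exists (Num.bound s) => n.
have le : s <= (Num.bound s)%:R by apply/ltW/archi_boundP.
apply: le_trans (ler_wpM2r _ le); last by rewrite exprn_ge0.
rewrite horner_coef mulr_suml; apply: le_trans (ler_norm_sum _ _ _) _.
apply: ler_sum => i _; rewrite normrM ler_wpM2l //.
rewrite ger0_norm ?exprn_ge0 //; apply: (@le_trans _ _ (n.+1%:R ^+ i)).
  by apply: lerXn2r; rewrite ?nnegrE ?ler0n // ler_nat.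
apply: ler_weXn2l; first by rewrite ler1n.
by rewrite -ltnS prednK; [exact: ltn_ord|apply: leq_ltn_trans (ltn_ord i)].
Qed.

(** If the degree exceeded [e], isolating the leading term would bound a positive multiple of n by a
    constant for all large n, against the Archimedean property. *)
Lemma poly_size_growth p C e n0 :
  (forall n, (n0 <= n)%N -> `|p.[n%:R]| <= C * n.+1%:R ^+ e) -> (size p <= e.+1)%N.
Proof.
move=> h; rewrite leqNgt; apply/negP => lt.
case ep : (size p) lt => [//|[//|s]]; rewrite ltnS => es.
pose p' := p - lead_coef p *: 'X^(s.+1).
have sp' : (size p' <= s.+1)%N.
  apply/leq_sizeP => j; rewrite leq_eqVlt => /orP[/eqP <-|lt].
    by rewrite coefB coefZ coefXn eqxx mulr1 lead_coefE ep subrr.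
  by rewrite coefB coefZ coefXn gtn_eqF // mulr0 subr0 nth_default // ep.
have [C' hC'] := poly_growth p'.
have c0 : 0 < `|lead_coef p| by rewrite normr_gt0 lead_coef_eq0 -size_poly_gt0 ep.
have key n : (maxn 1 n0 <= n)%N -> `|lead_coef p| * n%:R <= (C'%:R + `|C|) * 2 ^+ s.
  rewrite geq_max => /andP[n1 hn]; have npos : 0 < n%:R :> rat by rewrite ltr0n.
  have e1 : lead_coef p * n%:R ^+ s.+1 = p.[n%:R] - p'.[n%:R].
    by rewrite /p' hornerD hornerN hornerZ hornerXn opprB addrC subrK.
  have n1' : 1 <= n.+1%:R :> rat by rewrite ler1n.
  have b1 : `|p.[n%:R]| <= `|C| * n.+1%:R ^+ s.
    apply: le_trans (h n hn) _; apply: (@le_trans _ _ (`|C| * n.+1%:R ^+ e)).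
      by apply: ler_wpM2r; rewrite ?exprn_ge0 // ler_norm.
    by apply: ler_wpM2l => //; apply: ler_weXn2l.
  have b2 : `|p'.[n%:R]| <= C'%:R * n.+1%:R ^+ s.
    apply: le_trans (hC' n) _; apply: ler_wpM2l => //; apply: ler_weXn2l => //.
    by case: (size p') sp'.
  have b3 : (n.+1%:R : rat) ^+ s <= 2 ^+ s * n%:R ^+ s.
    rewrite -exprMn; apply: lerXn2r; rewrite ?nnegrE ?mulr_ge0 ?ler0n //.
    by rewrite -natrM ler_nat; lia.
  rewrite -(ler_pM2r (exprn_gt0 s npos)) -mulrA -exprS.
  rewrite -{1}[n%:R ^+ s.+1]ger0_norm ?exprn_ge0 ?ler0n // -normrM e1.
  apply: le_trans (ler_normB _ _) _; apply: le_trans (lerD b1 b2) _.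
  rewrite -mulrDl addrC -mulrA; apply: ler_wpM2l => //.
  by rewrite addr_ge0.
pose B := (C'%:R + `|C|) * 2 ^+ s / `|lead_coef p|.
have B0 : 0 <= B by rewrite !mulr_ge0 ?invr_ge0 ?addr_ge0 ?exprn_ge0.
have := key (maxn (maxn 1 n0) (Num.bound B)) (leq_maxl _ _).
rewrite mulrC -ler_pdivlMr //; apply/negP; rewrite -ltNge.
apply: lt_le_trans (archi_boundP B0) _.
by rewrite ler_nat leq_maxr.
Qed.

Lemma poly_eq_nat p q n0 : (forall n, (n0 <= n)%N -> p.[n%:R] = q.[n%:R]) -> p = q.
Proof.
move=> h; apply/eqP; rewrite -subr_eq0; apply/negPn/negP => ne.
have := max_poly_roots ne (rs := [seq (n0 + i)%:R | i <- iota 0 (size (p - q)%R)]).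
rewrite size_map size_iota ltnn => H; suff: false by [].
apply: H.
  apply/allP => _ /mapP [i _ ->]; rewrite rootE hornerD hornerN h ?subrr //.
  exact: leq_addr.
rewrite map_inj_uniq ?iota_uniq // => i j /eqP.
by rewrite eqr_nat eqn_add2l => /eqP.
Qed.

End PolynomialGrowth.

(** * Krull dimension as an order of growth, and comparison of Hilbert coefficients *)

Section KrullDimension.
Variables (A : comNzRingType) (M J : set A).
Hypotheses (noethA : noetherian A) (M_local : local_ring M).
Hypotheses (J_ideal : is_ideal J) (JM : J `<=` M) (radJ : M_radical M J).

Lemma hilbert_function (I : set A) : is_ideal I ->
  exists2 l : nat -> nat, evpoly l &
    forall n, has_length (pow_smul J n (I : set A^o)) (pow_smul J n.+1 (I : set A^o)) (l n).
Proof.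
by move=> iI; have [b hb] := finite_length noethA M_local J_ideal radJ; apply: hilbert_ideal hb.
Qed.

Lemma has_length_pow_sum (L : lmodType A) (I : set L) (l : nat -> nat) : is_submod I ->
  (forall n, has_length (pow_smul J n I) (pow_smul J n.+1 I) (l n)) ->
  forall n, has_length I (pow_smul J n I) (\sum_(i < n) l i).
Proof.
move=> sI hl; elim=> [|n IH]; first by rewrite big_ord0; apply: has_length_xx.
rewrite big_ord_recr /= addnC; apply: has_length_add (hl n) IH => //; exact: pow_smul_submod.
Qed.

Lemma HS0E k : sadd ([set 0%R] : set A^o) (pow_smul J k (setT : set A^o)) = pow_smul J k (setT : set A^o).
Proof.
apply: sadd_idl; [exact: submod_zero|exact: pow_smul_submod|].
by move=> _ ->; apply: submod0 (pow_smul_submod _ _ _).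
Qed.

Lemma HS0_hlen k : has_length ([set: A^o]) (pow_smul J k (setT : set A^o)) (HS J ([set 0%R] : set A) k).
Proof.
by rewrite -HS0E; exact: (HS_hlen noethA M_local radJ k (@submod_zero A A^o)).
Qed.

Lemma HS0_evpoly : evpoly (HS J ([set 0%R] : set A)).
Proof.
have [l el hl] := hilbert_function (@idealT A).
apply: (evpoly_ext (k := 0)) (evpoly_partial_sum el) => n _.
exact: has_length_uniq (has_length_pow_sum (@submodT _ _) hl n) (HS0_hlen n).
Qed.

(** The degree of the Hilbert-Samuel polynomial bounds the chains, which rules out the default value
    of [krull_dim]. *)
Lemma prime_chain_bounded : exists d, forall n, prime_chain A n -> (n <= d)%N.
Proof.
have [p [n0 hp]] := HS0_evpoly; have [C hC] := poly_growth p.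
exists (size p).-1 => n cn.
(* The maximum covers the arguments below [n0], where the polynomial need not give the values. *)
pose B := (C + \max_(i < n0) HS J ([set 0%R] : set A) i)%N.
apply: (@prime_chain_growth _ M J noethA M_local J_ideal JM radJ n _ B cn) => k.
have [nk|kn] := leqP n0 k; last first.
  apply: (@leq_trans B); last by rewrite leq_pmulr // expn_gt0.
  apply: leq_trans (leq_addl _ _).
  exact: (leq_bigmax (Ordinal kn)).
apply: (@leq_trans (C * k.+1 ^ (size p).-1)%N); last by rewrite leq_mul2r leq_addr orbT.
rewrite -(ler_nat rat) natrM natrX; apply: le_trans (hC k).
by rewrite hp // ler_norm.
Qed.

Lemma prime_chain0 : prime_chain A 0.
Proof.
exists (fun=> M); split; first by move=> _; apply: maximal_prime noethA M_local.
by move=> i j; rewrite !ord1.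
Qed.

Lemma krull_dimP : prime_chain A (krull_dim A) /\
  forall n, prime_chain A n -> (n <= krull_dim A)%N.
Proof.
have [d hd] := prime_chain_bounded.
have ex : exists n, `[< prime_chain A n >] by exists 0%N; apply/asboolP/prime_chain0.
have ub n : `[< prime_chain A n >] -> (n <= d)%N by move/asboolP; apply: hd.
case: (ex_maxnP ex ub) => n /asboolP h1 h2.
have h2' k : prime_chain A k -> (k <= n)%N by move=> hk; apply/h2/asboolP.
suff -> : krull_dim A = n by split.
rewrite /krull_dim /supremum; case: eqP => [e|_]; first by rewrite e in h1.
have hs : supremums (prime_chain A) n.
  by split; [move=> k /h2'; rewrite leEnat|move=> k; apply].
exact: (is_subset1_supremums (xgetPex _ (ex_intro _ n hs)) hs).
Qed.

(** With [krull_dim_le] this makes [krull_dim A] the least exponent of growth, a description that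
    can be compared between two rings. *)
Lemma HS0_growth : exists C, forall k, (HS J ([set 0%R] : set A) k <= C * k.+1 ^ krull_dim A)%N.
Proof.
apply: (HS_growth noethA M_local radJ); first exact: (@submod_zero A A^o).
by move=> n [p [? ? _]]; apply: krull_dimP.2; exists p.
Qed.

Lemma krull_dim_le d C : (forall k, HS J ([set 0%R] : set A) k <= C * k.+1 ^ d)%N -> (krull_dim A <= d)%N.
Proof. exact: (prime_chain_growth noethA M_local J_ideal JM radJ krull_dimP.1). Qed.

(* By Artin-Rees, length (A / J^(n-h)) <= length (I / J^n I) <= length (A / J^(n+h')),
   so the two Hilbert-Samuel polynomials differ by one of lower degree. *)
Lemma hilbert_coef_ideal (I : set A) c (l l' : nat -> nat) (p p' : {poly rat}) n0 :
  is_ideal I -> I c -> (forall x y, x * c = y * c -> x = y) -> (0 < krull_dim A)%N ->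
  (forall n, has_length (pow_smul J n (I : set A^o)) (pow_smul J n.+1 (I : set A^o)) (l n)) ->
  (forall n, has_length (pow_smul J n (setT : set A^o)) (pow_smul J n.+1 (setT : set A^o)) (l' n)) ->
  (forall n, (n0 <= n)%N -> p.[n%:R] = (l n)%:R) ->
  (forall n, (n0 <= n)%N -> p'.[n%:R] = (l' n)%:R) ->
  p`_(krull_dim A).-1 = p'`_(krull_dim A).-1.
Proof.
move=> iI Ic creg dpos hl hl' hp hp'; set d := krull_dim A in dpos *.
have ic : is_ideal (cyc (c : A^o)) by apply: cyc_submod.
have icI : cyc (c : A^o) `<=` I by apply: cyc_min.
have [h hh] := artin_rees noethA J_ideal ic.
have [h' hh'] := artin_rees noethA J_ideal iI.
have iJI n : is_ideal (pow_smul J n (I : set A^o)) by apply: pow_smul_submod.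
have iJT n : is_ideal (pow_smul J n (setT : set A^o)) by apply: pow_smul_submod.
pose HI n := (\sum_(i < n) l i)%N; pose HT n := HS J ([set 0%R] : set A) n.
have hHI n : has_length (I : set A^o) (pow_smul J n (I : set A^o)) (HI n) by apply: has_length_pow_sum hl n.
have hHT n : has_length ([set: A^o]) (pow_smul J n (setT : set A^o)) (HT n) by apply: HS0_hlen.
have HTE n : HT n = (\sum_(i < n) l' i)%N.
  exact: has_length_uniq (hHT n) (has_length_pow_sum (@submodT A A^o) hl' n).
(* Multiplication by [c] embeds A / (J^n I : c) in I / J^n I; as [c] is regular, Artin-Rees for the
   ideal (c) puts J^n I : c inside J^(n-h). *)
have low n : (h <= n)%N -> (HT (n - h) <= HI n)%N.
  move=> hn; have iS := sadd_submod (iJI n) ic.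
  have [a [b [ha hb ->]]] := has_length_split (iJI n) iI iS (saddSl ic)
    (sadd_min iI (pow_smul_subr iI) icI) (hHI n).
  apply: leq_trans (leq_addr _ _); move/cyc_len: ha => /(_ (iJI n)) ha.
  apply: has_length_le ha (hHT _) => // x hx.
  have : pow_smul J (n - h) (cyc (c : A^o)) (x * c).
    by apply: hh => //; [exists x|apply: (pow_smulS (@subsetT _ _)) hx].
  by move=> /pow_smul_cyc1 [y Jy]; rewrite [c * y]mulrC => /creg ->.
have up n : (HI n <= HT (n + h'))%N.
  have sI : has_chain (I : set A^o) (I `&` pow_smul J (n + h') (setT : set A^o)) (HI n).
    apply: has_chain_mono (hHI n).1 => // x [Ix Jx].
    by rewrite -(addnK h' n); apply: hh' => //; apply: leq_addl.
  have sII := submodI iI (iJT (n + h')%N).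
  have [a [b [le ha hb]]] := has_chain_split sII iI (iJT (n + h')%N) sI.
  rewrite -setIA setIid in ha.
  have := (@has_length_xx A A^o _).2 _ ha.
  rewrite leqn0 => /eqP a0; rewrite a0 in le; apply: leq_trans le _.
  apply: (hHT _).2; apply: has_chain_mono hb => //.
  exact: saddSr.
have evl : evpoly l by exists p, n0.
have evl' : evpoly l' by exists p', n0.
have [PI [n1 hPI]] := evpoly_partial_sum evl.
have [PT [n2 hPT]] := evpoly_partial_sum evl'.
have sPT : (size PT <= d.+1)%N.
  have [C hC] := HS0_growth.
  apply: (@poly_size_growth PT C%:R d n2) => n hn.
  by rewrite hPT // -HTE ger0_norm ?ler0n // -natrX -natrM ler_nat; apply: hC.
(* The gap between the two bounds; both shifts of [PT] have the same leading term, so the degree of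
   [E] is below [d]. *)
pose E := (PT \Po ('X + h'%:R%:P) - PT) - (PT \Po ('X + (- h%:R)%:P) - PT).
have sE : (size E <= d)%N.
  have s1 a : (size (PT \Po ('X + a%:P) - PT)%R <= d)%N.
    by apply: leq_trans (size_shift_sub PT a) _; case: (size PT) sPT.
  by apply: leq_trans (size_polyD _ _) _; rewrite size_polyN geq_max !s1.
have [C hC] := poly_growth E.
have sD : (size (PI - PT)%R <= d)%N.
  rewrite -(prednK dpos).
  apply: (@poly_size_growth _ C%:R _ (n1 + n2 + h)%N) => n hn.
  have En : `|(PI - PT).[n%:R]| <= E.[n%:R].
    have -> : E.[n%:R] = (HT (n + h')%N)%:R - (HT (n - h)%N)%:R.
      have hn' : (h <= n)%N by lia.
      have cE a : (PT \Po ('X + a%:P)).[n%:R] = PT.[n%:R + a].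
        by rewrite horner_comp hornerD hornerX hornerC.
      rewrite /E !hornerD !hornerN !hornerD !hornerN !cE -natrD -(natrB _ hn').
      rewrite !hPT; [|lia..]; rewrite -!HTE; ring.
    rewrite hornerD hornerN hPI; last by lia.
    rewrite hPT; last by lia.
    rewrite -HTE -/(HI n).
    have hm m k : (m <= k)%N -> (HT m <= HT k)%N.
      by move=> mk; apply: (HS_mono noethA M_local radJ (@submod_zero A A^o)).
    have l1 : (HT (n - h)%N)%:R <= (HI n)%:R :> rat by rewrite ler_nat low //; lia.
    have l2 : (HI n)%:R <= (HT (n + h')%N)%:R :> rat by rewrite ler_nat up.
    have l3 : (HT (n - h)%N)%:R <= (HT n)%:R :> rat by rewrite ler_nat hm //; lia.
    have l4 : (HT n)%:R <= (HT (n + h')%N)%:R :> rat by rewrite ler_nat hm //; lia.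
    rewrite ler_norml; apply/andP; split; lra.
  apply: le_trans En _; apply: le_trans (ler_norm _) _; apply: le_trans (hC n) _.
  apply: ler_wpM2l => //; apply: ler_weXn2l; first by rewrite ler1n.
  by case: (size E) sE => [//|k] /= kd; lia.
(* Taking the first difference of PI - PT, of degree below [d], loses one more degree, so the
   coefficient of X^(d-1) vanishes. *)
have pE : p - p' = (PI - PT) \Po ('X + 1%:P) - (PI - PT).
  apply: (@poly_eq_nat _ _ (n0 + n1 + n2)%N) => n hn.
  rewrite !hornerD !hornerN horner_comp !hornerD !hornerN hornerX hornerC natr1.
  rewrite hp; last by lia.
  rewrite hp'; last by lia.
  rewrite !hPI; [|lia..]; rewrite !hPT; [|lia..].
  rewrite !big_ord_recr /= !natrD; ring.
apply/eqP; rewrite -subr_eq0 -coefB pE nth_default //.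
apply: leq_trans (size_shift_sub _ _) _.
by rewrite -!subn1 leq_sub2r.
Qed.

End KrullDimension.

(** * Minimal numbers of generators *)

Section MinimalGenerators.
Variables (A : comNzRingType) (M : set A).
Hypotheses (noethA : noetherian A) (M_local : local_ring M).
Implicit Types (I Q : set A) (s t : seq A).

Let M_ideal := maximal_ideal M_local.

Let lsp t : set A := span ([set` t] : set A^o).

Let lsp_ideal t : is_ideal (lsp t).
Proof. exact: span_submod. Qed.

Lemma generated_by_seq I n : generated_by (I : set A^o) n <->
  exists2 s, size s = n & I = span ([set` s] : set A^o).
Proof.
split=> [[x ->]|[s <- ->]].
  exists (codom x); first by rewrite size_codom card_ord.
  apply: (congr1 (@span A A^o)); apply/seteqP.
  by split=> [_ [i _ <-]|_ /codomP [i ->]]; [apply/codom_f|exists i].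
exists (fun i => tnth (in_tuple s) i); apply: (congr1 (@span A A^o)); apply/seteqP.
split=> [x xs|_ [i _ <-]]; last exact: mem_tnth.
by have /tnthP [i ->] : x \in in_tuple s by []; exists i.
Qed.

(** One member of [s] is eliminated at a time: y = m y + w with m in [M] and w in the span of the
    others plus [Q], and 1 - m is a unit. *)
Lemma nakayama I Q s : is_ideal I -> is_ideal Q ->
  I `<=` sadd (smul M (I : set A^o)) Q -> (forall y, y \in s -> I y) ->
  I `<=` sadd (lsp s : set A^o) Q -> I `<=` Q.
Proof.
move=> iI iQ IMQ; elim: s => [|y s IH] sI.
  rewrite /lsp (@span_nil A A^o) sadd_idl //; first exact: (@submod_zero A A^o).
  by move=> _ ->; apply: ideal0.
rewrite /lsp (@span_seq_cons A A^o) -/(lsp s) => IS.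
have sI' z : z \in s -> I z by move=> zs; apply: sI; rewrite inE zs orbT.
have iT : is_ideal (sadd (lsp s : set A^o) Q) by apply: sadd_ideal => //; apply: lsp_ideal.
have IE x : I x -> exists b w, [/\ sadd (lsp s : set A^o) Q w & x = b * y + w].
  move=> /IS [_ [q [[t [_ [ht [b ->] ->]]] hq ->]]]; exists b, (t + q).
  split; first by exists t, q.
  by rewrite [t + _]addrC addrA.
have [m [w [Mm Tw ey]]] : exists m w, [/\ M m, sadd (lsp s : set A^o) Q w & y = m * y + w].
  have [z [q [hz hq ey]]] := IMQ y (sI y (mem_head _ _)).
  suff [m [w [Mm Tw ez]]] : exists m w, [/\ M m, sadd (lsp s : set A^o) Q w & z = m * y + w].
    exists m, (w + q); split=> //; last by rewrite {1}ey ez addrA.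
    exact: (idealD iT Tw (@saddSr A A^o _ _ (lsp_ideal s) _ hq)).
  have sU : is_submod [set z : A^o | exists m w, [/\ M m, sadd (lsp s : set A^o) Q w & z = m * y + w]].
    split; first by exists 0, 0; split; [exact: ideal0|exact: ideal0|rewrite mul0r addr0].
    move=> a _ _ [m [w [Mm Tw ->]]] [m' [w' [Mm' Tw' ->]]].
    exists (a * m + m'), (a * w + w'); split; [exact: M_ideal.2|exact: iT.2|].
    by change (a * (m * y + w) + (m' * y + w') = (a * m + m') * y + (a * w + w')); ring.
  move: z hz {ey}; apply: (smul_min sU) => a x Ma /IE [b [w [Tw ->]]].
  exists (a * b), (a * w); split; [exact: idealMr|exact: idealMl|].
  by change (a * (b * y + w) = a * b * y + a * w); ring.
have [|u hu] := @local_unit A M noethA M_local (1 - m).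
  by move=> h; apply: (maximal_proper M_local); rewrite -(subrK m 1); apply: idealD.
apply: IH => // x /IE [b [w' [Tw' ->]]]; apply: (idealD iT) => //; apply: (idealMl _ iT).
have -> : y = u * w.
  by rewrite -[LHS]mul1r -hu -mulrA mulrBl mul1r {1}ey addrAC subrr add0r.
exact: idealMl.
Qed.

(* Adding the members of a minimal generating sequence to M I one by one, each
   step has length exactly 1: by Nakayama no generator is redundant. *)
Lemma has_length_mu I : is_ideal I -> has_length (I : set A^o) (smul M (I : set A^o)) (mu (I : set A^o)).
Proof.
move=> iI; have [s0 n0] := noethA iI.
have ex : exists n, `[< generated_by (I : set A^o) n >].
  by exists s0; apply/asboolP.
case: (ex_minnP ex) => n /asboolP gn minn.
have min k : generated_by (I : set A^o) k -> (n <= k)%N by move=> h; apply/minn/asboolP.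
have -> : mu (I : set A^o) = n.
  rewrite /mu /infimum; case: eqP => [e|_]; first by rewrite e in gn.
  have hs : infimums (generated_by (I : set A^o)) n.
    by split; [move=> k /min; rewrite leEnat|move=> k; apply].
  exact: (is_subset1_infimums (xgetPex _ (ex_intro _ n hs)) hs).
have /generated_by_seq [s ss Is] := gn.
have sI y : y \in s -> I y by move=> ys; rewrite Is; apply: sub_span.
have iMI : is_ideal (smul M (I : set A^o)) by apply: smul_submod.
suff H s1 s2 : s = s1 ++ s2 ->
    has_length (sadd (smul M (I : set A^o)) (lsp s1)) (smul M (I : set A^o)) (size s1).
  rewrite -ss; have := H s [::]; rewrite cats0 => /(_ erefl).
  by rewrite /lsp -Is sadd_idl //; apply: smul_subr.
elim/last_ind: s1 s2 => [|s1 y IH] s2 e.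
  rewrite /lsp (@span_nil A A^o) saddC sadd_idl //; first exact: has_length_xx.
    exact: submod_zero.
  by move=> _ ->; apply: ideal0.
have lspS : lsp (rcons s1 y) = sadd (lsp s1 : set A^o) (cyc (y : A^o)).
  rewrite /lsp -(@span_seq_cons A A^o); apply: (congr1 (@span A A^o)).
  by apply/seteqP; split=> z /=; rewrite mem_rcons.
rewrite cat_rcons in e.
have Iy : I y by apply: sI; rewrite e mem_cat mem_head orbT.
have iU : is_ideal (sadd (smul M (I : set A^o)) (lsp s1)) by apply: sadd_ideal => //; apply: lsp_ideal.
rewrite lspS saddA size_rcons -addn1.
apply: (has_length_add iMI (sadd_submod iU (cyc_submod _)) iU) (IH _ e) _.
apply/cyc_len => //.
have nU : ~ sadd (smul M (I : set A^o)) (lsp s1) y.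
  move=> Uy; suff: (n <= (size s).-1)%N by rewrite -ss e size_cat /= addnS ltnn.
  apply: min; apply/generated_by_seq; exists (s1 ++ s2).
    by rewrite e !size_cat /= addnS.
  have iS := lsp_ideal (s1 ++ s2).
  have sub z : z \in s1 ++ s2 -> z \in s.
    by rewrite e !mem_cat inE => /orP[->|->]; rewrite ?orbT.
  apply/seteqP; split; last first.
    by rewrite [X in _ `<=` X]Is; apply: (@spanS A A^o) => z; apply: sub.
  apply: (@nakayama I _ s) => //; last first.
    by rewrite /lsp -Is; exact: (@saddSl A A^o _ _ iS).
  rewrite {1}Is; apply: (span_min (sadd_submod iMI iS)) => z.
  rewrite /= e mem_cat inE => zs.
  have [ez|zs'] : z = y \/ z \in s1 ++ s2.
    by case/or3P: zs => [h|/eqP ->|h]; [right|left|right]; rewrite // mem_cat h ?orbT.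
    rewrite ez; move: Uy; apply: (@saddS A A^o) => //; apply: (@spanS A A^o) => v /= vs.
    by rewrite mem_cat vs.
  by apply: (@saddSr A A^o) => //; apply: sub_span.
suff -> : colon (sadd (smul M (I : set A^o)) (lsp s1)) y = M by apply: has_length_maximal.
have iC := colon_ideal y iU.
apply/seteqP; split.
  by apply: (local_proper noethA M_local iC); rewrite /colon /= mul1r.
move=> a Ma; apply: (@saddSl A A^o _ _ (lsp_ideal s1)); exact: (@smulP A A^o M I a y Ma Iy).
Qed.

End MinimalGenerators.

(** * Modules over a discrete valuation ring *)

Lemma submod_restrict (A B : comNzRingType) (phi : {rmorphism A -> B}) (L : lmodType B)
  (P : set L) : is_submod P -> is_submod (P : set (restrict_scalars phi L)).
Proof. by move=> [p0 pZ]; split=> // a u v Pu Pv; apply: pZ. Qed.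

Section FiberLength.
Variables (A B : comNzRingType) (phi : {rmorphism A -> B}) (L : lmodType B).
Variables (m : set B) (n e : nat) (y : 'I_n -> L).
Local Notation rB := (restrict_scalars phi B^o).
Local Notation rL := (restrict_scalars phi L).
Hypothesis m_ideal : is_ideal m.
Hypothesis y_basis : fiber_basis m y.
Hypothesis len_B : has_length ([set: rB]) (m : set rB) e.

Let mL : set L := smul m setT.
Let mL_submod : is_submod mL. Proof. exact: smul_submod. Qed.

Let part (a : 'I_n -> B) i : L := \sum_(j < n | (j < i)%N) a j *: y j.

Let U i : set L := [set z | exists a, mL (z - part a i)].

Let U_submod i : is_submod (U i).
Proof.
split.
  exists (fun=> 0); rewrite /part big1 ?subr0; last by move=> j _; rewrite scale0r.
  exact: submod0.
move=> b u v [a ha] [a' ha']; exists (fun j => b * a j + a' j).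
have -> : part (fun j => b * a j + a' j) i = b *: part a i + part a' i.
  rewrite /part scaler_sumr -big_split; apply: eq_bigr => j _.
  by rewrite scalerDl scalerA.
exact: (eqmD mL_submod (eqmZ b mL_submod ha) ha').
Qed.

Let partS a (i : 'I_n) : part a i.+1 = part a i + a i *: y i.
Proof.
rewrite /part (bigD1 i) //= addrC; congr (_ + _).
by apply: eq_bigl => j; rewrite ltnS ltn_neqAle andbC.
Qed.

Let mLU i : mL `<=` U i.
Proof.
move=> z hz; exists (fun=> 0); rewrite /part big1 ?subr0 // => j _.
by rewrite scale0r.
Qed.

Let U_step (i : 'I_n) z : U i.+1 z <-> exists v, U i (z - v *: y i).
Proof.
split=> [[a ha]|[v [a ha]]].
  by exists (a i), a; move: ha; rewrite partS opprD addrA addrAC.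
exists (fun j => if j == i then v else a j).
rewrite partS eqxx opprD addrA addrAC; congr (mL (_ - _)): ha.
by apply: eq_bigr => j ji; case: eqP ji => // ->; rewrite ltnn.
Qed.

Let U_ker (i : 'I_n) v : U i (v *: y i) <-> m v.
Proof.
split; last by move=> mv; apply: mLU; apply: smulP.
(* [b] holds the coefficients of v y_i minus a combination of the earlier basis vectors;
   independence modulo [m] forces v into [m]. *)
move=> [a ha]; pose b (j : 'I_n) := if (j < i)%N then - a j else if j == i then v else 0.
suff e' : \sum_j b j *: y j = v *: y i - part a i.
  by have := y_basis.2 b; rewrite e' => /(_ ha i); rewrite /b ltnn eqxx.
rewrite (bigD1 i) //= {1}/b ltnn eqxx; congr (_ + _).
rewrite /part -sumrN [LHS]big_mkcond [RHS]big_mkcond; apply: eq_bigr => j _.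
rewrite /b; have [->|ji] := eqVneq j i; first by rewrite ltnn.
by case: ifP => _ /=; rewrite ?scaleNr ?scale0r.
Qed.

(** The layers of the filtration [U] by initial segments of the basis are copies of B / m. With
    [phi] the identity of [S] this measures V / NV, and with [phi] equal to [jS] it measures K /
    xK. *)
Lemma has_length_fiber : has_length ([set: rL]) (mL : set rL) (n * e).
Proof.
have UT : (U n : set L) = setT.
  apply/seteqP; split=> // z _; have [a ha] := y_basis.1 z; exists a.
  by rewrite /part (eq_bigl xpredT) // => j; rewrite ltn_ord.
suff H i : (i <= n)%N -> has_length (U i : set rL) (mL : set rL) (i * e).
  by have := H n (leqnn n); rewrite UT.
elim: i => [_|i IH lt].
  have -> : U 0%N = mL.
    apply/seteqP; split=> z; last exact: mLU.
    by move=> [a]; rewrite /part big_pred0_eq subr0.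
  exact: has_length_xx.
have rs j : is_submod (U j : set rL) by exact: (@submod_restrict _ _ phi L _ (U_submod j)).
have mLr : is_submod (mL : set rL) by exact: (@submod_restrict _ _ phi L _ mL_submod).
have mr : is_submod (m : set rB) by exact: (@submod_restrict _ _ phi B^o).
rewrite mulSn addnC; apply: (has_length_add mLr (rs i.+1) (rs i)); first exact: IH (ltnW lt).
set i0 := Ordinal lt.
have Ui := U_submod i.
apply/(@has_length_iso A A rB rL (m : set rB) setT (U i : set rL) (U i.+1 : set rL)
   (fun v : rB => (v : B) *: y i0 : rL)) => //.
- by move=> z [a ha]; apply/(U_step i0); exists 0; rewrite scale0r subr0; exists a.
- move=> v _; apply/(U_step i0); exists v; rewrite subrr; exact: submod0.
- by move=> u v _ _; rewrite scalerDl subrr; apply: submod0.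
- by move=> z /(U_step i0) [v hv]; exists v.
- by move=> v _; apply: U_ker.
- by move=> a v _; exists a; rewrite -[(a *: v) *: _]scalerA subrr; apply: submod0.
- by move=> a v _; exists a; rewrite -[(a *: v) *: _]scalerA subrr; apply: submod0.
Qed.

End FiberLength.

Section FiniteRank.
Variables (V : idomainType) (MV : set V) (x : V) (K : lmodType V).
Hypotheses (noethV : noetherian V) (V_local : local_ring MV).
Hypothesis MVx : forall v, MV v <-> exists w, v = w * x.
Hypothesis V_factor : forall a : V, a <> 0 -> exists n u v, v * u = 1 /\ a = u * x ^+ n.
Hypothesis x_neq0 : x <> 0.
Hypothesis K_tf : torsion_free K.

Lemma smul_uniformizer (k : K) : smul MV setT k <-> exists k', k = x *: k'.
Proof.
split; last first.
  by move=> [k' ->]; apply: smulP => //; apply/MVx; exists 1; rewrite mul1r.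
have sX : is_submod [set k : K | exists k', k = x *: k'].
  split; first by exists 0; rewrite scaler0.
  move=> a _ _ [u ->] [v ->]; exists (a *: u + v).
  by rewrite scalerDr !scalerA mulrC.
move: k; apply: (smul_min sX) => a k /MVx [w ->] _; exists (w *: k).
by rewrite scalerA mulrC.
Qed.

(** By torsion-freeness a linear relation can be divided by [x] indefinitely, whereas a nonzero
    coefficient u x^n is not divisible by x^(n+1). *)
Lemma fiber_free_lin_indep n (y : 'I_n -> K) :
  (forall a : 'I_n -> V, smul MV setT (\sum_(i < n) a i *: y i) -> forall i, MV (a i)) ->
  lin_indep y.
Proof.
move=> hy a ha.
have div l : exists a' : 'I_n -> V, \sum_i a' i *: y i = 0 /\ forall i, a i = x ^+ l * a' i.
  elim: l => [|l [a' [h0 ha']]]; first by exists a; split=> // i; rewrite mul1r.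
  have /choice [b hb] i : exists b, a' i = b * x.
    by apply/MVx; apply: hy; rewrite h0; apply: submod0 (smul_submod _ _).
  exists b; split; last by move=> i; rewrite ha' hb exprSr -mulrA [x * _]mulrC.
  have : x *: \sum_i b i *: y i = 0.
    by rewrite scaler_sumr -[RHS]h0; apply: eq_bigr => i _; rewrite hb scalerA mulrC.
  by case/K_tf.
move=> i; apply: contrapT => /V_factor [n' [u [v [vu e]]]].
have [a' [_ /(_ i)]] := div n'.+1; rewrite e exprSr -mulrA [u * _]mulrC.
have xn : x ^+ n' != 0 by apply: expf_neq0; apply/eqP.
move/(mulfI xn) => eu; apply: (maximal_proper V_local); apply/MVx.
by exists (v * a' i); rewrite -vu eu; ring.
Qed.

(** No finite generating family of [K] is at hand; instead the rank bounds the families that are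
    independent modulo [x], and a longest such family spans K / xK. *)
Lemma fiber_dim_exists : finite_rank K -> exists n, has_fiber_dim K MV n.
Proof.
move=> [r hr].
pose F n := exists y : 'I_n -> K, forall a : 'I_n -> V,
  smul MV setT (\sum_(i < n) a i *: y i) -> forall i, MV (a i).
have ex : exists n, `[< F n >] by exists 0%N; apply/asboolP; exists (fun=> 0) => a _ [].
have ub n : `[< F n >] -> (n <= r)%N.
  by move=> /asboolP [y hy]; apply: hr (fiber_free_lin_indep hy).
case: (ex_maxnP ex ub) => n /asboolP [y hy] maxn; exists n, y; split=> // z.
apply: contrapT => hz; suff: (n.+1 <= n)%N by rewrite ltnn.
have iV := maximal_ideal V_local.
apply: maxn; apply/asboolP.
exists (fun i => if unlift ord_max i is Some j then y j else z) => a.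
rewrite big_ord_recr /= unlift_none.
under eq_bigr => i _.
  have -> : widen_ord (leqnSn n) i = lift ord_max i by apply: ord_inj; rewrite lift_max.
  rewrite liftK; over.
move=> ha.
have Mz : MV (a ord_max).
  apply: contrapT => /(local_unit noethV V_local) [u hu]; apply: hz.
  exists (fun i => - (u * a (lift ord_max i))).
  have -> : z - \sum_i - (u * a (lift ord_max i)) *: y i =
      u *: (\sum_i a (lift ord_max i) *: y i + a ord_max *: z).
    rewrite scalerDr scalerA hu scale1r addrC scaler_sumr -sumrN; congr (_ + _).
    by apply: eq_bigr => i _; rewrite scaleNr opprK scalerA.
  exact: submodZ (smul_submod _ _) ha.
move=> i; case: (unliftP ord_max i) => [j ->|->] //.
apply: (hy (fun j => a (lift ord_max j))).
by apply: submodDr (smul_submod _ _) _ ha; apply: smulP.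
Qed.

End FiniteRank.

Section DVR.
Variables (V : idomainType) (MV : set V).
Hypothesis V_dvr : is_dvr MV.

Lemma dvr_noetherian : noetherian V.
Proof.
move=> I iI; have [_ /(_ I iI) [x ->] _] := V_dvr; exists 1%N, (fun=> x).
have -> : [set a * x | a in setT] = cyc (x : V^o).
  by apply/seteqP; split=> [_ [a _ <-]|_ [a ->]]; exists a.
apply/seteqP; split.
  by apply: (@cyc_min V V^o _ _ (span_submod _)); apply: sub_span; exists ord0.
apply: (@span_min V V^o _ _ (cyc_submod (x : V^o))) => _ [_ _ <-].
exact: cycid.
Qed.

Lemma dvr_local : local_ring MV.
Proof. by case: V_dvr. Qed.

(** For the factorization, a counterexample a with (a) maximal is a nonunit a = b x; then (b) is
    strictly larger, so b factors and with it a. *)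
Lemma dvr_uniformizer : exists x : V,
  [/\ x <> 0, forall v, MV v <-> exists w, v = w * x
   & forall a, a <> 0 -> exists n u v, v * u = 1 /\ a = u * x ^+ n].
Proof.
have [_ hp [z [z0 Mz]]] := V_dvr; have lV := dvr_local.
have [x Mx] := hp MV (maximal_ideal lV).
have MVx v : MV v <-> exists w, v = w * x.
  by rewrite Mx; split=> [[w _ <-]|[w ->]]; exists w.
exists x; split=> //.
  by move=> x0; have /MVx [w] := Mz; rewrite x0 mulr0.
move=> a0 a0_neq0; apply: contrapT => ha0.
pose good a := exists n u v, v * u = 1 /\ a = u * x ^+ n.
have [||_ [a [aN0 na ->]] hmax] := @noeth_max V dvr_noetherian
  (fun I => exists a, [/\ a <> 0, ~ good a & I = cyc (a : V^o)]) (cyc (a0 : V^o)).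
- by move=> _ [a [_ _ ->]]; apply: cyc_submod.
- by exists a0.
have Ma : MV a.
  apply: contrapT => /(local_unit dvr_noetherian lV) [v va]; apply: na.
  by exists 0%N, a, v; rewrite expr0 mulr1.
have /MVx [b eb] := Ma.
have bN0 : b <> 0 by move=> b0; apply: aN0; rewrite eb b0 mul0r.
apply: (hmax (cyc (b : V^o))).
  exists b; split=> // -[n [u [v [vu e]]]]; apply: na.
  by exists n.+1, u, v; split=> //; rewrite eb e exprSr mulrA.
split.
  by apply: (@cyc_min V V^o _ _ (cyc_submod _)); exists x; rewrite eb mulrC.
move=> /(_ b (cycid _)) [t]; rewrite eb => e.
have : b * 1 = b * (t * x) by rewrite mulr1 {1}e; change (t * (b * x) = b * (t * x)); ring.
move/mulfI => /(_ (introN eqP bN0)) e1.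
by apply: (maximal_proper lV); apply/MVx; exists t.
Qed.

End DVR.

(** Restriction along the identity leaves the module unchanged but gives another [lmodType]; this
    makes [has_length_fiber] usable over a single ring. *)
Lemma has_length_restrict_id (A : comNzRingType) (L : lmodType A) (P Q : set L) n :
  is_submod P -> is_submod Q -> P `<=` Q ->
  has_length (Q : set (restrict_scalars idfun L)) (P : set (restrict_scalars idfun L)) n <-> has_length Q P n.
Proof.
move=> sP sQ PQ; have sP' := submod_restrict idfun sP; have sQ' := submod_restrict idfun sQ.
apply: (@has_length_iso A A (restrict_scalars idfun L) L P Q P Q id) => //.
- by move=> u v _ _; apply: eqm_refl.
- by move=> u Qu; exists u => //; apply: eqm_refl.
- by move=> a u _; exists a; apply: eqm_refl.
- by move=> a u _; exists a; apply: eqm_refl.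
Qed.

Section ValuationFiltration.
Variables (S : comNzRingType) (V : idomainType) (jS : {rmorphism S -> V}) (x : V) (K : lmodType V).
Hypothesis x_neq0 : x <> 0.
Hypothesis K_tf : torsion_free K.
Local Notation rK := (restrict_scalars jS K).

Definition xmul l : set K := [set k | exists k', k = x ^+ l *: k'].

Lemma xmul_submod l : is_submod (xmul l).
Proof.
split; first by exists 0; rewrite scaler0.
move=> a _ _ [u ->] [v ->]; exists (a *: u + v).
by rewrite scalerDr !scalerA mulrC.
Qed.

Lemma xmul_rsubmod l : is_submod (xmul l : set rK).
Proof. exact: (submod_restrict jS (xmul_submod l)). Qed.

Lemma xmul_le i j : (i <= j)%N -> xmul j `<=` xmul i.
Proof.
by move=> ij _ [k ->]; exists (x ^+ (j - i) *: k); rewrite scalerA -exprD subnKC.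
Qed.

Lemma xmul0 : xmul 0 = setT.
Proof. by apply/seteqP; split=> // k _; exists k; rewrite expr0 scale1r. Qed.

Lemma sadd_xmul i j : sadd (xmul i) (xmul j) = xmul (minn i j).
Proof.
apply/seteqP; split.
  by apply: (sadd_min (xmul_submod _)); apply: xmul_le; rewrite ?geq_minl ?geq_minr.
have [ij|/ltnW ji] := leqP i j.
  by apply: saddSl; apply: xmul_submod.
by apply: saddSr; apply: xmul_submod.
Qed.

(** Since [K] is torsion-free, multiplication by x^l carries K / xK isomorphically onto x^l K /
    x^(l+1) K. *)
Lemma has_length_xmul q : has_length ([set: rK]) (xmul 1 : set rK) q ->
  forall a b, has_length (xmul a : set rK) (xmul (a + b) : set rK) (b * q).
Proof.
move=> hq a; elim=> [|b IH]; first by rewrite addn0; apply: has_length_xx.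
rewrite mulSn addnS.
apply: (has_length_add (xmul_rsubmod _) (xmul_rsubmod a) (xmul_rsubmod (a + b))) IH.
set l := (a + b)%N.
have xl : x ^+ l <> 0 by apply/eqP/expf_neq0/eqP.
apply/(@has_length_iso S S rK rK (xmul 1 : set rK) setT (xmul l.+1 : set rK) (xmul l : set rK)
   (fun k : rK => x ^+ l *: (k : K) : rK)) => //.
- exact: xmul_rsubmod.
- exact: xmul_rsubmod.
- exact: xmul_rsubmod.
- exact: xmul_le.
- by move=> k _; exists k.
- by move=> u v _ _; rewrite scalerDr subrr; apply: submod0 (xmul_submod _).
- by move=> _ [k ->]; exists k => //; rewrite subrr; apply: submod0 (xmul_submod _).
- move=> k _; split=> [[k']|[k' ->]].
    rewrite exprSr -scalerA => /eqP; rewrite -subr_eq0 -scalerBr => /eqP /K_tf [//|/eqP].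
    by rewrite subr_eq0 => /eqP ->; exists k'; rewrite expr1.
  by exists k'; rewrite scalerA -exprD addn1.
- move=> a' k _; exists a'; have -> : a' *: k = jS a' *: (k : K) by [].
  have -> : a' *: (x ^+ l *: (k : K) : rK) = jS a' *: (x ^+ l *: (k : K)) by [].
  by rewrite !scalerA mulrC subrr; apply: submod0 (xmul_submod _).
- move=> a' k _; exists a'; have -> : a' *: k = jS a' *: (k : K) by [].
  have -> : a' *: (x ^+ l *: (k : K) : rK) = jS a' *: (x ^+ l *: (k : K)) by [].
  by rewrite !scalerA mulrC subrr; apply: submod0 (xmul_submod _).
Qed.

(* a V = x^t V *)
Definition has_val (a : set S) t :=
  (forall s, a s -> exists v, jS s = v * x ^+ t) /\
  (exists s v, a s /\ v * jS s = x ^+ t).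

Lemma smul_has_val a t l : has_val a t ->
  smul a (xmul l : set rK) = (xmul (t + l) : set rK).
Proof.
move=> [h1 [s [v [As e]]]]; apply/seteqP; split.
  apply: (smul_min (xmul_rsubmod _)) => b _ /h1 [w ew] [k ->].
  have E : jS b *: (x ^+ l *: k) = x ^+ (t + l) *: (w *: k).
    by rewrite ew !scalerA exprD; congr (_ *: _); ring.
  by exists (w *: k).
move=> _ [k ->]; have E : x ^+ (t + l) *: k = jS s *: (x ^+ l *: (v *: k)).
  by rewrite !scalerA; congr (_ *: _); rewrite exprD -e; ring.
rewrite E; apply: (@smulP S rK a (xmul l : set rK) s) => //.
by exists (v *: k).
Qed.

End ValuationFiltration.

Section Valuation.
Variables (S : comNzRingType) (V : idomainType) (jS : {rmorphism S -> V}) (x : V).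
Hypothesis V_factor : forall a : V, a <> 0 -> exists n u v, v * u = 1 /\ a = u * x ^+ n.
Hypothesis jS_inj : injective jS.
Local Notation has_val := (has_val jS x).

Lemma has_val_exists (a : set S) s : a s -> s <> 0 -> exists t, has_val a t.
Proof.
move=> As s0; have nz s' : s' <> 0 -> jS s' <> 0 by move=> h e; apply: h; apply: jS_inj; rewrite e rmorph0.
pose F n := exists s v, a s /\ v * jS s = x ^+ n.
have F0 s' n u v : a s' -> v * u = 1 -> jS s' = u * x ^+ n -> F n.
  by move=> As' vu e; exists s', v; rewrite e mulrA vu mul1r.
have ex : exists n, `[< F n >].
  have [n [u [v [vu e]]]] := V_factor (nz _ s0).
  by exists n; apply/asboolP; apply: F0 As vu e.
case: (ex_minnP ex) => n /asboolP Fn minn; exists n; split=> // s' As'.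
have [->|s'0] := pselect (s' = 0); first by exists 0; rewrite rmorph0 mul0r.
have [k [u [v [vu e]]]] := V_factor (nz _ s'0).
have nk : (n <= k)%N by apply/minn/asboolP; apply: F0 As' vu e.
by exists (u * x ^+ (k - n)); rewrite e -mulrA -exprD subnK.
Qed.

Lemma has_val_smul (a b : set S) s t : has_val a s -> has_val b t ->
  has_val (smul a (b : set S^o)) (s + t).
Proof.
move=> [a1 [r [u [Ar eu]]]] [b1 [r' [u' [Br eu']]]]; split; last first.
  exists (r * r'), (u * u'); split; first exact: (@smulP S S^o).
  by rewrite rmorphM exprD -eu -eu'; ring.
have sX : is_submod [set r : S^o | exists v, jS r = v * x ^+ (s + t)].
  split; first by exists 0; rewrite rmorph0 mul0r.
  move=> c y z [v ev] [w ew]; exists (jS c * v + w).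
  by rewrite rmorphD rmorphM ev ew; ring.
move=> z; move: z; apply: (smul_min sX) => y z /a1 [v ev] /b1 [w ew].
by exists (v * w); rewrite /= rmorphM ev ew exprD; ring.
Qed.

Lemma has_val_pow (a b : set S) s t n : has_val a s -> has_val b t ->
  has_val (pow_smul a n (b : set S^o)) (s * n + t).
Proof.
move=> ha hb; elim: n => [|n IH]; first by rewrite muln0.
by rewrite mulnS -addnA; apply: has_val_smul.
Qed.

End Valuation.

(** * Twisted subrings *)

Section TwistedSubring.
Variables (S R : comNzRingType) (jR : {rmorphism R -> S}) (K : lmodType S).
Variables (C : set S) (dR : R -> K).

(** What is used of the derivation, stated without localizations. [tw_dense] is the splitting S =
    ker D + cS, [tw_onto] is what remains of the generation of K_C by D(S_C), and [tw_div] and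
    [tw_unit] hold because [R] consists of all s in [S] whose derivative lies in [K]. *)
Record twisting : Prop := Twisting {
  tw_mul : forall c d, C c -> C d -> C (c * d);
  tw_inj : injective jR;
  tw_D : forall r r', dR (r + r') = dR r + dR r';
  tw_M : forall r r', dR (r * r') = jR r *: dR r' + jR r' *: dR r;
  tw_C : forall c, C c -> exists2 r, jR r = c & dR r = 0;
  tw_dense : forall c s, C c -> exists r t, dR r = 0 /\ s = jR r + c * t;
  tw_onto : forall c k, C c -> exists r s k', jR r = c * s /\ dR r = k + c *: k';
  tw_div : forall c r s k, C c -> jR r = c * s -> dR r = c *: k -> exists r', jR r' = s;
  tw_unit : forall r s, jR r * s = 1 -> exists r', jR r' = s
}.

Hypothesis tw : twisting.

Lemma tw_0 : dR 0 = 0.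
Proof. by apply: (@addrI _ (dR 0)); rewrite addr0 -(tw_D tw) addr0. Qed.

Lemma tw_N r : dR (- r) = - dR r.
Proof. by apply: (@addrI _ (dR r)); rewrite -(tw_D tw) !subrr tw_0. Qed.

Lemma tw_Ml r r' : dR r = 0 -> dR (r * r') = jR r *: dR r'.
Proof. by move=> h; rewrite (tw_M tw) h scaler0 addr0. Qed.

Implicit Types (a b : set S) (L : set K).

(* contains the contracted ideal IS ∩ R as IS ⋆ K *)
Definition star a L : set R := [set r | a (jR r) /\ L (dR r)].

(** The closure condition for [star a L]: in the derivative of t r, the Leibniz rule produces the
    extra term [jR r *: dR t], which has to lie in [L]. *)
Definition absorbs a L := forall s k, a s -> L (s *: k).

Lemma star_ideal a L : is_ideal a -> is_submod L -> absorbs a L -> is_ideal (star a L).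
Proof.
move=> ia sL aL; split.
  by rewrite /star /= rmorph0 tw_0; split; [exact: ideal0|exact: submod0].
move=> t r r' [ar Lr] [ar' Lr']; split.
  by rewrite rmorphD rmorphM; apply: (idealD ia) => //; apply: (idealMl _ ia).
rewrite (tw_D tw) (tw_M tw); apply: submodD => //; apply: submodD => //.
  exact: submodZ.
exact: aL.
Qed.

(** Insert [star b L]: its quotient by [star b L'] is L / L' through [dR], and the quotient of
    [star a L] by it is a / b through [jR]. Scalars of [S] are matched by [tw_dense] up to multiples
    of [c], which are negligible as [c] lies in [b] and c K in [L']. *)
Lemma has_length_star a b L L' c l1 l2 : is_ideal a -> is_ideal b -> is_submod L -> is_submod L' ->
  C c -> b c -> (forall k, L' (c *: k)) -> absorbs a L -> absorbs b L' ->
  has_length (a : set S^o) (b : set S^o) l1 -> has_length L L' l2 ->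
  has_length (star a L : set R^o) (star b L' : set R^o) (l2 + l1).
Proof.
move=> ia ib sL sL' Cc bc cL' aL bL' hab hLL'.
have ba := has_length_sub hab; have LL := has_length_sub hLL'.
have bL : absorbs b L by move=> s k bs; apply/LL/bL'.
have iaL := star_ideal ia sL aL; have ibL := star_ideal ib sL bL.
have ibL' := star_ideal ib sL' bL'.
apply: (@has_length_add R R^o _ (star b L) _ _ _ ibL' iaL ibL).
  apply/(@has_length_iso R S R^o K (star b L') (star b L) L' L dR) => //.
  - by move=> r [br Lr]; split=> //; apply: LL.
  - by move=> r [].
  - by move=> r r' _ _; rewrite (tw_D tw) subrr; apply: submod0.
  - move=> k Lk; have [r [s [k' [er ek]]]] := tw_onto tw k Cc.
    exists r; last by rewrite ek opprD addNKr; apply: submodN.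
    split; first by rewrite er; apply: idealMr.
    by rewrite ek; apply: submodD => //; apply/LL/cL'.
  - by move=> r [br Lr]; split=> [?|[]].
  - move=> t r [br Lr]; exists (jR t); rewrite (tw_M tw) addrAC subrr add0r.
    exact: bL'.
  - move=> s r [br Lr]; have [t [w [dt ->]]] := tw_dense tw s Cc.
    exists t; rewrite (tw_Ml _ dt) scalerDl opprD addNKr -scalerA.
    exact: submodN.
apply/(@has_length_iso R S R^o S^o (star b L) (star a L) b a jR) => //.
- by move=> r [br Lr]; split=> //; apply: ba.
- by move=> r [].
- by move=> r r' _ _; rewrite rmorphD subrr; apply: ideal0.
- move=> s hs; have [r [t [dr e]]] := tw_dense tw s Cc.
  have e' : s - jR r = c * t by rewrite e addrAC subrr add0r.
  have bct : b (c * t) by apply: idealMr.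
  exists r; last by rewrite e'.
  split; last by rewrite dr; apply: submod0.
  by rewrite -(subKr s (jR r)) e'; apply: idealB => //; apply: ba.
- by move=> r [ar Lr]; split=> [?|[]].
- by move=> t r _; exists (jR t); rewrite rmorphM subrr; apply: ideal0.
- move=> s r [ar Lr]; have [t [w [dt ->]]] := tw_dense tw s Cc.
  exists t; rewrite rmorphM.
  have -> : jR t * jR r - (jR t + c * w) *: (jR r : S^o) = - (c * (w * jR r)).
    by change (jR t * jR r - (jR t + c * w) * jR r = - (c * (w * jR r))); ring.
  by apply: idealN => //; apply: idealMr.
Qed.

(** One inclusion is the Leibniz rule, which puts the derivative of a product in a L + b K. The
    other has to produce elements of [R], so the two components are approximated separately. *)
Lemma smul_star a b L c : is_ideal a -> is_ideal b -> is_submod L ->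
  C c -> a c -> b c -> (forall k, L (c *: k)) -> absorbs b L ->
  smul (star a setT) (star b L : set R^o) =
  star (smul a (b : set S^o)) (sadd (smul a L) (smul b setT)).
Proof.
move=> ia ib sL Cc ac bc cL bL.
have iab : is_ideal (smul a (b : set S^o)) by apply: smul_submod.
have ab_b : smul a (b : set S^o) `<=` b by apply: (@smul_subr S S^o).
have sT : is_submod (sadd (smul a L) (smul b setT)).
  by apply: sadd_submod; apply: smul_submod.
apply/seteqP; split.
  have iT : is_submod (star (smul a (b : set S^o)) (sadd (smul a L) (smul b setT)) : set R^o).
    apply: star_ideal => // s k /ab_b bs; apply: saddSr; first exact: smul_submod.
    exact: smulP.
  apply: (smul_min iT) => r q [ar _] [bq Lq]; split.
    by rewrite rmorphM; apply: (@smulP S S^o).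
  rewrite (tw_M tw); exists (jR r *: dR q), (jR q *: dR r).
  by split=> //; apply: smulP.
pose X : set R := smul (star a setT) (star b L : set R^o); rewrite -/X.
have iX : is_ideal X by apply: smul_submod.
(* With e = c^2, an r in R with jR r in eS and dR r in eK lies in c (cR),
   hence in X; so it suffices to approximate z modulo such elements. *)
pose e := c * c; have Ce : C e by apply: (tw_mul tw).
have ae t : a (e * t) by rewrite /e -mulrA; apply: idealMr.
have be t : b (e * t) by rewrite /e -mulrA; apply: idealMr.
have eL k : L (e *: k) by rewrite /e -scalerA; apply: cL.
have inX x y : a (jR x) -> b (jR y) -> L (dR y) -> X (x * y).
  by move=> ax by_ Ly; apply: (@smulP R R^o); split.
(* Both factors are replaced by elements of the kernel of [dR] modulo e S, so the derivative of the
   product stays 0. *)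
have approx_ring w : smul a (b : set S^o) w ->
    exists q t, [/\ X q, dR q = 0 & w = jR q + e * t].
  have sU : is_submod [set w : S^o | exists q t, [/\ X q, dR q = 0 & w = jR q + e * t]].
    split.
      by exists 0, 0; rewrite tw_0 rmorph0 mulr0 addr0; split=> //; apply: ideal0.
    move=> s w1 w2 [q [t [Xq dq ->]]] [q' [t' [Xq' dq' ->]]].
    have [r [u [dr ->]]] := tw_dense tw s Ce.
    exists (r * q + q'), (jR r * t + u * jR q + u * e * t + t').
    split; first by apply: (idealD iX) => //; apply: (idealMl _ iX).
      by rewrite (tw_D tw) (tw_Ml _ dr) dq dq' scaler0 addr0.
    rewrite rmorphD rmorphM.
    by change ((jR r + e * u) * (jR q + e * t) + (jR q' + e * t') =
      jR r * jR q + jR q' + e * (jR r * t + u * jR q + u * e * t + t')); ring.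
  move: w; apply: (smul_min sU) => u v au bv.
  have [x [t [dx eu]]] := tw_dense tw u Ce; have [y [t' [dy ev]]] := tw_dense tw v Ce.
  have ax : a (jR x) by rewrite -(addrK (e * t) (jR x)) -eu; apply: idealB.
  have by_ : b (jR y) by rewrite -(addrK (e * t') (jR y)) -ev; apply: idealB.
  exists (x * y), (jR x * t' + t * jR y + e * t * t'); split.
  - by apply: inX => //; rewrite dy; apply: submod0.
  - by rewrite (tw_Ml _ dx) dy scaler0.
  rewrite rmorphM eu ev.
  by change ((jR x + e * t) * (jR y + e * t') =
    jR x * jR y + e * (jR x * t' + t * jR y + e * t * t')); ring.
(* A kernel approximation of s is multiplied by some q with jR q in e S and dR q close to k; the
   ring component stays in e S and does not disturb the other approximation. *)
have approx_mod k : sadd (smul a L) (smul b setT) k ->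
    exists q t k', [/\ X q, jR q = e * t & dR q = k + e *: k'].
  have sU : is_submod [set k : K | exists q t k', [/\ X q, jR q = e * t & dR q = k + e *: k']].
    split.
      exists 0, 0, 0; rewrite tw_0 rmorph0 mulr0 scaler0 addr0; split=> //; exact: ideal0.
    move=> s k1 k2 [q [t [k' [Xq eq1 eq2]]]] [p [u [k'' [Xp ep1 ep2]]]].
    have [r [v [dr ->]]] := tw_dense tw s Ce.
    exists (r * q + p), (jR r * t + u), (jR r *: k' - v *: k1 + k''); split.
    - by apply: (idealD iX) => //; apply: (idealMl _ iX).
    - by rewrite rmorphD rmorphM eq1 ep1; ring.
    rewrite (tw_D tw) (tw_Ml _ dr) eq2 ep2 !scalerDr scalerN scalerDl !scalerA [jR r * e]mulrC.
    set x1 := jR r *: k1; set x2 := (e * jR r) *: k'; set x3 := (e * v) *: k1.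
    rewrite (addrAC x1 x3) -(addrA (x1 + k2)) [x3 + _]addrA [x3 + _]addrC subrK.
    exact: addrACA.
  have approx s : exists r u, [/\ dR r = 0, jR r = s - e * u, a s -> a (jR r) & b s -> b (jR r)].
    have [r [u [dr es]]] := tw_dense tw s Ce; exists r, u.
    have er : jR r = s - e * u by rewrite es addrK.
    by split=> // h; rewrite er; apply: idealB.
  have expand s u k1 k2 : (s - e * u) *: (k1 + e *: k2) =
      s *: k1 + e *: (s *: k2 - u *: k1 - (u * e) *: k2).
    rewrite scalerBl !scalerDr !scalerN !scalerA [s * e]mulrC opprD !addrA.
    by congr (_ - _); congr (_ *: _); ring.
  move: k; apply: (sadd_min sU); apply: (smul_min sU) => s k hs hk.
    have [x [u [dx ex ax _]]] := approx s.
    have [q [t [k' [eq1 eq2]]]] := tw_onto tw k Ce.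
    exists (x * q), (jR x * t), (s *: k' - u *: k - (u * e) *: k'); split.
    - apply: inX; [exact: ax|by rewrite eq1|by rewrite eq2; apply: submodD].
    - by rewrite rmorphM eq1; ring.
    by rewrite (tw_Ml _ dx) eq2 ex expand.
  have [y [u [dy ey _ by_]]] := approx s.
  have [q [t [k' [eq1 eq2]]]] := tw_onto tw k Ce.
  exists (q * y), (jR y * t), (s *: k' - u *: k - (u * e) *: k'); split.
  - apply: inX; [by rewrite eq1|exact: by_|by rewrite dy; apply: submod0].
  - by rewrite rmorphM eq1; ring.
  by rewrite mulrC (tw_Ml _ dy) eq2 ey expand.
(* What remains of z has both components divisible by e = c^2, so by [tw_div] it is c (c r) with r
   in [R]: the first c lies in [a], and c r belongs to [star b L]. *)
move=> z [/approx_ring [q1 [t1 [Xq1 dq1 e1]]] /approx_mod [q2 [t2 [k2 [Xq2 e2 d2]]]]].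
have j0 : jR (z - q1 - q2) = e * (t1 - t2) by rewrite !rmorphB e1 e2; ring.
have d0 : dR (z - q1 - q2) = e *: (- k2).
  by rewrite !(tw_D tw) !tw_N dq1 d2 subr0 opprD addNKr scalerN.
have [r hr] := tw_div tw Ce j0 d0.
have [rc erc drc] := tw_C tw Cc.
have ez : z - q1 - q2 = rc * (rc * r).
  by apply: (tw_inj tw); rewrite j0 !rmorphM erc hr mulrA.
rewrite -(subrK q1 z) -(subrK q2 (z - q1)) ez; apply: (idealD iX) => //; apply: (idealD iX) => //.
apply: inX; rewrite ?rmorphM ?erc //; first by apply: idealMr.
by rewrite (tw_Ml _ drc) erc; apply: cL.
Qed.

End TwistedSubring.

Lemma twisted_twisting (S R : comNzRingType) (jR : {rmorphism R -> S}) (K : lmodType S) (C : set S) :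
  injective jR -> twisted K C (range jR) -> exists dR : R -> K, twisting jR C dR.
Proof.
move=> jR_inj [C_mul _ C_regK [SC [j [KC [jK [D [[[j_inv j_frac _] [jK_lin jK_frac jK_ker] D_M] [D_C R_E D_span D_dense]]]]]]]].
have inv c : C c -> exists u, j c * u = 1 by apply: j_inv.
have D_D s t : D (s + t) = D s + D t by apply: raddfD.
have cancel c (k k' : KC) : C c -> j c *: k = j c *: k' -> k = k'.
  move=> /inv [u hu] e; have := congr1 (fun k => u *: k) e.
  by rewrite /= !scalerA mulrC hu !scale1r.
have jK_inj : injective jK.
  move=> k k' e; have [c Cc] : exists2 c, C c & c *: (k - k') = 0.
    by apply: jK_ker; rewrite raddfB e subrr.
  by rewrite scalerBr => /eqP; rewrite subr_eq0 => /eqP /(C_regK c Cc).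
have inR s k : D (j s) = jK k -> exists r, jR r = s.
  move=> h; have : range jR s by rewrite R_E; exists k.
  by case=> r _ <-; exists r.
have /choice [dR hd] r : exists k, D (j (jR r)) = jK k.
  have : range jR (jR r) by exists r.
  by rewrite R_E => -[k]; exists k.
have dR_eq r k : D (j (jR r)) = jK k -> dR r = k by rewrite hd => /jK_inj.
have D1 : D 1 = 0.
  by have := D_M 1 1; rewrite mulr1 scale1r => /esym/eqP; rewrite -subr_eq0 addrK => /eqP.
have D_Cl c s : C c -> D (j (c * s)) = j c *: D (j s).
  by move=> Cc; rewrite rmorphM D_M (D_C _ Cc) scaler0 addr0.
have dense c s : C c -> exists r t, dR r = 0 /\ s = jR r + c * t.
  move=> Cc; have [x [t [Dx e]]] := D_dense c s Cc.
  have ex : x = j (s - c * t) by rewrite rmorphB e addrK.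
  have [r hr] : exists r, jR r = s - c * t by apply: (inR _ 0); rewrite -ex Dx raddf0.
  exists r, t; split; last by rewrite hr subrK.
  by apply: dR_eq; rewrite hr -ex Dx raddf0.
(* The aim is K_C = D(S) + K; [tw_onto] for k follows by decomposing k / c in this way. *)
pose Z : set KC := [set k | exists s k', k = D (j s) + jK k'].
have ZD k k' : Z k -> Z k' -> Z (k + k').
  move=> [s [u ->]] [s' [u' ->]]; exists (s + s'), (u + u').
  by rewrite !raddfD addrACA.
(* If x = s / c and s = r + c t with D(r) = 0, then D(x) = D(t). *)
have D_S x : exists s, D x = D (j s).
  have [c [s [Cc e]]] := j_frac x; have [r [t [dr es]]] := dense c s Cc.
  exists t; apply: (cancel c) => //.
  have : D (j c * x) = j c *: D x by rewrite D_M (D_C _ Cc) scaler0 addr0.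
  move=> <-; rewrite e es rmorphD raddfD hd dr raddf0 add0r; exact: D_Cl.
have Z_all k : Z k.
  (* Requiring [Z] for all multiples makes the set a submodule, so it can be tested on the range of
     [D]. *)
  suff : [set k | forall x : SC, Z (x *: k)] k by move=> /(_ 1); rewrite scale1r.
  have : span (range D) k by rewrite D_span.
  move: k; apply: span_min.
    split; first by move=> x; rewrite scaler0; exists 0, 0; rewrite !raddf0 addr0.
    by move=> a k k' hk hk' x; rewrite scalerDr scalerA; apply: ZD.
  move=> _ [x0 _ <-] x; have [t0 ->] := D_S x0.
  have [c [s [Cc e]]] := j_frac x; have [r0 [t [d0 et]]] := dense c t0 Cc.
  have -> : x *: D (j t0) = j s *: D (j t).
    rewrite et rmorphD raddfD hd d0 raddf0 add0r D_Cl // scalerA mulrC; by rewrite e.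
  (* With c' D(t) = k in [K], s = r + c' w and D(r) = 0, the element s D(t) becomes D(r t) + w k. *)
  have [c' [k [Cc' ek]]] := jK_frac (D (j t)).
  have [r [w [dr ->]]] := dense c' s Cc'.
  exists (jR r * t), (w *: k).
  rewrite [in RHS]rmorphM D_M hd dr raddf0 scaler0 addr0 jK_lin -ek rmorphD rmorphM.
  by rewrite scalerDl scalerA [j c' * _]mulrC.
exists dR; split=> //.
- by move=> r r'; apply: dR_eq; rewrite rmorphD !raddfD !hd.
- by move=> r r'; apply: dR_eq; rewrite !rmorphM D_M raddfD !jK_lin !hd.
- move=> c Cc; have [r hr] : exists r, jR r = c by apply: (inR _ 0); rewrite D_C // raddf0.
  by exists r => //; apply: dR_eq; rewrite hr D_C // raddf0.
- move=> c k Cc; have [u hu] := inv c Cc.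
  have [s [k' e]] := Z_all (u *: jK k).
  have e' : jK k = D (j (c * s)) + jK (c *: k').
    by rewrite D_Cl // jK_lin -scalerDr -e scalerA hu scale1r.
  have e'' : D (j (c * s)) = jK (k + c *: - k').
    by rewrite raddfD e' scalerN raddfN addrK.
  have [r hr] := inR _ _ e''.
  by exists r, s, (- k'); split=> //; apply: dR_eq; rewrite hr.
- move=> c r s k Cc er ek; apply: (inR s k); apply: (cancel c) => //.
  by rewrite -D_Cl // -er hd ek jK_lin.
(* Differentiating r s = 1 gives D(s) = - s^2 D(r), which is again in [K]. *)
- move=> r s e; apply: (inR s (- (s * s) *: dR r)).
  have ej : j (jR r) * j s = 1 by rewrite -rmorphM e rmorph1.
  have := D_M (j (jR r)) (j s); rewrite ej D1 => /esym h.
  have := congr1 (fun k => j s *: k) h.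
  rewrite /= scaler0 scalerDr !scalerA mulrC ej scale1r => /eqP.
  by rewrite addr_eq0 hd => /eqP ->; rewrite jK_lin rmorphN rmorphM scaleNr.
Qed.

(** * Generators, dimension and multiplicity over a twisted subring *)

Section TwistedInvariants.
Variables (S V : idomainType) (R : comNzRingType).
Variables (jS : {rmorphism S -> V}) (jR : {rmorphism R -> S}).
Variables (N : set S) (K : lmodType V) (C : set S) (x : V) (q : nat).
Local Notation KS := (restrict_scalars jS K).
Variable dR : R -> KS.
Hypotheses (S_local : local_ring N) (S_noeth : noetherian S) (R_noeth : noetherian R).
Hypothesis V_factor : forall a : V, a <> 0 -> exists n u v, v * u = 1 /\ a = u * x ^+ n.
Hypotheses (x_neq0 : x <> 0) (jS_inj : injective jS) (K_tf : torsion_free K).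
Hypothesis len_K : has_length ([set: KS]) (@xmul V x K 1 : set KS) q.
Hypothesis tw : twisting jR C dR.
Hypothesis C_neq0 : forall c, C c -> c <> 0.
Variable c0 : S.
Hypotheses (C_c0 : C c0) (N_c0 : N c0).
Implicit Types (a b : set S).

Local Notation xK := (@xmul V x K).
Local Notation star a L := (star jR dR a L).
Let M : set R := star N setT.

Let N_ideal : is_ideal N. Proof. exact: maximal_ideal S_local. Qed.

Let xK_submod l : is_submod (xK l : set KS).
Proof. exact: (@xmul_rsubmod S V jS x K). Qed.

Let xKT : (xK 0 : set KS) = setT.
Proof. exact: (@xmul0 V x K). Qed.

(** By [tw_unit] an element of [R] that is a unit in [S] is a unit in [R]. *)
Lemma proper_sub_star (I : set R) : is_ideal I -> ~ I 1 -> I `<=` M.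
Proof.
move=> iI I1 r Ir; split=> //; apply: contrapT => /(local_unit S_noeth S_local) [s hs].
rewrite mulrC in hs; have [r' hr'] := tw_unit tw hs.
apply: I1; suff <- : r * r' = 1 by apply: idealMr.
by apply: (tw_inj tw); rewrite rmorphM hr' hs rmorph1.
Qed.

Let M_ideal : is_ideal M.
Proof. exact: (star_ideal tw N_ideal (@submodT _ _)). Qed.

Let M_proper : ~ M 1.
Proof. by rewrite /M => -[]; rewrite rmorph1 => /(maximal_proper S_local). Qed.

Lemma maximal_eq_star (M' : set R) : is_maximal M' -> M' = M.
Proof.
move=> [iM' M'1 maxM']; have [//|e] := maxM' M M_ideal (proper_sub_star iM' M'1).
by case: M_proper; rewrite e.
Qed.

Lemma star_local : local_ring M.
Proof.
split; last exact: maximal_eq_star.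
split=> // I iI MI; have [/(ideal1 iI)|I1] := pselect (I 1); [by right|left].
by apply/seteqP; split=> //; apply: proper_sub_star.
Qed.

(** The product of [M] with [star a setT] has components N a and N K, because a K lies in N K; the
    extra term is the length of K / NK. *)
Lemma mu_star a c t : is_ideal a -> a `<=` N -> C c -> a c -> has_val jS x N t ->
  mu (star a setT : set R^o) = (mu (a : set S^o) + t * q)%N.
Proof.
move=> ia aN Cc ac hN.
have iS : is_ideal (star a setT) by apply: (star_ideal tw ia (@submodT _ _)).
apply: (@has_length_uniq R R^o _ _ _ _ (has_length_mu R_noeth star_local iS)).
have iNa : is_ideal (smul N (a : set S^o)) by apply: smul_submod.
have sNK : is_submod (smul N (setT : set KS)) by apply: smul_submod.
have Nc := aN c ac.
rewrite /M (smul_star tw N_ideal ia (@submodT _ _) Cc Nc ac) //.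
rewrite saddC sadd_idl //; [|exact: smul_submod|exact: smulS].
have NaN : smul N (a : set S^o) `<=` N.
  by apply: (@smul_min S S^o _ _ _ N_ideal) => u v Nu _; apply: (@idealMr S N v u).
(* The smaller ideal N a has to contain an element of [C]: c need not lie in it, but c^2 does. *)
have cc : smul N (a : set S^o) (c * c) by apply: (@smulP S S^o).
rewrite addnC; apply: (has_length_star tw (c := c * c)) => //.
- exact: (tw_mul tw).
- by move=> k; apply: smulP => //; apply: NaN.
- by move=> s k /NaN Ns; apply: smulP.
- exact: (has_length_mu S_noeth S_local ia).
rewrite -xKT (smul_has_val K 0 hN) addn0.
by have := has_length_xmul x_neq0 K_tf len_K 0 t.
Qed.

Section Powers.
Variables (a b : set S) (c : S) (va vb : nat).
Hypotheses (ia : is_ideal a) (ib : is_ideal b) (Cc : C c) (ac : a c) (bc : b c).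
Hypotheses (hva : has_val jS x a va) (hvb : has_val jS x b vb).

Let J : set R := star a setT.
Let I : set R := star b setT.
Let bn n : set S := pow_smul a n (b : set S^o).
(** Solves l_0 = 0 and l_(n+1) = min(va + l_n, va n + vb), the recursion that a L + b K in
    [smul_star] imposes; for n > 0 the first argument is the smaller one. *)
Let lv n := (if n is k.+1 then va * k + minn va vb else 0)%N.

Let bn_ideal n : is_ideal (bn n).
Proof. exact: (@pow_smul_submod S S^o). Qed.

Let bn_val n : has_val jS x (bn n) (va * n + vb).
Proof. exact: has_val_pow. Qed.

Let bn_K n : smul (bn n) (setT : set KS) = xK (va * n + vb).
Proof. by rewrite -xKT (smul_has_val K 0 (bn_val n)) addn0. Qed.

Let lv_le n : (lv n <= va * n + vb)%N.
Proof. by case: n => [//|n]; rewrite /lv mulnS; have := geq_minr va vb; lia. Qed.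

Let lv_mono n : (lv n <= lv n.+1)%N.
Proof. by case: n => [//|n]; rewrite /lv mulnS; lia. Qed.

Let bn_absorbs n : absorbs (bn n) (xK (lv n) : set KS).
Proof.
move=> s k hs; apply: (xmul_le (lv_le n)).
by rewrite -[@xmul _ _ _ _]bn_K; apply: smulP.
Qed.

Let cn n : exists d, [/\ C d, a d & bn n d].
Proof.
elim: n => [|n [d [Cd ad bd]]]; first by exists c.
exists (c * d); split; [exact: (tw_mul tw)|exact: idealMr|exact: (@smulP S S^o)].
Qed.

Lemma pow_smul_star n :
  pow_smul J n (I : set R^o) = star (bn n) (xK (lv n) : set KS).
Proof.
elim: n => [|n IH]; first by rewrite /= xKT.
have [d [Cd ad bd]] := cn n.
rewrite [LHS]/= IH (smul_star tw ia (bn_ideal n) (xK_submod _) Cd ad bd) //; last by move=> k; apply: bn_absorbs.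
rewrite (smul_has_val K _ hva) bn_K; congr (star _ _).
have -> : lv n.+1 = minn (va + lv n) (va * n + vb).
  by case: (n) => [|k]; rewrite /lv ?mulnS; lia.
exact: (@sadd_xmul V x K).
Qed.

Lemma has_length_pow_star n l : has_length (bn n : set S^o) (bn n.+1 : set S^o) l ->
  has_length (pow_smul J n (I : set R^o)) (pow_smul J n.+1 (I : set R^o)) ((lv n.+1 - lv n) * q + l).
Proof.
move=> hl; have [d [Cd ad bd]] := cn n.+1; rewrite !pow_smul_star.
apply: (has_length_star tw (bn_ideal n) (bn_ideal n.+1) (xK_submod _) (xK_submod _) Cd bd) => //.
  by move=> k; apply: bn_absorbs.
by have := has_length_xmul x_neq0 K_tf len_K (lv n) (lv n.+1 - lv n); rewrite subnKC.
Qed.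

End Powers.

Let star_T : star setT setT = [set: R].
Proof. by apply/seteqP; split. Qed.

Lemma krull_dim_pos : (0 < krull_dim S)%N.
Proof.
have rN : M_radical N N by move=> s Ns; exists 1%N.
apply: (krull_dimP S_noeth S_local N_ideal (fun s h => h) rN).2.
have zN : [set 0%R] `<` N.
  split; first by move=> _ ->; apply: ideal0.
  by move=> /(_ c0 N_c0); apply: C_neq0.
exists (fun i : 'I_2 => if i == 0%N :> nat then [set 0%R] else N); split.
  move=> i; case: eqP => _; last exact: (maximal_prime S_noeth S_local).
  split; [exact: (@submod_zero S S^o)|by move/eqP; rewrite oner_eq0|].
  by move=> u v /eqP; rewrite mulf_eq0 => /orP[/eqP ->|/eqP ->]; [left|right].
by move=> [[|[|i]] hi] [[|[|j]] hj] //= _.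
Qed.

(** The Hilbert-Samuel functions of the maximal ideals differ by t q (k - 1) for k > 0; being linear
    in k, this does not affect the order of growth, as [krull_dim S] is positive. *)
Lemma krull_dim_star t : has_val jS x N t -> krull_dim R = krull_dim S.
Proof.
move=> hN; have rN : M_radical N N by move=> s Ns; exists 1%N.
have rM : M_radical M M by move=> s Ms; exists 1%N.
have [l el hl] := hilbert_function S_noeth S_local N_ideal rN (@idealT S).
(* For the unit ideal vb = 0, so the minimum in [lv] is 0 and l_(n+1) = t n. *)
have hT : has_val jS x setT 0.
  split; first by move=> s _; exists (jS s); rewrite expr0 mulr1.
  by exists 1, 1; rewrite rmorph1 expr0 mulr1.
have hR n := has_length_pow_star N_ideal (@idealT S) C_c0 N_c0 I hN hT (hl n).
rewrite star_T in hR.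
have HSR k : HS M ([set 0%R] : set R) k = (HS N ([set 0%R] : set S) k + (if k is k'.+1 then t * k' else 0) * q)%N.
  have h1 := HS0_hlen R_noeth star_local rM k.
  have h2 := HS0_hlen S_noeth S_local rN k.
  rewrite (has_length_uniq h1 (has_length_pow_sum (@submodT R R^o) hR k)).
  rewrite (has_length_uniq h2 (has_length_pow_sum (@submodT S S^o) hl k)) big_split /= addnC.
  congr (_ + _)%N; rewrite -big_distrl; congr (_ * q)%N.
  elim: k {h1 h2} => [|k IH]; first by rewrite big_ord0.
  rewrite big_ord_recr /= IH minn0 !addn0; case: k {IH} => [|k]; first by rewrite muln0.
  by rewrite !addn0 mulnS; lia.
apply/eqP; rewrite eqn_leq; apply/andP; split.
  have [B hB] := HS0_growth S_noeth S_local N_ideal (fun s h => h) rN.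
  apply: (@krull_dim_le R M M R_noeth star_local M_ideal (fun s h => h) rM _ (B + t * q)) => k.
  rewrite HSR mulnDl leq_add //.
  have kk : (k <= k.+1 ^ krull_dim S)%N.
    by apply: (@leq_trans (k.+1 ^ 1)); [rewrite expn1|rewrite leq_pexp2l // krull_dim_pos].
  rewrite mulnAC; apply: leq_mul => //; case: k kk => [//|k] kk.
  by rewrite leq_mul2l; apply/orP; right; lia.
have [B hB] := HS0_growth R_noeth star_local M_ideal (fun s h => h) rM.
apply: (@krull_dim_le S N N S_noeth S_local N_ideal (fun s h => h) rN _ B) => k.
by apply: leq_trans (hB k); rewrite HSR leq_addr.
Qed.

Lemma hilbert_poly_eq (A : comNzRingType) (L : lmodType A) (J : set A) (Q : set L) p :
  is_hilbert_poly J Q p -> hilbert_poly J Q = p.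
Proof.
move=> hp; have [n0 h0] : is_hilbert_poly J Q (hilbert_poly J Q).
  by apply: xgetPex; exists p.
have [n1 h1] := hp; apply: (@poly_eq_nat _ _ (n0 + n1)) => n hn.
by rewrite h0 ?h1 //; lia.
Qed.

(** The Hilbert polynomials over [R] and [S] differ by the constant [va * q], which reaches the
    coefficient of X^(d-1) only if d = 1; [hilbert_coef_ideal] then replaces [b] by [S]. *)
Lemma multiplicity_star a b c va t : is_ideal a -> is_ideal b -> a `<=` N ->
  M_radical N a -> C c -> a c -> b c -> has_val jS x a va -> has_val jS x N t ->
  multiplicity (star a setT) (star b setT : set R^o) =
  multiplicity a [set: S^o] + (if krull_dim S == 1%N then (va * q)%:R else 0).
Proof.
move=> ia ib aN ra Cc ac bc hva hN.
have [vb hvb] := has_val_exists V_factor jS_inj bc (C_neq0 Cc).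
have [l el hl] := hilbert_function S_noeth S_local ia ra ib.
have [l' el' hl'] := hilbert_function S_noeth S_local ia ra (@idealT S).
have [p [n1 hp]] := el; have [p' [n2 hp']] := el'.
have iJ : is_ideal (star a setT) by apply: (star_ideal tw ia (@submodT _ _)).
have iI : is_ideal (star b setT) by apply: (star_ideal tw ib (@submodT _ _)).
have coef : p`_(krull_dim S).-1 = p'`_(krull_dim S).-1.
  apply: (hilbert_coef_ideal S_noeth S_local ia aN ra (n0 := (n1 + n2)%N) ib bc _ krull_dim_pos hl hl').
  - by move=> u v; apply: mulIf; apply/eqP/C_neq0.
  - by move=> n hn; apply: hp; lia.
  - by move=> n hn; apply: hp'; lia.
have e1 : hilbert_poly a [set: S^o] = p'.
  apply: hilbert_poly_eq; exists n2 => n hn; rewrite hp' //.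
  by rewrite (has_length_length_quot _ _ (hl' n)) //; apply: (@pow_smul_submod S S^o).
have e2 : hilbert_poly (star a setT) (star b setT : set R^o) = p + (va * q)%:R%:P.
  (* Starting at [n1.+1] excludes n = 0, where the increment of l_n is min(va, vb) instead of va. *)
  apply: hilbert_poly_eq; exists n1.+1 => -[//|n] hn.
  have h := has_length_pow_star ia ib Cc ac bc hva hvb (hl n.+1).
  rewrite (has_length_length_quot _ _ h); [|exact: (@pow_smul_submod R R^o)..].
  rewrite hornerD hornerC hp; last exact: ltnW.
  have -> : (va * n.+1 + minn va vb - (va * n + minn va vb) = va)%N by rewrite mulnS; lia.
  by rewrite natrD addrC.
rewrite /multiplicity (krull_dim_star hN) e1 e2 coefD coef mulrDr; congr (_ + _).
rewrite coefC; have [->|d1] := eqVneq (krull_dim S) 1%N; first by rewrite /= mul1r.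
case: (krull_dim S) krull_dim_pos d1 => [//|[//|d]] _ _ /=.
by rewrite mulr0.
Qed.

End TwistedInvariants.

Lemma extension_ideal (A B : comNzRingType) (f : A -> B) (I : set A) : is_ideal (extension f I).
Proof. exact: span_submod. Qed.

Lemma mem_extension (A B : comNzRingType) (f : A -> B) (I : set A) r : I r -> extension f I (f r).
Proof. by move=> Ir; apply: (@sub_span B B^o); exists r. Qed.

(** Modulo c, hence modulo [a], each element of [N] agrees with one coming from [R], and congruent
    elements have congruent powers. *)
Lemma M_radical_dense (S R : comNzRingType) (jR : {rmorphism R -> S}) (N a : set S) (c : S) :
  is_ideal N -> is_ideal a -> a `<=` N -> a c ->
  (forall s, exists r t, s = jR r + c * t) ->
  (forall r, N (jR r) -> exists k, a (jR r ^+ k)) -> M_radical N a.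
Proof.
move=> iN ia aN ac dense h s Ns; have [r [t es]] := dense s.
have act : a (c * t) by apply: idealMr.
have [|k hk] := h r.
  by rewrite -(addrK (c * t) (jR r)) -es; apply: idealB => //; apply: aN.
exists k; have step e : a (s ^+ e - jR r ^+ e).
  elim: e => [|e IH]; first by rewrite subrr; apply: ideal0.
  have -> : s ^+ e.+1 - jR r ^+ e.+1 = s * (s ^+ e - jR r ^+ e) + jR r ^+ e * (c * t).
    by rewrite !exprS es; ring.
  by apply: idealD => //; apply: idealMl.
by rewrite -(subrK (jR r ^+ k) (s ^+ k)); apply: idealD.
Qed.

(** The premise [~ I 1] of the first formula excludes I = R, where both numbers of generators are 1
    although [m * rK] may be positive. *)
Theorem theorem7p1
  (S V : idomainType) (R : comNzRingType)
  (jS : {rmorphism S -> V}) (jV : {rmorphism V -> {fraction S}})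
  (jR : {rmorphism R -> S})
  (N : set S) (MV : set V) (M : set R)
  (K : lmodType V) (C : set S) (m : nat) (I J : set R)
  (S_local : local_ring N) (S_noeth : noetherian S)
  (V_dvr : is_dvr MV) (V_dom : birationally_dominates jS jV N MV)
  (V_deg : has_fiber_dim (restrict_scalars jS V^o) N m)
  (K_neq0 : exists k : K, k <> 0) (K_tf : torsion_free K)
  (K_rank : finite_rank K)
  (jR_inj : injective jR) (R_noeth : noetherian R)
  (R_twisted : twisted (restrict_scalars jS K) C (range jR))
  (C_nonunit : exists2 c : S, C c & c \isn't a GRing.unit)
  (M_max : is_maximal M)
  (I_ideal : is_ideal I) (J_ideal : is_ideal J)
  (I_contr : contracted jR I) (J_contr : contracted jR J)
  (J_primary : is_primary M J) (I_meets_C : exists2 r : R, I r & C (jR r)) :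
  let rK := fiber_dim K MV in
  let IS := extension jR I in
  let JS := extension jR J in
  let JV := extension (jS \o jR) J in
  local_ring M /\
  [/\ ~ I 1 -> mu (I : set R^o) = (mu (IS : set S^o) + m * rK)%N,
      emb_dim M = (emb_dim N + m * rK)%N,
      multiplicity J (I : set R^o) =
        multiplicity JS [set: S^o] +
        (if krull_dim S == 1%N
         then (rK * length_quot [set: restrict_scalars jS V^o] JV)%:R
         else 0)
    & ring_multiplicity M =
        ring_multiplicity N +
        (if krull_dim S == 1%N then (m * rK)%:R else 0)].
Proof.
move=> rK IS JS JV.
have [jV_inj jV_jS MV_N] := V_dom.
have jS_inj : injective jS.
  move=> s s' e; apply/eqP; rewrite -tofrac_eq -!jV_jS e; exact: eqxx.
have V_noeth := dvr_noetherian V_dvr; have V_local := dvr_local V_dvr.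
have [x [x_neq0 MVx V_factor]] := dvr_uniformizer V_dvr.
have iMV := maximal_ideal V_local; have iN := maximal_ideal S_local.
have [C_mul C_reg _ _] := R_twisted.
have [dR tw] := twisted_twisting jR_inj R_twisted.
have C_neq0 c : C c -> c <> 0.
  by move=> /C_reg h c0; have /eqP := h 1 0 (etrans (mulr1 _) (etrans c0 (esym (mulr0 _)))); rewrite oner_eq0.
have [c0 C_c0 c0_nonunit] := C_nonunit.
have N_c0 : N c0.
  apply: contrapT => /(local_unit S_noeth S_local) [u hu].
  by move/negP: c0_nonunit; apply; apply/unitrPr; exists u; rewrite mulrC.
have V_tf : torsion_free V^o.
  by move=> a v /eqP; rewrite [_ *: _]/(a * v) mulf_eq0 => /orP[/eqP ->|/eqP ->]; [left|right].
have MVE : MV = @xmul V x V^o 1.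
  apply/seteqP; split=> v; first by move=> /MVx [w ->]; exists w; rewrite expr1 mulrC.
  by move=> [w ->]; apply/MVx; exists w; rewrite expr1 mulrC.
have [t hN] := has_val_exists V_factor jS_inj N_c0 (C_neq0 _ C_c0).
have t_gt0 : (0 < t)%N.
  case: t hN => [|//] [_ [s [v [Ns]]]]; rewrite expr0 => e; case: (maximal_proper V_local).
  by rewrite -e; apply: idealMl => //; rewrite -MV_N in Ns.
have smulN (L : lmodType V) : smul N (setT : set (restrict_scalars jS L)) = @xmul V x L t.
  by rewrite -[setT](@xmul0 V x L) (smul_has_val L 0 hN) addn0.
have rsub (L : lmodType V) l := @xmul_rsubmod S V jS x L l.
have len_NV : has_length [set: restrict_scalars jS V^o] (@xmul V x V^o t) m.
  have [y hy] := V_deg.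
  have hN1 : has_length [set: restrict_scalars idfun S^o] (N : set (restrict_scalars idfun S^o)) 1.
    apply/(@has_length_restrict_id S S^o N setT) => //.
    exact: has_length_maximal S_local.
  apply/(@has_length_restrict_id S (restrict_scalars jS V^o) _ setT) => //; first exact: rsub.
  by have := has_length_fiber iN hy hN1; rewrite muln1 smulN.
(* V / NV = V / x^t V has t layers isomorphic to V / xV, each of length e over [S]. *)
have [e [len_V em]] : exists e, has_length [set: restrict_scalars jS V^o] (@xmul V x V^o 1) e /\ m = (t * e)%N.
  have [_ [e [_ he _]]] := has_length_split (rsub V^o t) (@submodT _ _) (rsub V^o 1%N)
    (@xmul_le V x V^o _ _ t_gt0) (@subsetT _ _) len_NV.
  exists e; split=> //; apply: has_length_uniq len_NV _.
  by have := has_length_xmul x_neq0 V_tf he 0 t; rewrite xmul0.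
have [y hy] : has_fiber_dim K MV rK.
  by apply: xgetPex; apply: fiber_dim_exists V_noeth V_local MVx V_factor x_neq0 K_tf K_rank.
have len_K : has_length [set: restrict_scalars jS K] (@xmul V x K 1) (rK * e).
  have -> : @xmul V x K 1 = smul MV setT.
    apply/seteqP; split=> [_ [k ->]|k /(smul_uniformizer MVx) [k' ->]].
      by apply/(smul_uniformizer MVx); exists k; rewrite expr1.
    by exists k'; rewrite expr1.
  by apply: (has_length_fiber iMV hy); rewrite MVE.
have MlocalE := maximal_eq_star S_local S_noeth tw M_max.
have starT (a : set S) r : star jR dR a setT r <-> a (jR r) by split=> [[]|].
have M_N r : M r <-> N (jR r) by rewrite MlocalE starT.
have iIS : is_ideal IS by apply: extension_ideal.
have iJS : is_ideal JS by apply: extension_ideal.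
have IE : I = star jR dR IS setT by apply/seteqP; split=> r; rewrite starT {1}I_contr.
have JE : J = star jR dR JS setT by apply/seteqP; split=> r; rewrite starT {1}J_contr.
have local_M : local_ring M by rewrite MlocalE; apply: (star_local S_local S_noeth tw).
have [_ J1 _ radJ] := J_primary.
have ext_N (Q : set R) : is_ideal Q -> ~ Q 1 -> extension jR Q `<=` N.
  move=> iQ Q1; apply: (@span_min S S^o _ _ iN) => _ [r Qr <-].
  by apply/M_N; apply: (local_proper R_noeth local_M iQ Q1).
have JN : JS `<=` N by apply: ext_N.
(* [c0] comes from an element of M = rad J, so some power of it lies in JS; exponent 0 would put 1
   in [J]. *)
have [c1 C_c1 JS_c1] : exists2 c1, C c1 & JS c1.
  have [r0 er0 _] := tw_C tw C_c0.
  have : M r0 by apply/M_N; rewrite er0.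
  rewrite -radJ => -[[|k] hk]; first by case: J1.
  exists (c0 ^+ k.+1); last by rewrite -er0 -rmorphXn; apply: mem_extension.
  by elim: (k) => [//|k' IH]; rewrite exprS; apply: C_mul.
have [r2 I_r2 C_r2] := I_meets_C.
have C_c : C (c1 * jR r2) by apply: C_mul.
have JS_c : JS (c1 * jR r2) by apply: (idealMr _ iJS).
have IS_c : IS (c1 * jR r2) by apply: (idealMl _ iIS); apply: mem_extension.
have rad_JS : M_radical N JS.
  apply: (M_radical_dense (jR := jR) iN iJS JN JS_c1).
    by move=> s; have [r [u [_ ->]]] := tw_dense tw s C_c1; exists r, u.
  move=> r /M_N; rewrite -radJ => -[k hk]; exists k.
  by rewrite -rmorphXn; apply: mem_extension.
have rad_N : M_radical N N by move=> s Ns; exists 1%N.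
have [a hJ] := has_val_exists V_factor jS_inj JS_c (C_neq0 _ C_c).
have tq : (t * (rK * e) = m * rK)%N by rewrite em; ring.
have JV_E : JV = @xmul V x V^o a.
  have [h1 [s [v [Js es]]]] := hJ.
  apply/seteqP; split.
    apply: (@span_min V V^o _ _ (xmul_submod x V^o a)) => _ [r Jr <-].
    have [w ew] := h1 _ (@mem_extension _ _ jR J r Jr).
    by exists w; rewrite /= ew mulrC.
  (* The element of least value is only known to lie in JS, so JS is first mapped into [JV]. *)
  have JV_JS : forall s, JS s -> JV (jS s).
    have iP : is_submod [set s : S^o | JV (jS s)].
      split; first by rewrite /= rmorph0; apply: ideal0 (extension_ideal _ _).
      move=> u w z hw hz; rewrite /= rmorphD rmorphM.
      by apply: (extension_ideal _ _).2.
    apply: (span_min iP) => _ [r Jr <-].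
    exact: (@mem_extension R V (jS \o jR)).
  move=> _ [w ->]; rewrite -es -[_ *: _]/(v * jS s * w) mulrAC.
  by apply: (idealMl _ (extension_ideal _ _)); apply: JV_JS.
have len_JV : length_quot [set: restrict_scalars jS V^o] JV = (a * e)%N.
  rewrite JV_E; apply: (@has_length_length_quot S _ _ _ _ (rsub V^o a) (@submodT _ _)).
  by have := has_length_xmul x_neq0 V_tf len_V 0 a; rewrite xmul0.
have mult := multiplicity_star S_local S_noeth R_noeth V_factor x_neq0 jS_inj K_tf len_K tw
  C_neq0 C_c0 N_c0.
have mu_eq := mu_star S_local S_noeth R_noeth x_neq0 K_tf len_K tw.
split=> //; split.
- move=> I1; rewrite {1}IE -tq; apply: (mu_eq _ _ _ iIS (ext_N _ I_ideal I1) C_c IS_c hN).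
- rewrite /emb_dim MlocalE -tq; exact: (mu_eq _ _ _ iN (fun s h => h) C_c0 N_c0 hN).
- rewrite {1}JE {1}IE (mult _ _ _ _ _ iJS iIS JN rad_JS C_c JS_c IS_c hJ hN).
  by rewrite len_JV mulnCA.
rewrite /ring_multiplicity -tq.
(* This is the case of [M] acting on the unit ideal, with [c0] as the common element of [C]. *)
have -> : [set: R^o] = star jR dR setT setT by apply/seteqP; split.
rewrite MlocalE; exact: (mult _ _ _ _ _ iN (@idealT S) (fun s h => h) rad_N C_c0 N_c0 Logic.I hN hN).
Qed.
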